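(* Let $\mathcal A=\mathcal A(\alpha)\subset\mathbb P^2$ be an irreducible line arrangement with $n$ lines. Then the following are equivalent: (1) $\mathcal A$ is not formal; (2) $\mathcal M(\alpha)$ has non-trivial weak perspective representations (up to rank $3$); (3) $\operatorname{reg}(D_0(\mathcal A))=n-2$.
   Context: $\mathbb K$ is a field of characteristic zero, $V=\mathbb K^3$, $S=\mathbb K[x,y,z]$. A line arrangement $\mathcal A=\mathcal A(\alpha)$ is given by a map $\alpha:\{1,\dots,n\}\to V^*$ whose values are nonzero linear forms defining pairwise distinct lines $H_i=\mathbb V(\alpha_i)\subset\mathbb P^2$; $Q=\prod_i\alpha_i$. $\mathcal M(\alpha)$ is the linear matroid on $\{1,\dots,n\}$ of $\alpha_1,\dots,\alpha_n$. $\mathcal A$ is irreducible if it does not split as a product of arrangements of strictly smaller dimension; $\mathcal A$ splits as a product if and only if, after a suitable linear change of coordinates, there are nontrivial partitions $Y_1\sqcup Y_2=\{x,y,z\}$ and $Z_1\sqcup Z_2=\{\alpha_1,\dots,\alpha_n\}$ such that the forms in $Z_i$ involve only the variables in $Y_i$ ($i=1,2$). $\mathcal A$ is formal if the space of linear relations $\{c\in\mathbb K^n:\sum c_i\alpha_i=0\}$ is spanned by relations with exactly three nonzero entries. $D_0(\mathcal A)=\{\theta\in\mathrm{Der}_{\mathbb K}(S):\theta(Q)=0\}$, graded by the degree of the polynomial coefficients of $\theta$. For a finitely generated graded $S$-module $M$ with graded Betti numbers $b_{i,j}(M)$ (so the $i$th term of the minimal graded free resolution is $\bigoplus_jS(-j)^{b_{i,j}(M)}$),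 the Castelnuovo–Mumford regularity is $\operatorname{reg}(M)=\max\{j-i:b_{i,j}(M)\ne0\}$. Truncation: $\mathcal N^{[3]}$ is the matroid whose independent sets are the independent sets of $\mathcal N$ of size at most $3$. A map $\beta:\{1,\dots,n\}\to V^*$ is a weak representation of $\mathcal M(\alpha)$ up to rank $3$ if every dependent set of $\mathcal M(\alpha)^{[3]}$ is dependent in $\mathcal M(\beta)^{[3]}$. Fix a line $H_0=\mathbb V(\alpha_0)$ not in $\mathcal A$ and containing no intersection point of two lines of $\mathcal A$. The space of weak perspective representations of $\mathcal M(\alpha)$ is the set of $\lambda\in\mathbb K^n$ such that $\beta_j=\alpha_j+\lambda_j\alpha_0$ is a weak representation of $\mathcal M(\alpha)$ up to rank $3$; it is a linear subspace that does not depend on the choice of $H_0$. The trivial ones are those with $\lambda=(\alpha_1(\mathbf v),\dots,\alpha_n(\mathbf v))$ for some $\mathbf v\in\mathbb K^3$. $\mathcal M(\alpha)$ has non-trivial weak perspective representations if the quotient of this space by the trivial ones is nonzero. *)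

(* Defs.v *)
From HB Require Import structures.
From mathcomp Require Import all_boot all_order all_algebra.
From mathcomp Require Import mpoly.

Set Implicit Arguments.
Unset Strict Implicit.
Unset Printing Implicit Defensive.

Import Order.TTheory GRing.Theory Num.Theory.

Local Open Scope ring_scope.

(* Conventions: V = K^3 consists of column vectors, V^* of row vectors, and the
   linear form a takes the value (a *m v) 0 0 at v. Points of P^2 are given by
   homogeneous coordinates, i.e. nonzero column vectors. *)

Section Arrangements.
Variables (K : fieldType) (n : nat).
Implicit Types (a : 'rV[K]_3) (alpha beta : 'I_n -> 'rV[K]_3).

Definition line a : pred 'cV[K]_3 := fun p => (p != 0) && (a *m p == 0).

Definition line_arrangement alpha : Prop :=
  (forall i, alpha i != 0) /\
  (forall i j, i != j -> ~ (line (alpha i) =1 line (alpha j))).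

(* The columns of g give the new coordinates: the k-th coordinate of alpha i in the
   new basis of V^* is (alpha i *m g) 0 k. The partitions are Y, ~: Y and
   Z, ~: Z, with all four parts nonempty. *)
Definition splits alpha : Prop :=
  exists (g : 'M[K]_3) (Y : {set 'I_3}) (Z : {set 'I_n}),
    [/\ g \in unitmx,
        (Y != set0) && (~: Y != set0),
        (Z != set0) && (~: Z != set0),
        forall i k, i \in Z -> k \notin Y -> (alpha i *m g) 0 k = 0
      & forall i k, i \notin Z -> k \in Y -> (alpha i *m g) 0 k = 0].

Definition irreducible_arrangement alpha : Prop := ~ splits alpha.

Definition linear_relation alpha (c : 'rV[K]_n) : bool :=
  \sum_i c 0 i *: alpha i == 0.

Definition three_term (c : 'rV[K]_n) : bool := #|[set i | c 0 i != 0]| == 3.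

Definition formal alpha : Prop :=
  forall c, linear_relation alpha c ->
    exists2 s : seq 'rV[K]_n,
      all (fun r => linear_relation alpha r && three_term r) s
      & c \in <<s>>%VS.

(* Matroids on {1, ..., n} are given by their families of independent sets. *)
Definition linear_matroid alpha : {set {set 'I_n}} :=
  [set I : {set 'I_n} | free [seq alpha i | i in I]].

Definition truncation (r : nat) (N : {set {set 'I_n}}) : {set {set 'I_n}} :=
  [set I in N | #|I| <= r]%N.

Definition weak_representation alpha beta : Prop :=
  forall D : {set 'I_n},
    D \notin truncation 3 (linear_matroid alpha) ->
    D \notin truncation 3 (linear_matroid beta).

(* Admissible auxiliary lines H_0 = V(a0). *)
Definition generic_line alpha a0 : Prop :=
  [/\ a0 != 0,
      forall i, ~ (line a0 =1 line (alpha i))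
    & forall i j p, i != j ->
        line (alpha i) p -> line (alpha j) p -> ~~ line a0 p].

Definition weak_perspective alpha a0 (lambda : 'rV[K]_n) : Prop :=
  weak_representation alpha (fun j => alpha j + lambda 0 j *: a0).

Definition trivial_perspective alpha (lambda : 'rV[K]_n) : Prop :=
  exists v : 'cV[K]_3, forall j, lambda 0 j = (alpha j *m v) 0 0.

(* The quotient by the subspace of trivial ones is nonzero. *)
Definition has_nontrivial_weak_perspective alpha a0 : Prop :=
  exists2 lambda, weak_perspective alpha a0 lambda
                & ~ trivial_perspective alpha lambda.

Definition linear_form_poly a : {mpoly K[3]} := \sum_k a 0 k *: 'X_k.

Definition defining_poly alpha : {mpoly K[3]} :=
  \prod_i linear_form_poly (alpha i).

(* Der_K(S) is the free S-module S^3 on the partial derivatives. *)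
Definition derivation_apply (theta : 'rV[{mpoly K[3]}]_3) (f : {mpoly K[3]}) :
  {mpoly K[3]} := \sum_k theta 0 k * f^`M(k).

Definition D0 alpha : pred 'rV[{mpoly K[3]}]_3 :=
  fun theta => derivation_apply theta (defining_poly alpha) == 0.

End Arrangements.

(* Regularity of a graded submodule M of S^m, where S = K[X_0, ..., X_(v-1)] and
   S^m is graded by the degree of the coordinates. *)
Section Regularity.
Variables (K : fieldType) (v : nat).
Local Notation S := {mpoly K[v]}.

Definition homog_of_degree (e : int) (p : S) : bool :=
  match e with
  | Posz d => p \is d.-homog
  | Negz _ => p == 0
  end.

(* The i-th free module is the direct sum over k of S(-(gfc_shift i)_k), and
   maps act on row vectors from the right. Resolutions are infinite to the left;
   an empty list of shifts encodes the zero module. *)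
Record graded_free_complex (m : nat) := GradedFreeComplex {
  gfc_shift : nat -> seq int;
  gfc_diff : forall i, 'M[S]_(size (gfc_shift i.+1), size (gfc_shift i));
  gfc_aug : 'M[S]_(size (gfc_shift 0), m)
}.

Definition degree_preserving m (F : graded_free_complex m) : Prop :=
  (forall i (k : 'I_(size (gfc_shift F i.+1))) (l : 'I_(size (gfc_shift F i))),
     homog_of_degree (nth 0 (gfc_shift F i.+1) k - nth 0 (gfc_shift F i) l)
                     (gfc_diff F i k l)) /\
  (forall (k : 'I_(size (gfc_shift F 0))) (l : 'I_m),
     homog_of_degree (nth 0 (gfc_shift F 0) k) (gfc_aug F k l)).

Definition resolves m (F : graded_free_complex m) (M : pred 'rV[S]_m) : Prop :=
  [/\ forall x, M x <-> exists u, x = u *m gfc_aug F,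
      forall u : 'rV_(size (gfc_shift F 0)),
        u *m gfc_aug F = 0 <-> exists w, u = w *m gfc_diff F 0
    & forall i (u : 'rV_(size (gfc_shift F i.+1))),
        u *m gfc_diff F i = 0 <-> exists w, u = w *m gfc_diff F i.+1].

(* All entries of the differentials lie in the irrelevant maximal ideal. *)
Definition minimal m (F : graded_free_complex m) : Prop :=
  forall i k l, (gfc_diff F i k l)@_0%MM = 0.

Definition minimal_graded_free_resolution m (F : graded_free_complex m)
    (M : pred 'rV[S]_m) : Prop :=
  [/\ degree_preserving F, resolves F M & minimal F].

Definition betti m (F : graded_free_complex m) (i : nat) (j : int) : nat :=
  count_mem j (gfc_shift F i).

(* reg M = r. It is a relation rather than a function; minimal graded free
   resolutions are unique up to isomorphism, so r does not depend on F. *)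
Definition has_regularity m (M : pred 'rV[S]_m) (r : int) : Prop :=
  exists2 F : graded_free_complex m,
    minimal_graded_free_resolution F M
    & (exists i j, betti F i j != 0%N /\ r = j - i%:Z) /\
      (forall i j, betti F i j != 0%N -> j - i%:Z <= r).

End Regularity.

(* Main.v *)
(* The module D of logarithmic derivations is the kernel of the evaluation
   S^3 -> (+)_i S/(alpha i); let C be its cokernel. With E the Euler derivation,
   D is the direct sum of D0 and S E. Linear duality identifies the
   values lam in K^n that are linear at each intersection point with the
   functionals on K^n that kill all three-term relations; modulo the globally
   linear ones they measure the failure of formality, they are the weak
   perspectives, and they form the degree 0 part of H^0_m(C) = H^2_m(D0).

   D0 has a resolution 0 -> F1 -> F0 -> D0, since it is the kernel of a map of free
   modules over a polynomial ring in three variables. The pairing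
   <th, et> = det(E, th, et) / Q identifies D0 with Hom(D0, S) up to a shift by
   n - 1, whence Ext^1(D0, S) = H^2_m(Hom(D0, S)) = H^0_m(C) with a shift. As C
   lives in degrees >= 0, all generators of F1 have degree at most n - 1, and the
   value n - 1 occurs exactly when there is a nontrivial weak perspective. A
   generator of F0 of too high a degree would be isolated, and by self-duality
   would produce a nonzero element of D0 of degree at most 1, which irreducibility
   forbids. *)
Require Import Defs.
From HB Require Import structures.
From mathcomp Require Import all_boot all_order all_algebra.
From mathcomp Require Import ring zify.
From mathcomp Require Import mpoly.
From Stdlib Require Import Classical.

Set Implicit Arguments.
Unset Strict Implicit.
Unset Printing Implicit Defensive.

Import Order.TTheory GRing.Theory Num.Theory.
Local Open Scope ring_scope.

(** * Homogeneous components of polynomials *)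

(** No derived functor is formed. The comparison of Ext^1(D0, S) with H^0_m(C) is a relation,
    [corresponds], between representatives, with the Koszul complex of high powers of the variables
    in the role of the Cech complex. It need not be a function: it is enough that classes on either
    side have partners and that triviality passes to partners, in each degree separately. The
    exponent of those powers exists because the product of the alpha_i not vanishing at a point p
    kills the obstruction at p. K-rational points suffice here, since only linear forms over K are
    inverted. The number n - 1 is deg Q - deg E: pairing degrees a and b gives degree a + b + 1 - n.
    Characteristic zero enters by making n invertible, which splits D into D0 and S E. Splitting
    asks for forms on both sides, so three or more concurrent lines count as irreducible. That the
    lines are not concurrent has to be derived: from a nontrivial perspective in one direction, from
    the degree bound on the generators in the other. *)

Section HomogeneousComponents.
Variables (K : fieldType) (v : nat).
Local Notation S := {mpoly K[v]}.
Implicit Types (p q : S) (d e : int).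

(** Degrees are integers, so that differences of shifts need no case distinction; in negative degree
    the component is 0, in agreement with [homog_of_degree]. *)
Definition hcomp e p : S := if e is Posz d then pihomog (@mdeg v) d p else 0.

Lemma mcoeff_hcomp e p m :
  (hcomp e p)@_m = if (mdeg m)%:Z == e then p@_m else 0.
Proof.
case: e => [d|d] /=; last by rewrite mcoeff0.
have -> : ((mdeg m)%:Z == d%:Z) = (mdeg m == d) by [].
rewrite pihomogE raddf_sum big_mkcond /=.
have [mp | mp] := boolP (m \in msupp p); last first.
  rewrite (memN_msupp_eq0 mp) if_same big1_seq // => m' /= m'p.
  rewrite mcoeffZ mcoeffX; case: (m' =P m) => [E|]; last by rewrite mulr0 if_same.
  by rewrite -E m'p in mp.
rewrite (bigD1_seq m) ?msupp_uniq //= big1 => [|m' /negbTE nm].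
  by rewrite mcoeffZ mcoeffX eqxx mulr1 addr0.
by rewrite mcoeffZ mcoeffX nm mulr0 if_same.
Qed.

Lemma hcomp_is_zmod_morphism e : zmod_morphism (hcomp e).
Proof.
move=> p q; apply/mpolyP => m; rewrite mcoeffB !mcoeff_hcomp mcoeffB.
by case: ifP; rewrite ?subrr.
Qed.

HB.instance Definition _ e :=
  GRing.isZmodMorphism.Build S S (hcomp e) (hcomp_is_zmod_morphism e).

Lemma homog_of_degreeP e p :
  reflect (forall m, p@_m != 0 -> (mdeg m)%:Z = e) (homog_of_degree e p).
Proof.
case: e => [d|d] /=.
  apply: (iffP (dhomogP _ _ _)) => H m.
    by rewrite -mcoeff_msupp => /H ->.
  by rewrite mcoeff_msupp => /H [].
apply: (iffP eqP) => [-> m|H]; first by rewrite mcoeff0 eqxx.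
apply/mpolyP => m; rewrite mcoeff0; apply/eqP/negPn/negP => /H.
by [].
Qed.

Lemma homog_hcomp e p : homog_of_degree e (hcomp e p).
Proof.
by apply/homog_of_degreeP => m; rewrite mcoeff_hcomp; case: ((mdeg m)%:Z =P e) => //; rewrite eqxx.
Qed.

Lemma hcomp_homog d e p :
  homog_of_degree e p -> hcomp d p = if d == e then p else 0.
Proof.
move=> /homog_of_degreeP H; apply/mpolyP => m; rewrite mcoeff_hcomp.
rewrite [RHS](fun_if (mcoeff m)) mcoeff0.
have [/eqP->|/H ->] := boolP (p@_m == 0); first by rewrite !if_same.
by rewrite eq_sym.
Qed.

Lemma homog0 e : homog_of_degree e (0 : S).
Proof. by apply/homog_of_degreeP => m; rewrite mcoeff0 eqxx. Qed.

Lemma homogD e p q :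
  homog_of_degree e p -> homog_of_degree e q -> homog_of_degree e (p + q).
Proof.
move=> /homog_of_degreeP Hp /homog_of_degreeP Hq.
apply/homog_of_degreeP => m; rewrite mcoeffD.
have [/eqP->|/Hp //] := boolP (p@_m == 0).
by rewrite add0r => /Hq.
Qed.

Lemma homogN e p : homog_of_degree e p -> homog_of_degree e (- p).
Proof.
by move=> /homog_of_degreeP Hp; apply/homog_of_degreeP => m; rewrite mcoeffN oppr_eq0 => /Hp.
Qed.

Lemma homogB e p q :
  homog_of_degree e p -> homog_of_degree e q -> homog_of_degree e (p - q).
Proof. by move=> hp hq; apply: homogD => //; apply: homogN. Qed.

Lemma homogZ e (c : K) p : homog_of_degree e p -> homog_of_degree e (c *: p).
Proof.
move=> /homog_of_degreeP Hp; apply/homog_of_degreeP => m; rewrite mcoeffZ.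
by rewrite mulf_eq0 negb_or => /andP[_ /Hp].
Qed.

Lemma homog_sum (I : finType) (P : pred I) (F : I -> S) e :
  (forall i, P i -> homog_of_degree e (F i)) ->
  homog_of_degree e (\sum_(i | P i) F i).
Proof. by move=> H; apply: (big_ind (fun p => homog_of_degree e p)) => //; [exact: homog0 | exact: homogD]. Qed.

Lemma homogX m : homog_of_degree (mdeg m)%:Z ('X_[m] : S).
Proof. by apply/homog_of_degreeP => m'; rewrite mcoeffX; case: (m =P m') => [->|]; rewrite ?eqxx. Qed.

Lemma homogM d e p q :
  homog_of_degree d p -> homog_of_degree e q -> homog_of_degree (d + e) (p * q).
Proof.
move=> /homog_of_degreeP Hp /homog_of_degreeP Hq; apply/homog_of_degreeP => m.
rewrite -mcoeff_msupp => /msuppM_le /allpairsP[[m1 m2] /= [m1p m2q ->]].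
rewrite mdegD PoszD Hp ?Hq //; rewrite -mcoeff_msupp //.
Qed.

Lemma homog1 : homog_of_degree 0 (1 : S).
Proof. by rewrite -mpolyX0; have := homogX 0%MM; rewrite mdeg0. Qed.

Lemma homogXn d (n : nat) p : homog_of_degree d p -> homog_of_degree (d * n%:Z) (p ^+ n).
Proof.
move=> hp; elim: n => [|n IH]; first by rewrite mulr0 expr0 homog1.
by rewrite exprS -addn1 PoszD mulrDr mulr1 addrC; apply: homogM.
Qed.

Lemma homogXU (i : 'I_v) : homog_of_degree 1 ('X_i : S).
Proof. by have := homogX U_(i)%MM; rewrite mdeg1. Qed.

(** The tool for grading: components are taken of an ungraded identity, and a homogeneous
    coefficient only shifts the degree. *)
Lemma hcompM d e p q :
  homog_of_degree e q -> hcomp (d + e) (p * q) = hcomp d p * q.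
Proof.
move=> hq; rewrite {1 2}(mpolyE p) !mulr_suml !raddf_sum mulr_suml /=.
apply: eq_bigr => m _; set c := p@_m.
have hm : homog_of_degree (mdeg m)%:Z (c *: 'X_[m] : S) by apply/homogZ/homogX.
rewrite (hcomp_homog _ hm) (hcomp_homog _ (homogM hm hq)) (inj_eq (addIr e)).
by case: ifP => _; rewrite ?mul0r.
Qed.

Lemma homog_neg e p : homog_of_degree e p -> (e < 0)%R -> p = 0.
Proof. by case: e => // e /eqP. Qed.

Lemma homog_const p : homog_of_degree 0 p -> p = (p@_0%MM)%:MP.
Proof.
move=> /homog_of_degreeP H; apply/mpolyP => m; rewrite mcoeffC.
have [->|m0] := eqVneq m 0%MM; first by rewrite mulr1.
rewrite mulr0; apply/eqP/negPn/negP => /H [] /eqP.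
by rewrite mdeg_eq0 (negbTE m0).
Qed.

End HomogeneousComponents.

(** * Ideals generated by powers of variables *)

Section MonomialIdeals.
Variables (K : fieldType) (v : nat).
Local Notation S := {mpoly K[v]}.
Implicit Types (f g h : S) (A : pred 'I_v).

(** The ideal generated by the N-th powers of the variables in [A], tested on monomials, where it is
    evident that the other variables are nonzerodivisors modulo it. *)
Definition in_powers (N : nat) A f :=
  forall m, f@_m != 0 -> exists2 i, A i & (N <= m i)%N.

Lemma in_powers0 N A : in_powers N A 0.
Proof. by move=> m; rewrite mcoeff0 eqxx. Qed.

Lemma in_powersD N A f g : in_powers N A f -> in_powers N A g -> in_powers N A (f + g).
Proof.
move=> Hf Hg m; rewrite mcoeffD; have [/eqP->|/Hf //] := boolP (f@_m == 0).
by rewrite add0r => /Hg.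
Qed.

Lemma in_powers_gen N A (i : 'I_v) h : A i -> in_powers N A (h * 'X_i ^+ N).
Proof.
move=> Ai m; rewrite -mcoeff_msupp mpolyXn (perm_mem (msuppMX _ _)).
case/mapP => m' _ ->; exists i => //.
by rewrite mnmDE mulmnE mnm1E eqxx mul1n leq_addr.
Qed.

Lemma in_powersP N A f :
  in_powers N A f <-> exists h : 'I_v -> S, f = \sum_(i | A i) h i * 'X_i ^+ N.
Proof.
split=> [H|[h ->]]; last first.
  apply: big_ind => [|? ?|i Ai]; [exact: in_powers0 | exact: in_powersD |].
  exact: in_powers_gen.
rewrite (mpolyE f) big_seq.
apply: (big_ind (fun g => exists h : 'I_v -> S, g = \sum_(i | A i) h i * 'X_i ^+ N)).
- by exists (fun=> 0); rewrite big1 // => i _; rewrite mul0r.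
- move=> _ _ [h1 ->] [h2 ->]; exists (fun i => h1 i + h2 i).
  by rewrite -big_split /=; apply: eq_bigr => i _; rewrite mulrDl.
- move=> m; rewrite mcoeff_msupp => /H [i Ai Nm].
  exists (fun j => if j == i then f@_m *: 'X_[m - U_(i) *+ N] else 0).
  rewrite (bigD1 i) //= eqxx big1 ?addr0 => [|j /andP[_ /negbTE->]]; last by rewrite mul0r.
  rewrite mpolyXn -scalerAl -mpolyXD submK //.
  apply/mnm_lepP => j; rewrite mulmnE mnm1E; case: eqP => [<-|_]; rewrite ?mul1n ?mul0n //.
Qed.

Lemma in_powers_reg N A (j : 'I_v) f :
  ~~ A j -> in_powers N A (f * 'X_j ^+ N) -> in_powers N A f.
Proof.
move=> nAj H m fm.
have [|i Ai] := H (U_(j) *+ N + m)%MM; first by rewrite mpolyXn mcoeffMX.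
rewrite mnmDE mulmnE mnm1E; case: eqP => [E|_]; first by rewrite E Ai in nAj.
by rewrite mul0n add0n; exists i.
Qed.

End MonomialIdeals.

(** * The Koszul complex of the powers of the variables *)

Notation o0 := (@Ordinal 3 0 isT).
Notation o1 := (@Ordinal 3 1 isT).
Notation o2 := (@Ordinal 3 2 isT).

Lemma sum3 (V : nmodType) (F : 'I_3 -> V) : \sum_k F k = F o0 + F o1 + F o2.
Proof.
rewrite !big_ord_recl big_ord0 addr0 addrA.
by congr (_ + _ + _); congr (F _); apply: val_inj.
Qed.

Lemma ord3_ind (P : 'I_3 -> Prop) : P o0 -> P o1 -> P o2 -> forall k, P k.
Proof.
move=> P0 P1 P2 [[|[|[|//]]] lt_k3].
- by have -> : Ordinal lt_k3 = o0 by apply: val_inj.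
- by have -> : Ordinal lt_k3 = o1 by apply: val_inj.
- by have -> : Ordinal lt_k3 = o2 by apply: val_inj.
Qed.

Section CrossProduct.
Variable R : comPzRingType.
Implicit Types a b u w z : 'rV[R]_3.

Definition dot u w : R := \sum_k u 0 k * w 0 k.

(** Makes det(u, w, z) available as [dot u (cross w z)], so that Cramer's rule becomes a family of
    identities for [ring]. *)
Definition cross u w : 'rV[R]_3 :=
  \row_k nth 0 [:: u 0 o1 * w 0 o2 - u 0 o2 * w 0 o1;
                   u 0 o2 * w 0 o0 - u 0 o0 * w 0 o2;
                   u 0 o0 * w 0 o1 - u 0 o1 * w 0 o0] k.

Lemma dotE u w : dot u w = u 0 o0 * w 0 o0 + u 0 o1 * w 0 o1 + u 0 o2 * w 0 o2.
Proof. exact: sum3. Qed.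

Lemma row3P u w : u 0 o0 = w 0 o0 -> u 0 o1 = w 0 o1 -> u 0 o2 = w 0 o2 -> u = w.
Proof. by move=> *; apply/rowP; apply: ord3_ind. Qed.

Lemma dotC u w : dot u w = dot w u.
Proof. by rewrite !dotE; ring. Qed.

Lemma dotZl c u w : dot (c *: u) w = c * dot u w.
Proof. by rewrite !dotE !mxE; ring. Qed.

Lemma dotBl u w z : dot (u - w) z = dot u z - dot w z.
Proof. by rewrite !dotE !mxE; ring. Qed.

Lemma dot0l u : dot 0 u = 0.
Proof. by rewrite dotE !mxE; ring. Qed.

Lemma dotDr u w z : dot z (u + w) = dot z u + dot z w.
Proof. by rewrite !dotE !mxE; ring. Qed.

Lemma dotZr c u w : dot w (c *: u) = c * dot w u.
Proof. by rewrite !dotE !mxE; ring. Qed.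

Lemma dotBr u w z : dot z (u - w) = dot z u - dot z w.
Proof. by rewrite !dotE !mxE; ring. Qed.

Lemma dot0r u : dot u 0 = 0.
Proof. by rewrite dotE !mxE; ring. Qed.

Lemma dot_mulmx (m : nat) (y : 'rV[R]_m) (A : 'M[R]_(m, 3)) w :
  dot (y *m A) w = \sum_i y 0 i * dot (row i A) w.
Proof.
under [RHS]eq_bigr => i _ do rewrite mulr_sumr.
rewrite exchange_big; apply: eq_bigr => k _.
by rewrite !mxE mulr_suml; apply: eq_bigr => i _; rewrite !mxE mulrA.
Qed.

Lemma eq_dot u w : (forall z, dot u z = dot w z) -> u = w.
Proof.
move=> H; apply/rowP => k; have := H (delta_mx 0 k).
rewrite /dot (bigD1 k) //= (bigD1 (P := xpredT) k) //= !big1 ?addr0 => [|i ik|i ik].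
- by rewrite !mxE !eqxx !mulr1.
- by rewrite !mxE (negbTE ik) andbF mulr0.
- by rewrite !mxE (negbTE ik) andbF mulr0.
Qed.

Lemma dot_cramer a u w z k :
  a 0 k * dot u (cross w z) =
  dot a u * cross w z 0 k + dot a w * cross z u 0 k + dot a z * cross u w 0 k.
Proof. by elim/ord3_ind: k; rewrite !dotE !mxE /=; ring. Qed.

Lemma dot_cross_cross a b u w :
  dot (cross a b) (cross u w) = dot a u * dot b w - dot a w * dot b u.
Proof. by rewrite !dotE !mxE /=; ring. Qed.

Lemma dot_crossC a u w : dot a (cross u w) = - dot u (cross a w).
Proof. by rewrite !dotE !mxE /=; ring. Qed.

Lemma dot_cross_same a u : dot a (cross u a) = 0.
Proof. by rewrite !dotE !mxE /=; ring. Qed.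

Lemma dot_cross_left a u : dot a (cross a u) = 0.
Proof. by rewrite !dotE !mxE /=; ring. Qed.

Lemma crossDr a u w : cross a (u + w) = cross a u + cross a w.
Proof. by apply: row3P; rewrite !mxE /= ?mxE; ring. Qed.

Lemma crossZr c u w : cross u (c *: w) = c *: cross u w.
Proof. by apply: row3P; rewrite !mxE /= ?mxE; ring. Qed.

Lemma crossZl c u w : cross (c *: u) w = c *: cross u w.
Proof. by apply: row3P; rewrite !mxE /= ?mxE; ring. Qed.

Lemma dot_cross_mod a u w h l : dot a (cross (u - h *: a) (w - l *: a)) = dot a (cross u w).
Proof. by rewrite !dotE !mxE /=; ring. Qed.

Lemma dot_cross_modl a u w h : dot a (cross (u - h *: a) w) = dot a (cross u w).
Proof. by rewrite !dotE !mxE /=; ring. Qed.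

Lemma vector_cramer a u w z :
  dot a (cross u w) *: z =
  dot a (cross z w) *: u - dot a (cross z u) *: w + dot z (cross u w) *: a.
Proof. by apply: row3P; rewrite !dotE !mxE /= ?mxE; ring. Qed.

Lemma dot_cross3 a b u z : dot z (cross u (cross a b)) = dot a z * dot u b - dot b z * dot u a.
Proof. by rewrite !dotE !mxE /=; ring. Qed.

End CrossProduct.

Ltac row3 := apply: row3P; rewrite ?mxE /= ?dotE ?mxE /=.

Section KoszulComplex.
Variables (R : comPzRingType) (x : 'I_3 -> R) (p q : nat).
Implicit Types t : 'I_3 -> 'M[R]_(p, q).

(** The cross product of [t] with [x], matrix-valued: the middle map of the Koszul complex, between
    g |-> (x_a g) and f |-> sum of x_a f_a. *)
Definition koszul t (c : 'I_3) : 'M[R]_(p, q) :=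
  nth 0 [:: x o2 *: t o1 - x o1 *: t o2;
            x o0 *: t o2 - x o2 *: t o0;
            x o1 *: t o0 - x o0 *: t o1] c.

Lemma koszul_closed t : \sum_a x a *: koszul t a = 0.
Proof. by apply/matrixP => i j; rewrite sum3 /koszul /= !mxE; ring. Qed.

Lemma koszul_eq0 t :
  (forall a, koszul t a = 0) -> forall a b, x b *: t a = x a *: t b.
Proof.
move=> H a b; move: (H o0) (H o1) (H o2) => /= /subr0_eq E0 /subr0_eq E1 /subr0_eq E2.
by elim/ord3_ind: a; elim/ord3_ind: b; rewrite ?E0 ?E1 ?E2.
Qed.

Lemma koszul_pairs (P : 'M[R]_(p, q) -> Prop) t :
  P 0 -> (forall y, P y -> P (- y)) -> (forall c, P (koszul t c)) ->
  forall a b, P (x b *: t a - x a *: t b).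
Proof.
move=> P0 PN Pk; move: (Pk o0) (Pk o1) (Pk o2); rewrite /koszul /= => P12 P20 P01.
have PC y z : P (y - z) -> P (z - y) by move/PN; rewrite opprB.
move=> a b; elim/ord3_ind: a; elim/ord3_ind: b;
  by [rewrite subrr | exact: P12 | exact: P20 | exact: P01
      | apply: PC; exact: P12 | apply: PC; exact: P20 | apply: PC; exact: P01].
Qed.

Lemma koszulB t t' a : koszul (fun a => t a - t' a) a = koszul t a - koszul t' a.
Proof. by apply/matrixP => i j; elim/ord3_ind: a; rewrite /koszul /= !mxE; ring. Qed.

Lemma koszulZ c t a : koszul (fun a => c *: t a) a = c *: koszul t a.
Proof. by apply/matrixP => i j; elim/ord3_ind: a; rewrite /koszul /= !mxE; ring. Qed.

Lemma eq_koszul t t' : t =1 t' -> koszul t =1 koszul t'.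
Proof. by move=> E a; rewrite /koszul !E. Qed.

Lemma koszulX (g : 'M[R]_(p, q)) a : koszul (fun a => x a *: g) a = 0.
Proof. by apply/matrixP => i j; elim/ord3_ind: a; rewrite /koszul /= !mxE; ring. Qed.

End KoszulComplex.

Lemma koszul_mulmxl (R : comPzRingType) (x : 'I_3 -> R) p q r (B : 'M[R]_(r, p))
    (t : 'I_3 -> 'M[R]_(p, q)) a :
  koszul x (fun a => B *m t a) a = B *m koszul x t a.
Proof. by elim/ord3_ind: a; rewrite /koszul /= mulmxBr !scalemxAr. Qed.

Lemma koszul_mulmxr (R : comPzRingType) (x : 'I_3 -> R) p q r (B : 'M[R]_(q, r))
    (t : 'I_3 -> 'M[R]_(p, q)) a :
  koszul x (fun a => t a *m B) a = koszul x t a *m B.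
Proof. by elim/ord3_ind: a; rewrite /koszul /= mulmxBl !scalemxAl. Qed.

Section TripleProducts.
Variables (R : comPzRingType) (m : nat) (e : 'rV[R]_3) (A : 'M[R]_(m, 3)).
Implicit Types w z : 'rV[R]_3.

(* For e the Euler derivation this is Q times the pairing <row i A, w>. *)
Definition triple_col w : 'cV[R]_m := \col_i dot e (cross (row i A) w).

Lemma triple_colD w z : triple_col (w + z) = triple_col w + triple_col z.
Proof. by apply/colP => i; rewrite !mxE crossDr dotDr. Qed.

Lemma triple_col0 : triple_col 0 = 0.
Proof. by apply/colP => i; rewrite !mxE -(scale0r 0) crossZr scale0r dot0r. Qed.

Lemma triple_colZ c w : triple_col (c *: w) = c *: triple_col w.
Proof. by apply/colP => i; rewrite !mxE crossZr dotZr. Qed.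

Lemma triple_colB w z : triple_col (w - z) = triple_col w - triple_col z.
Proof. by rewrite -scaleN1r triple_colD triple_colZ scaleN1r. Qed.

Lemma triple_col_same h : triple_col (h *: e) = 0.
Proof. by rewrite triple_colZ; apply/colP => i; rewrite !mxE dot_cross_same mulr0. Qed.

Lemma triple_col_sum (F : 'I_3 -> 'rV[R]_3) :
  triple_col (\sum_a F a) = \sum_a triple_col (F a).
Proof. by rewrite !sum3 !triple_colD. Qed.

Lemma triple_col_koszul (x : 'I_3 -> R) (t : 'I_3 -> 'rV[R]_3) a :
  koszul x (fun b => triple_col (t b)) a = triple_col (koszul x t a).
Proof. by elim/ord3_ind: a; rewrite /koszul /= triple_colB !triple_colZ. Qed.

Lemma mul_triple_col (u : 'rV[R]_m) w :
  u *m triple_col w = (dot e (cross (u *m A) w))%:M.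
Proof.
rewrite [LHS]mx11_scalar; congr (_%:M).
rewrite dot_crossC dot_mulmx mxE -sumrN; apply: eq_bigr => i _.
by rewrite mxE dot_crossC mulrN.
Qed.

End TripleProducts.

Section Koszul.
Variable K : fieldType.
Local Notation S := {mpoly K[3]}.

Definition powers (N : nat) (a : 'I_3) : S := 'X_a ^+ N.

Lemma powers_reg01 N (f g : S) :
  f * 'X_o1 ^+ N = g * 'X_o0 ^+ N -> exists h, f = h * 'X_o0 ^+ N.
Proof.
move=> E; have : in_powers N (pred1 o0) f.
  by apply: (in_powers_reg (j := o1)) => //; rewrite E; apply: in_powers_gen => /=.
by case/in_powersP => h; rewrite big_pred1_eq => ->; exists (h o0).
Qed.

Lemma Xn_neq0 (N : nat) (i : 'I_3) : 'X_i ^+ N != 0 :> S.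
Proof.
rewrite mpolyXn; apply/eqP => /(congr1 (mcoeff (U_(i) *+ N))).
by rewrite mcoeffX eqxx mcoeff0 => /eqP; rewrite oner_eq0.
Qed.

Lemma koszul1_scalar N (f : 'I_3 -> S) :
  (forall a b, f a * 'X_b ^+ N = f b * 'X_a ^+ N) ->
  exists g, forall a, f a = 'X_a ^+ N * g.
Proof.
move=> H; have [g Eg] := powers_reg01 (H o0 o1); exists g => a.
apply: (mulIf (Xn_neq0 N o0)); rewrite H Eg; ring.
Qed.

Lemma koszul2_scalar N (f : 'I_3 -> S) :
  \sum_a f a * 'X_a ^+ N = 0 ->
  exists t : 'I_3 -> S, [/\ f o0 = 'X_o2 ^+ N * t o1 - 'X_o1 ^+ N * t o2,
            f o1 = 'X_o0 ^+ N * t o2 - 'X_o2 ^+ N * t o0 &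
            f o2 = 'X_o1 ^+ N * t o0 - 'X_o0 ^+ N * t o1].
Proof.
rewrite sum3 => E.
(* X_2^N is regular modulo the other two powers, so f_2 is a combination of them; removing the
   matching boundary leaves a relation between X_0^N and X_1^N alone. *)
have : in_powers N (pred2 o0 o1) (f o2).
  apply: (in_powers_reg (j := o2)) => //.
  have -> : f o2 * 'X_o2 ^+ N = (- f o0) * 'X_o0 ^+ N + (- f o1) * 'X_o1 ^+ N.
    by apply/eqP; rewrite -subr_eq0 -[X in _ == X]E; apply/eqP; ring.
  by apply: in_powersD; apply: in_powers_gen => /=; rewrite ?eqxx ?orbT.
case/in_powersP => h; rewrite (bigD1 o0) //= (bigD1 o1) //= big1 ?addr0; last first.
  by move=> i; elim/ord3_ind: i.
move=> Eh.
have E1 : (f o1 + 'X_o2 ^+ N * h o1) * 'X_o1 ^+ N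
   = (- (f o0 + 'X_o2 ^+ N * h o0)) * 'X_o0 ^+ N.
  by apply/eqP; rewrite -subr_eq0 -[X in _ == X]E Eh; apply/eqP; ring.
have [d Ed] := powers_reg01 E1.
have Ed0 : f o0 + 'X_o2 ^+ N * h o0 = - d * 'X_o1 ^+ N.
  apply: (mulIf (Xn_neq0 N o0)); rewrite -[LHS]opprK -mulNr -E1 Ed; ring.
exists (fun c => nth 0 [:: h o1; - h o0; d] c); split => /=.
- by rewrite -[f o0](addrK ('X_o2 ^+ N * h o0)) Ed0; ring.
- by rewrite -[f o1](addrK ('X_o2 ^+ N * h o1)) Ed; ring.
- by rewrite Eh; ring.
Qed.

Lemma koszul1_exact N p q (f : 'I_3 -> 'M[S]_(p, q)) :
  (forall a b, powers N b *: f a = powers N a *: f b) ->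
  exists g, forall a, f a = powers N a *: g.
Proof.
move=> H.
have /fin_all_exists[g Hg] : forall ij : 'I_p * 'I_q,
    exists g, forall a, f a ij.1 ij.2 = 'X_a ^+ N * g.
  move=> [i j] /=; apply: koszul1_scalar => a b.
  by have /matrixP/(_ i j) := H a b; rewrite !mxE mulrC => ->; rewrite mulrC.
exists (\matrix_(i, j) g (i, j)) => a; apply/matrixP => i j.
by rewrite !mxE (Hg (i, j)).
Qed.

Lemma koszul2_exact N p q (f : 'I_3 -> 'M[S]_(p, q)) :
  \sum_a powers N a *: f a = 0 -> exists t, forall a, f a = koszul (powers N) t a.
Proof.
move=> H.
have /fin_all_exists[t Ht] : forall ij : 'I_p * 'I_q,
    exists t : 'I_3 -> S, [/\ f o0 ij.1 ij.2 = 'X_o2 ^+ N * t o1 - 'X_o1 ^+ N * t o2,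
            f o1 ij.1 ij.2 = 'X_o0 ^+ N * t o2 - 'X_o2 ^+ N * t o0 &
            f o2 ij.1 ij.2 = 'X_o1 ^+ N * t o0 - 'X_o0 ^+ N * t o1].
  move=> [i j] /=; apply: (koszul2_scalar (f := fun a => f a i j)).
  have /matrixP/(_ i j) := H; rewrite summxE [RHS]mxE; apply: etrans.
  by apply: eq_bigr => a _; rewrite mxE mulrC.
exists (fun a => \matrix_(i, j) t (i, j) a) => a; apply/matrixP => i j.
by have [] := Ht (i, j); elim/ord3_ind: a => E0 E1 E2; rewrite /= !mxE.
Qed.

Definition euler : 'rV[S]_3 := \row_k 'X_k.

Lemma eulerE k : euler 0 k = 'X_k.
Proof. by rewrite mxE. Qed.

Lemma dot_euler_eq0 (u : 'rV[S]_3) :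
  dot euler u = 0 -> exists w, u = cross euler w.
Proof.
rewrite dotE => E.
have [|t []] := @koszul2_scalar 1 (fun a => u 0 a).
  rewrite sum3 -E !eulerE; ring.
(* [koszul] is t cross E; the order E cross w costs a sign. *)
rewrite !expr1 => E0 E1 E2; exists (- \row_k t k).
by row3; rewrite ?E0 ?E1 ?E2; ring.
Qed.

Lemma cross_euler_eq0 (u : 'rV[S]_3) : cross euler u = 0 -> exists h, u = h *: euler.
Proof.
move=> E; have [|h Hh] := @koszul1_scalar 1 (fun a => u 0 a).
  move/rowP: E => E; move: (E o0) (E o1) (E o2); rewrite !mxE /= ![_ * u _ _]mulrC.
  move=> /subr0_eq E0 /subr0_eq E1 /subr0_eq E2.
  by move=> a b; elim/ord3_ind: a; elim/ord3_ind: b; rewrite !expr1 ?E0 ?E1 ?E2.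
by exists h; apply/rowP => k; rewrite Hh !mxE expr1 mulrC.
Qed.

End Koszul.

(** * Linear forms and logarithmic derivations *)

Section Divides.
Variable R : comPzRingType.
Implicit Types d f g : R.

Definition divides d f := exists h, f = h * d.

Lemma divides0 d : divides d 0.
Proof. by exists 0; rewrite mul0r. Qed.

Lemma divides_refl d : divides d d.
Proof. by exists 1; rewrite mul1r. Qed.

Lemma dividesD d f g : divides d f -> divides d g -> divides d (f + g).
Proof. by move=> [h ->] [k ->]; exists (h + k); rewrite mulrDl. Qed.

Lemma dividesMl d f g : divides d f -> divides d (g * f).
Proof. by move=> [h ->]; exists (g * h); rewrite mulrA. Qed.

Lemma dividesMr d f g : divides d f -> divides d (f * g).
Proof. by rewrite mulrC; apply: dividesMl. Qed.

Lemma dividesN d f : divides d f -> divides d (- f).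
Proof. by move=> [h ->]; exists (- h); rewrite mulNr. Qed.

Lemma dividesB d f g : divides d f -> divides d g -> divides d (f - g).
Proof. by move=> df dg; apply: dividesD => //; apply: dividesN. Qed.

End Divides.

Section LinearForms.
Variable K : fieldType.
Local Notation S := {mpoly K[3]}.
Implicit Types (a b : 'rV[K]_3) (p : 'cV[K]_3).

Definition const_vec m n (a : 'M[K]_(m, n)) : 'M[S]_(m, n) := map_mx (@mpolyC 3 K) a.

Local Notation lf := linear_form_poly.
Local Notation E := (euler K).

Lemma linear_form_polyE a : lf a = dot (const_vec a) E.
Proof. by apply: eq_bigr => k _; rewrite !mxE mul_mpolyC. Qed.

Lemma meval_linear_form a p : (lf a).@[fun k => p k 0] = (a *m p) 0 0.
Proof.
rewrite raddf_sum mxE; apply: eq_bigr => k _ /=.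
by rewrite mevalZ mevalXU.
Qed.

Lemma homog_linear_form a : homog_of_degree 1 (lf a).
Proof. by apply: homog_sum => k _; apply/homogZ/homogXU. Qed.

Lemma mcoeff_linear_form a k : (lf a)@_(U_(k)) = a 0 k.
Proof.
rewrite raddf_sum (bigD1 k) //= big1 => [|i /negbTE ik].
  by rewrite mcoeffZ mcoeffXU eqxx mulr1 addr0.
by rewrite mcoeffZ mcoeffXU ik mulr0.
Qed.

Lemma linear_form_inj : injective (@linear_form_poly K).
Proof. by move=> a b ab; apply/rowP => k; rewrite -!mcoeff_linear_form ab. Qed.

Lemma linear_form0 : lf (0 : 'rV[K]_3) = 0 :> S.
Proof. by apply: big1 => k _; rewrite mxE scale0r. Qed.

Lemma linear_form_neq0 a : a != 0 -> lf a != 0.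
Proof. by apply: contraNneq => a0; apply/eqP/linear_form_inj; rewrite a0 linear_form0. Qed.

Lemma row_neq0P a : a != 0 -> exists k, a 0 k != 0.
Proof.
move=> a0; apply: NNPP => H; case/eqP: a0; apply/rowP => k; rewrite mxE.
by apply/eqP/negPn/negP => ak; apply: H; exists k.
Qed.

(* Solving a = 0 for the variable 'X_k. *)
Lemma linear_form_subst a k : a 0 k != 0 ->
  exists s : {rmorphism S -> S},
    [/\ forall j, j != k -> s 'X_j = 'X_j,
        s (lf a) = 0 & forall f, divides (lf a) (f - s f)].
Proof.
move=> ak.
pose lq := [tuple ('X_i - (i == k)%:R *: ((a 0 k)^-1 *: lf a) : S) | i < 3].
have sX i : 'X_i \mPo lq = 'X_i - (i == k)%:R *: ((a 0 k)^-1 *: lf a).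
  by rewrite comp_mpolyXU -tnth_nth tnth_mktuple.
exists (comp_mpoly lq); split => /=.
- by move=> j /negbTE jk; rewrite sX jk scale0r subr0.
- rewrite raddf_sum /=; under eq_bigr => i _ do rewrite comp_mpolyZ sX scalerBr.
  rewrite sumrB [X in _ - X](bigD1 k) //= [X in _ - (_ + X)]big1.
    by rewrite addr0 eqxx scale1r scalerA divff // scale1r subrr.
  by move=> i /negbTE->; rewrite scale0r scaler0.
- move=> f; elim/mpolyind: f => [|c m f _ _ IH].
    by rewrite raddf0 subrr; apply: divides0.
  rewrite rmorphD opprD addrACA; apply: dividesD => //.
  rewrite /= comp_mpolyZ -scalerBr -mul_mpolyC; apply: dividesMl.
  rewrite mpolyXE_id.
  rewrite rmorph_prod /=.
  apply: (big_ind2 (fun x y => divides (lf a) (x - y))).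
  + by rewrite subrr; apply: divides0.
  + move=> x1 x2 y1 y2 H1 H2.
    have -> : x1 * y1 - x2 * y2 = y1 * (x1 - x2) + x2 * (y1 - y2) by ring.
    by apply: dividesD; apply: dividesMl.
  move=> i _; rewrite rmorphXn /= sX subrXX; apply: dividesMr.
  rewrite opprB addrC subrK scalerA -mul_mpolyC.
  exact/dividesMl/divides_refl.
Qed.

(** The substitution of [linear_form_subst] takes values in a domain, and whatever it kills is a
    multiple of the form. *)
Lemma linear_form_prime a f g : a != 0 ->
  divides (lf a) (f * g) -> divides (lf a) f \/ divides (lf a) g.
Proof.
move=> /row_neq0P[k /linear_form_subst[s [_ sa sd]]] [h Eh].
have /eqP : s f * s g = 0 by rewrite -rmorphM Eh rmorphM sa mulr0.
rewrite mulf_eq0 => /orP[] /eqP s0.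
  by left; have := sd f; rewrite s0 subr0.
by right; have := sd g; rewrite s0 subr0.
Qed.

(* The quotient by a linear form is again a polynomial ring, in which two of the three 'X_a^N form a regular sequence. *)
Lemma koszul_mod_linear_form a N (f : 'I_3 -> S) : a != 0 ->
  (forall i j, divides (lf a) ('X_j ^+ N * f i - 'X_i ^+ N * f j)) ->
  exists l, forall i, divides (lf a) ('X_i ^+ N * l - f i).
Proof.
move=> /row_neq0P[k /linear_form_subst[s [sX sa sd]]] H.
have sH i j : s ('X_j ^+ N) * s (f i) = s ('X_i ^+ N) * s (f j).
  apply/eqP; rewrite -subr_eq0 -!rmorphM -rmorphB; have [h ->] := H i j.
  by rewrite rmorphM sa mulr0.
have sXN j : j != k -> s ('X_j ^+ N) = 'X_j ^+ N by move=> jk; rewrite rmorphXn /= sX.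
have [i [j [ik jk ij]]] : exists i j : 'I_3, [/\ i != k, j != k & i != j].
  elim/ord3_ind: k {sX sXN sd sa s sH} => //; [exists o1, o2 | exists o0, o2 | exists o0, o1]; by [].
have Pi : in_powers N (pred1 i) (s (f i)).
  apply: (in_powers_reg (j := j)); first by rewrite /= eq_sym.
  have -> : s (f i) * 'X_j ^+ N = s (f j) * 'X_i ^+ N.
    by rewrite mulrC -{1}(sXN j jk) sH sXN // mulrC.
  by apply: in_powers_gen => /=.
case/in_powersP: Pi => h; rewrite big_pred1_eq => Eh.
exists (h i) => l.
have -> : 'X_l ^+ N * h i - f l =
   ('X_l ^+ N - s ('X_l ^+ N)) * h i - (f l - s (f l)); last first.
  by apply: dividesB => //; apply: dividesMr.
have : s (f l) = s ('X_l ^+ N) * h i.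
  apply: (mulfI (Xn_neq0 K N i)); rewrite -{1}(sXN i ik) sH Eh; ring.
by move=> ->; ring.
Qed.

(** Evaluation at the kernel of [a] turns divisibility into an inclusion of kernels, which linear
    algebra inverts over any field. *)
Lemma divides_linear_form a b : divides (lf a) (lf b) -> exists c, b = c *: a.
Proof.
move=> [h Eh].
have H p : a *m p = 0 -> b *m p = 0.
  move=> ap; apply/matrixP => i j; rewrite !ord1 -meval_linear_form Eh mevalM.
  by rewrite meval_linear_form ap !mxE mulr0.
have /submxP[D ->] : (b <= a)%MS.
  rewrite submxE; apply/eqP/matrixP => i j.
  have : a *m col j (cokermx a) = 0 by rewrite colE mulmxA mulmx_coker mul0mx.
  move/H; rewrite colE mulmxA -colE => /matrixP/(_ i 0).
  by rewrite [LHS]mxE [RHS]mxE => ->; rewrite mxE.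
by exists (D 0 0); rewrite [D]mx11_scalar mul_scalar_mx mxE mulr1n.
Qed.

Lemma linear_form_delta k : lf (delta_mx 0 k : 'rV[K]_3) = 'X_k.
Proof.
rewrite /linear_form_poly (bigD1 k) //= big1 => [|i /negbTE ik].
  by rewrite mxE !eqxx scale1r addr0.
by rewrite mxE ik andbF scale0r.
Qed.

Lemma linear_form_mulmx r (w : 'rV[K]_r) (U : 'M[K]_(r, 3)) :
  lf (w *m U) = \sum_l w 0 l *: lf (row l U).
Proof.
rewrite /linear_form_poly; under [RHS]eq_bigr => l _ do rewrite scaler_sumr.
rewrite exchange_big; apply: eq_bigr => k _ /=.
by rewrite mxE scaler_suml; apply: eq_bigr => l _; rewrite mxE scalerA.
Qed.

(** Ensures that modulo a nonzero linear form a power of X_0 or of X_1 can be cancelled. *)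
Lemma not_divides_two_variables a :
  divides (lf a) 'X_o0 -> divides (lf a) 'X_o1 -> False.
Proof.
rewrite -!linear_form_delta => /divides_linear_form[c /rowP Ec] /divides_linear_form[d /rowP Ed].
have := Ec o0; have := Ec o1; have := Ed o1; rewrite !mxE /= => /eqP d1 /eqP c1 /eqP c0.
move: c1; rewrite eq_sym mulf_eq0 => /orP[/eqP c1|/eqP a1].
  by move: c0; rewrite c1 mul0r oner_eq0.
by move: d1; rewrite a1 mulr0 oner_eq0.
Qed.

Lemma exists_independent_form a : exists b, ~ divides (lf a) (lf b).
Proof.
apply: NNPP => H; apply: (@not_divides_two_variables a); rewrite -linear_form_delta;
  by apply: NNPP => nb; apply: H; eexists; exact: nb.
Qed.

Lemma linear_form_prime_exp a f N : a != 0 ->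
  divides (lf a) (f ^+ N) -> divides (lf a) f.
Proof.
move=> a0; elim: N => [|N IH]; first by rewrite -[X in _ -> divides _ X]mulr1; apply: dividesMl.
by rewrite exprS => /(linear_form_prime a0)[].
Qed.

(** By [dot_cramer], each a_k times the determinant is a combination of the values of [a] on the
    three vectors, and some a_k is a nonzero constant. *)
Lemma divides_cramer a (u w z : 'rV[S]_3) : a != 0 ->
  divides (lf a) (dot (const_vec a) u) -> divides (lf a) (dot (const_vec a) w) ->
  divides (lf a) (dot (const_vec a) z) -> divides (lf a) (dot u (cross w z)).
Proof.
move=> /row_neq0P[k ak] Hu Hw Hz.
have : divides (lf a) ((a 0 k)%:MP * dot u (cross w z)).
  have -> : (a 0 k)%:MP * dot u (cross w z) = dot (const_vec a) u * cross w z 0 k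
     + dot (const_vec a) w * cross z u 0 k + dot (const_vec a) z * cross u w 0 k.
    by rewrite -dot_cramer mxE.
  by do 2?apply: dividesD; apply: dividesMr.
move=> [h Eh]; exists ((a 0 k)^-1 *: h).
by rewrite -scalerAl -Eh mul_mpolyC scalerA mulVf // scale1r.
Qed.

(* (a x b) . (E x w) = (a . E) (b . w) - (a . w) (b . E) *)
Lemma divides_of_cross a (w : 'rV[S]_3) : a != 0 ->
  (forall b, divides (lf a) (dot (cross (const_vec a) (const_vec b)) (cross E w))) ->
  divides (lf a) (dot (const_vec a) w).
Proof.
move=> a0 H; have [b nb] := exists_independent_form a.
have : divides (lf a) (dot (const_vec a) w * lf b).
  have -> : dot (const_vec a) w * lf b = dot (const_vec b) w * lf a
     - dot (cross (const_vec a) (const_vec b)) (cross E w).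
    by rewrite dot_cross_cross !linear_form_polyE [dot (const_vec b) w * _]mulrC opprB addrC subrK.
  by apply: dividesB => //; apply/dividesMl/divides_refl.
by case/(linear_form_prime a0).
Qed.

End LinearForms.

Section LogarithmicDerivations.
Variables (K : fieldType) (n : nat) (alpha : 'I_n -> 'rV[K]_3).
Hypothesis arr : line_arrangement alpha.
Local Notation S := {mpoly K[3]}.
Local Notation lf := linear_form_poly.
Local Notation E := (euler K).
Local Notation Q := (defining_poly alpha).
Implicit Types th et : 'rV[S]_3.

Lemma alpha_neq0 i : alpha i != 0.
Proof. by case: arr. Qed.

Lemma alpha_not_proportional i j c : i != j -> alpha j <> c *: alpha i.
Proof.
move=> ij Ec; have [_ /(_ i j ij) H] := arr; apply: H => p.
have c0 : c != 0.
  by apply/eqP => c0; have := alpha_neq0 j; rewrite Ec c0 scale0r eqxx.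
by rewrite /line Ec -scalemxAl scaler_eq0 (negbTE c0).
Qed.

Lemma not_divides_alpha i j : i != j -> ~ divides (lf (alpha i)) (lf (alpha j)).
Proof. by move=> ij /divides_linear_form[c /(alpha_not_proportional ij)]. Qed.

Lemma not_divides_prod (P : pred 'I_n) i : ~~ P i ->
  ~ divides (lf (alpha i)) (\prod_(j | P j) lf (alpha j)).
Proof.
move=> nPi; apply: (big_rec (fun f => ~ divides (lf (alpha i)) f)) => [|j f Pj IH]; last first.
  case/(linear_form_prime (alpha_neq0 i)) => //; apply: not_divides_alpha.
  by apply/eqP => ij; rewrite ij Pj in nPi.
move=> [h Eh].
(* In degree 0, the equation between 1 and a multiple of the form involves only the component of [h]
   of degree -1, which is 0. *)
have := congr1 (hcomp (-1 + 1)) Eh.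
rewrite (hcompM _ _ (homog_linear_form _)) (hcomp_homog _ (homog1 K 3)) /= mul0r.
by move/eqP; rewrite oner_eq0.
Qed.

Lemma divides_prod (P : pred 'I_n) f :
  (forall i, P i -> divides (lf (alpha i)) f) ->
  divides (\prod_(i | P i) lf (alpha i)) f.
Proof.
have [m] := ubnP #|P|; elim: m P => // m IH P ltP H.
have [i0 Pi0|P0] := pickP P; last first.
  by rewrite big_pred0 //; exists f; rewrite mulr1.
have [||h Eh] := IH (fun i => P i && (i != i0)).
- have : (#|[pred i | P i & i != i0]| < #|P|)%N.
    apply/proper_card/properP; split; first by apply/subsetP => i /andP[].
    by exists i0 => //; rewrite inE eqxx andbF.
  by move=> lt1; rewrite -ltnS; apply: leq_trans lt1 ltP.
- by move=> i /andP[/H].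
rewrite (bigD1 i0) //=; have := H i0 Pi0; rewrite Eh.
case/(linear_form_prime (alpha_neq0 i0)) => [[g ->]|].
  by exists g; rewrite mulrA.
by move/not_divides_prod; case; rewrite eqxx andbF.
Qed.

Lemma divides_defining_poly f : divides Q f <-> forall i, divides (lf (alpha i)) f.
Proof.
split=> [[h ->] i|H]; last exact: divides_prod.
by apply: dividesMl; rewrite /defining_poly (bigD1 i) //; apply/dividesMr/divides_refl.
Qed.

Lemma defining_poly_neq0 : Q != 0.
Proof. by apply/prodf_neq0 => i _; apply/linear_form_neq0/alpha_neq0. Qed.

Lemma homog_defining_poly : homog_of_degree n%:Z Q.
Proof.
have -> : n%:Z = \sum_(i < n) 1%:Z by rewrite sumr_const card_ord natz.
apply: (big_ind2 (fun (f : S) (d : int) => homog_of_degree d f)).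
- exact: homog1.
- by move=> f d g e; apply: homogM.
- by move=> i _; apply: homog_linear_form.
Qed.

Lemma derivation_applyM th f g :
  derivation_apply th (f * g) = derivation_apply th f * g + f * derivation_apply th g.
Proof.
rewrite /derivation_apply mulr_suml mulr_sumr -big_split /=.
by apply: eq_bigr => k _; rewrite mderivM; ring.
Qed.

Lemma derivation_apply1 th : derivation_apply th 1 = 0.
Proof. by apply: big1 => k _; rewrite -mpolyC1 mderivC mulr0. Qed.

Lemma derivation_apply_linear_form th a :
  derivation_apply th (lf a) = dot (const_vec a) th.
Proof.
apply: eq_bigr => k _; rewrite mulrC !mxE; congr (_ * _).
rewrite raddf_sum (bigD1 k) //= big1 ?addr0 => [|i ik].
  have Ukk : (U_(k) - U_(k) = 0)%MM by rewrite -{1}[U_(k)%MM]add0m addmK.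
  by rewrite mderivZ mderivX mnm1E eqxx scale1r Ukk mpolyX0 -mul_mpolyC mulr1.
by rewrite mderivZ mderivX mnm1E (negbTE ik) scale0r scaler0.
Qed.

Lemma derivation_applyD th et f :
  derivation_apply (th + et) f = derivation_apply th f + derivation_apply et f.
Proof. by rewrite /derivation_apply -big_split; apply: eq_bigr => k _; rewrite mxE mulrDl. Qed.

Lemma derivation_applyZ h th f : derivation_apply (h *: th) f = h * derivation_apply th f.
Proof. by rewrite /derivation_apply mulr_sumr; apply: eq_bigr => k _; rewrite mxE mulrA. Qed.

Lemma D0P th : reflect (derivation_apply th Q = 0) (D0 alpha th).
Proof. exact: eqP. Qed.

Lemma D0_0 : D0 alpha 0.
Proof. by apply/D0P/big1 => k _; rewrite mxE mul0r. Qed.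

Lemma D0D th et : D0 alpha th -> D0 alpha et -> D0 alpha (th + et).
Proof. by move=> /D0P H1 /D0P H2; apply/D0P; rewrite derivation_applyD H1 H2 addr0. Qed.

Lemma D0Z h th : D0 alpha th -> D0 alpha (h *: th).
Proof. by move=> /D0P H1; apply/D0P; rewrite derivation_applyZ H1 mulr0. Qed.

Lemma D0B th et : D0 alpha th -> D0 alpha et -> D0 alpha (th - et).
Proof. by move=> H1 H2; rewrite -scaleN1r; apply/D0D/D0Z. Qed.

Lemma D0_sum (I : finType) (F : I -> 'rV[S]_3) :
  (forall i, D0 alpha (F i)) -> D0 alpha (\sum_i F i).
Proof. by move=> H; apply: (big_ind (D0 alpha)) => //; [exact: D0_0 | exact: D0D]. Qed.

(** D0 is the kernel of a map into a domain, so S^3 / D0 is torsion free, as [second_syzygy_free]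
    requires. *)
Lemma D0_saturated h th : h != 0 -> D0 alpha (h *: th) -> D0 alpha th.
Proof.
move=> h0 /D0P; rewrite derivation_applyZ => /eqP; rewrite mulf_eq0 (negbTE h0) /=.
by move=> /eqP; move/D0P.
Qed.

Definition logarithmic th := forall i, divides (lf (alpha i)) (dot (const_vec (alpha i)) th).

Lemma logarithmic_euler : logarithmic E.
Proof. by move=> i; rewrite -linear_form_polyE; apply: divides_refl. Qed.

(** By the Leibniz rule, th(alpha_i) times the product of the other forms is a multiple of alpha_i,
    and alpha_i is prime to that product. *)
Lemma D0_logarithmic th : D0 alpha th -> logarithmic th.
Proof.
move=> /D0P H i.
have : divides (lf (alpha i)) (dot (const_vec (alpha i)) th * \prod_(j | j != i) lf (alpha j)).
  move: H; rewrite /defining_poly (bigD1 i) //= derivation_applyM derivation_apply_linear_form.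
  by move=> /eqP; rewrite addr_eq0 => /eqP->; apply/dividesN/dividesMr/divides_refl.
case/(linear_form_prime (alpha_neq0 i)) => // /not_divides_prod; case.
by rewrite eqxx.
Qed.

Lemma logarithmic_apply_Q th (c : 'I_n -> S) :
  (forall i, dot (const_vec (alpha i)) th = c i * lf (alpha i)) ->
  derivation_apply th Q = (\sum_i c i) * Q.
Proof.
move=> H; apply: (big_ind2 (fun f s => derivation_apply th f = s * f)).
- by rewrite derivation_apply1 mul0r.
- by move=> f s g t Ef Eg; rewrite derivation_applyM Ef Eg; ring.
- by move=> i _; rewrite derivation_apply_linear_form.
Qed.

Lemma derivation_apply_euler : derivation_apply E Q = n%:R * Q.
Proof.
rewrite (@logarithmic_apply_Q E (fun=> 1)); last first.
  by move=> i; rewrite mul1r linear_form_polyE.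
by rewrite sumr_const card_ord.
Qed.

Hypothesis n_neq0 : n%:R != 0 :> K.

Lemma D0_euler h : D0 alpha (h *: E) -> h = 0.
Proof.
move=> /D0P; rewrite derivation_applyZ derivation_apply_euler => /eqP.
rewrite !mulf_eq0 (negbTE defining_poly_neq0) orbF => /orP[/eqP//|].
by rewrite -mpolyC_nat mpolyC_eq0 (negbTE n_neq0).
Qed.

(** A logarithmic [th] multiplies Q by a polynomial and E multiplies it by n; as n is invertible, a
    multiple of E cancels the former. *)
Lemma logarithmic_D0 th : logarithmic th -> exists h, D0 alpha (th - h *: E).
Proof.
move=> /fin_all_exists[c Hc]; exists ((n%:R^-1 : K) *: \sum_i c i); apply/D0P.
rewrite -[_ - _]/(_ + _) -scaleNr derivation_applyD derivation_applyZ.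
rewrite (logarithmic_apply_Q Hc) derivation_apply_euler -mpolyC_nat.
rewrite mul_mpolyC -scalerAr mulNr scalerN -scalerAl scalerA divff // scale1r.
by rewrite subrr.
Qed.

Lemma divides_pairing th et : logarithmic th -> logarithmic et ->
  divides Q (dot E (cross th et)).
Proof.
move=> Hth Het; apply/divides_defining_poly => i.
by apply: divides_cramer (alpha_neq0 i) _ _ _ => //; apply: logarithmic_euler.
Qed.

End LogarithmicDerivations.

(** * Minimal graded generators *)

Section Noetherian.
Implicit Types R : comNzRingType.

Definition is_submodule R m (P : 'rV[R]_m -> Prop) : Prop :=
  [/\ P 0, forall x y, P x -> P y -> P (x + y) & forall c x, P x -> P (c *: x)].

Definition finitely_generated R m (P : 'rV[R]_m -> Prop) : Prop :=
  exists k (G : 'M[R]_(k, m)), forall x, P x <-> exists u, x = u *m G.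

Definition noetherian R : Prop :=
  forall m (P : 'rV[R]_m -> Prop), is_submodule P -> finitely_generated P.

Definition is_ideal R (I : R -> Prop) : Prop :=
  [/\ I 0, forall x y, I x -> I y -> I (x + y) & forall c x, I x -> I (c * x)].

Definition fg_ideal R (I : R -> Prop) : Prop :=
  exists k (c : 'I_k -> R), (forall i, I (c i)) /\
    forall a, I a -> exists u : 'I_k -> R, a = \sum_i u i * c i.

Lemma submodule_sum R m (P : 'rV[R]_m -> Prop) k (u : 'I_k -> R) (x : 'I_k -> 'rV[R]_m) :
  is_submodule P -> (forall i, P (x i)) -> P (\sum_i u i *: x i).
Proof. by case=> P0 PD PZ Px; apply: (big_ind P) => // i _; apply: PZ. Qed.

Lemma ideal_sum R (I : R -> Prop) (J : finType) (F : J -> R) :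
  is_ideal I -> (forall i, I (F i)) -> I (\sum_i F i).
Proof. by case=> I0 ID IM H; apply: (big_ind I). Qed.

(** Induction on the rank: lifts of generators of the ideal of first coordinates reduce a vector to
    one with first coordinate 0. *)
Lemma noetherian_of_ideals R :
  (forall I : R -> Prop, is_ideal I -> fg_ideal I) -> noetherian R.
Proof.
move=> RI; elim=> [|m IH].
  move=> P subP; have [P0 _ _] := subP; exists 0%N, 0 => x; rewrite [x]thinmx0; split=> // _.
  by exists 0; rewrite mul0mx.
suff H (P : 'rV[R]_(1 + m) -> Prop) : is_submodule P -> finitely_generated P by exact: H.
move=> subP; have [P0 PD PZ] := subP.
have [|k [c [Hc Gc]]] := RI (fun a => exists x, P (row_mx a%:M x)).
  split.
  - by exists 0; rewrite raddf0 row_mx0.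
  - move=> a b [x Px] [y Py]; exists (x + y).
    by rewrite raddfD -add_row_mx; apply: PD.
  - move=> a b [x Px]; exists (a *: x).
    by rewrite -scale_scalar_mx -scale_row_mx; apply: PZ.
have /fin_all_exists[y Py] := Hc.
have [|k' [G' HG']] := IH (fun x => P (row_mx 0 x)).
  split; first by rewrite row_mx0.
  - by move=> x z Px Pz; rewrite -[0](addr0 0) -add_row_mx; apply: PD.
  - by move=> a x Px; rewrite -[0](scaler0 _ a) -scale_row_mx; apply: PZ.
pose Y : 'M_(k, 1 + m) := \matrix_i row_mx (c i)%:M (y i).
have PY u : P (u *m Y).
  rewrite mulmx_sum_row; apply: submodule_sum => // i.
  by rewrite rowK.
exists (k + k')%N, (col_mx Y (row_mx 0 G')) => x; split; last first.
  case=> u ->; rewrite -[u]hsubmxK mul_row_col; apply: PD => //.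
  by rewrite mul_mx_row mulmx0 HG'; exists (rsubmx u).
move=> Px.
have [|u Eu] := Gc (lsubmx x 0 0).
  by exists (rsubmx x); rewrite -mx11_scalar hsubmxK.
pose z := x - (\row_i u i) *m Y.
have Pz : P z by rewrite /z -scaleN1r; apply: PD => //; apply: PZ.
have z0 : lsubmx z = 0.
  move: Eu; rewrite mxE => Eu; apply/matrixP => i j; rewrite !ord1 /z !mxE Eu.
  apply/eqP; rewrite subr_eq0; apply/eqP.
  apply: eq_bigr => l _; rewrite !mxE; case: splitP => // j' _.
  by rewrite !ord1 mxE mulr1n.
have [w Ew] : exists w, rsubmx z = w *m G' by apply/HG'; rewrite -z0 hsubmxK.
exists (row_mx (\row_i u i) w); rewrite mul_row_col mul_mx_row mulmx0 -Ew -z0 hsubmxK.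
by rewrite /z addrC subrK.
Qed.

Lemma noetherian_ideals R (I : R -> Prop) : noetherian R -> is_ideal I -> fg_ideal I.
Proof.
move=> nR [I0 ID IM].
have [|k [G HG]] := nR 1%N (fun x => I (x 0 0)).
  split; first by rewrite mxE.
  - by move=> x y Ix Iy; rewrite mxE; apply: ID.
  - by move=> c x Ix; rewrite mxE; apply: IM.
exists k, (fun i => G i 0); split.
  move=> i; have -> : G i 0 = row i G 0 0 by rewrite mxE.
  by apply/HG; exists (delta_mx 0 i); rewrite rowE.
move=> a Ia; have [|u Eu] := (HG a%:M).1; first by rewrite mxE mulr1n.
exists (fun i => u 0 i); have := congr1 (fun x : 'rV_1 => x 0 0) Eu.
by rewrite mxE mulr1n => ->; rewrite mxE.
Qed.

Lemma noetherian_field (K : fieldType) : noetherian K.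
Proof.
apply: noetherian_of_ideals => I [I0 ID IM].
have [[a [Ia a0]]|H] := classic (exists a, I a /\ a != 0).
  exists 1%N, (fun=> a); split=> // b _; exists (fun=> b / a).
  by rewrite big_ord1 divfK.
exists 0%N, (fun=> 0); split=> // b Ib; exists (fun=> 0); rewrite big_ord0.
by apply/eqP/negPn/negP => b0; apply: H; exists b.
Qed.

Lemma noetherian_image R R' (f : {rmorphism R -> R'}) :
  (forall y, exists x, f x = y) -> noetherian R -> noetherian R'.
Proof.
move=> surj nR; apply: noetherian_of_ideals => I [I0 ID IM].
have [|k [c [Ic Gc]]] := @noetherian_ideals R (fun x => I (f x)) nR.
  split=> [|x y|x y]; first by rewrite rmorph0.
    by rewrite rmorphD; apply: ID.
  by rewrite rmorphM; apply: IM.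
exists k, (f \o c); split=> // y; have [x <-] := surj y => /Gc[u ->].
exists (f \o u); rewrite rmorph_sum; apply: eq_bigr => i _.
by rewrite rmorphM.
Qed.

(* Hilbert's basis theorem: treat the leading coefficients, and then the polynomials of bounded degree as vectors. *)
Lemma noetherian_poly R : noetherian R -> noetherian {poly R}.
Proof.
move=> nR; apply: noetherian_of_ideals => I idI; have [I0 ID IM] := idI.
(* The coefficient in degree [d] is allowed to vanish, so that sums with cancelling leading terms
   cause no exception. *)
have [|k [c [Lc Gc]]] := @noetherian_ideals R
    (fun a => exists d f, [/\ I f, (size f <= d.+1)%N & f`_d = a]) nR.
  split.
  - by exists 0%N, 0; rewrite size_poly0 coef0.
  - move=> _ _ [d [f [If sf <-]]] [e [g [Ig sg <-]]].
    exists (d + e)%N, ('X^e * f + 'X^d * g); split.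
    + by apply: ID; apply: IM.
    + rewrite (leq_trans (size_polyD _ _)) // geq_max.
      by apply/andP; split; apply: leq_trans (size_polyMleq _ _) _; rewrite size_polyXn; lia.
    + rewrite coefD !coefXnM !ifN -?leqNgt ?leq_addr ?leq_addl //.
      by rewrite addnK addKn.
  - move=> a _ [d [f [If sf <-]]]; exists d, (a%:P * f); split; first exact: IM.
      by rewrite mul_polyC (leq_trans (size_scale_leq _ _)).
    by rewrite coefCM.
have /fin_all_exists[d Hd] := Lc; have /fin_all_exists[f Hf] := Hd.
(* Polynomials of size above D lose their leading term to multiples of the f_i; those in I of size
   at most D form a submodule of R^D. *)
pose D := (\sum_i d i)%N.
have dD i : (d i <= D)%N by rewrite /D (bigD1 i) //= leq_addr.
have [|k' [G HG]] := nR D (fun v => I (rVpoly v)).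
  split; first by rewrite linear0.
  - by move=> x y Ix Iy; rewrite linearD; apply: ID.
  - by move=> a x Ix; rewrite linearZ /= -mul_polyC; apply: IM.
pose gen (i : 'I_(k + k')) : {poly R} :=
  match split i with inl i => f i | inr j => rVpoly (row j G) end.
exists (k + k')%N, gen; split.
  move=> i; rewrite /gen; case: splitP => j _; first by case: (Hf j).
  by apply/HG; exists (delta_mx 0 j); rewrite rowE.
pose J (g : {poly R}) := exists u : 'I_(k + k') -> {poly R}, g = \sum_i u i * gen i.
have JD g h : J g -> J h -> J (g + h).
  move=> [u ->] [w ->]; exists (fun i => u i + w i).
  by rewrite -big_split; apply: eq_bigr => i _; rewrite mulrDl.
have JM g h : J h -> J (g * h).
  move=> [u ->]; exists (fun i => g * u i).
  by rewrite mulr_sumr; apply: eq_bigr => i _; rewrite mulrA.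
have Jgen i : J (gen i).
  exists (fun j => (j == i)%:R); rewrite (bigD1 i) //= eqxx mul1r big1 ?addr0 //.
  by move=> j /negbTE->; rewrite mul0r.
have J0 : J 0 by exists (fun=> 0); rewrite big1 // => i _; rewrite mul0r.
have Jsum m (F : 'I_m -> {poly R}) : (forall i, J (F i)) -> J (\sum_i F i).
  by move=> JF; apply: (big_ind J).
have Jf i : J (f i).
  by have := Jgen (lshift k' i); rewrite /gen; case: splitP => [j /= /ord_inj -> //|j /= E]; have := ltn_ord i; rewrite E; lia.
have Jsmall g : I g -> (size g <= D)%N -> J g.
  move=> Ig sg; have [|u Eu] := (HG (poly_rV g)).1; first by rewrite poly_rV_K.
  rewrite -(poly_rV_K sg) Eu mulmx_sum_row linear_sum; apply: Jsum => j.
  rewrite linearZ /= -mul_polyC; apply: JM.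
  have := Jgen (rshift k j); rewrite /gen; case: splitP => [j' /= E|j' /= /addnI /ord_inj -> //].
  by have := ltn_ord j'; rewrite -E; lia.
move=> g; have [s] := ubnP (size g); elim: s g => // s IH g lts Ig.
have [sg|lg] := leqP (size g) D; first exact: Jsmall.
have g0 : (0 < size g)%N by apply: leq_ltn_trans lg.
have [|u Eu] := Gc g`_(size g).-1.
  by exists (size g).-1, g; rewrite prednK.
pose h : {poly R} := \sum_i (u i *: 'X^((size g).-1 - d i)) * f i.
have Ih : I h by apply: ideal_sum => // i; apply: IM; case: (Hf i).
have Jh : J h by apply: Jsum => i; apply: JM.
have sh : (size h <= size g)%N.
  rewrite (leq_trans (size_sum _ _ _)) //; apply/bigmax_leqP => i _.
  rewrite -scalerAl (leq_trans (size_scale_leq _ _)) //.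
  rewrite (leq_trans (size_polyMleq _ _)) // size_polyXn.
  have [_ sf _] := Hf i; have := dD i; lia.
have Eh : h`_(size g).-1 = g`_(size g).-1.
  rewrite Eu coef_sum; apply: eq_bigr => i _; have [_ _ <-] := Hf i.
  rewrite -scalerAl coefZ coefXnM ifN -?leqNgt ?leq_subr // subKn //.
  have := dD i; lia.
rewrite -(subrK h g); apply: JD => //; apply: IH; last first.
  by rewrite -mulN1r; apply: ID => //; apply: IM.
suff : (size (g - h)%R <= (size g).-1)%N by move=> H; apply: leq_ltn_trans H _; rewrite -ltnS prednK.
apply/leq_sizeP => j; rewrite leq_eqVlt => /orP[/eqP<-|ltj].
  by rewrite coefB Eh subrr.
have lej : (size g <= j)%N by rewrite -(prednK g0).
by rewrite coefB !nth_default ?subrr // (leq_trans sh).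
Qed.

(** Evaluation maps K[x][y][z] onto this ring; surjectivity is all that has to be checked. *)
Lemma noetherian_mpoly3 (K : fieldType) : noetherian {mpoly K[3]}.
Proof.
have n3 := noetherian_poly (noetherian_poly (noetherian_poly (@noetherian_field K))).
pose S := {mpoly K[3]}.
pose ev (R : comNzRingType) (f : {rmorphism R -> S}) (x : S) : {rmorphism {poly R} -> S} :=
  horner_eval x \o map_poly f.
pose e1 := ev _ (@mpolyC 3 K) 'X_o0.
pose e2 := ev _ e1 'X_o1.
pose e3 := ev _ e2 'X_o2.
apply: (noetherian_image (f := e3)) n3 => y.
have evC (R : comNzRingType) (f : {rmorphism R -> S}) x c : ev _ f x c%:P = f c.
  by rewrite /= /horner_eval map_polyC hornerC.
have evX (R : comNzRingType) (f : {rmorphism R -> S}) x : ev _ f x 'X = x.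
  by rewrite /= /horner_eval map_polyX hornerX.
elim/mpolyind: y => [|c m f _ _ [g <-]]; first by exists 0; rewrite rmorph0.
exists (c%:P%:P%:P * ('X%:P%:P ^+ m o0 * 'X%:P ^+ m o1 * 'X ^+ m o2) + g).
rewrite rmorphD rmorphM !rmorphM !rmorphXn evC evC evC evC evC evC evX evX evX.
rewrite -mul_mpolyC; congr (_ * _ + _); rewrite [RHS]mpolyXE_id.
have prod3 (F : 'I_3 -> S) : \prod_i F i = F o0 * F o1 * F o2.
  rewrite !big_ord_recl big_ord0 mulr1 mulrA.
  by congr (F _ * F _ * F _); apply: val_inj.
by rewrite prod3.
Qed.

End Noetherian.

Section MinimalGenerators.
Variable K : fieldType.
Local Notation S := {mpoly K[3]}.

Lemma span_submodule (R : comNzRingType) m k (G : 'M[R]_(k, m)) :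
  is_submodule (fun x => exists u, x = u *m G).
Proof.
split; first by exists 0; rewrite mul0mx.
  by move=> _ _ [u ->] [w ->]; exists (u + w); rewrite mulmxDl.
by move=> c _ [u ->]; exists (c *: u); rewrite scalemxAl.
Qed.

Lemma span_row (R : comNzRingType) m k (G : 'M[R]_(k, m)) i : exists u, row i G = u *m G.
Proof. by exists (delta_mx 0 i); rewrite rowE. Qed.

Lemma submodule_mulmx (R : comNzRingType) m k (P : 'rV[R]_m -> Prop) (G : 'M[R]_(k, m)) u :
  is_submodule P -> (forall i, P (row i G)) -> P (u *m G).
Proof. by move=> subP HG; rewrite mulmx_sum_row; apply: submodule_sum. Qed.

Definition hcomp_row m (d : 'I_m -> int) (e : int) (x : 'rV[S]_m) : 'rV[S]_m :=
  \row_i hcomp (e - d i) (x 0 i).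

Definition graded m (d : 'I_m -> int) (P : 'rV[S]_m -> Prop) :=
  forall e x, P x -> P (hcomp_row d e x).

(** The list of degrees may be enlarged at will, so that finitely many rows can be decomposed along
    one common list. *)
Lemma hcomp_rowE m (d : 'I_m -> int) (x : 'rV[S]_m) :
  exists s : seq int, forall s', uniq s' -> {subset s <= s'} ->
    x = \sum_(e <- s') hcomp_row d e x.
Proof.
exists (flatten [seq [seq (mdeg mon)%:Z + d i | mon <- msupp (x 0 i)] | i <- enum 'I_m]).
move=> s' us' ss'; apply/rowP => i; apply/mpolyP => mon.
rewrite summxE raddf_sum /=.
under eq_bigr => e _ do rewrite mxE mcoeff_hcomp.
have [xm|xm] := boolP (mon \in msupp (x 0 i)); last first.
  by rewrite (memN_msupp_eq0 xm) big1 // => e _; rewrite if_same.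
have es : (mdeg mon)%:Z + d i \in s'.
  apply: ss'; apply/flattenP; eexists; first by apply/mapP; exists i; [rewrite mem_enum|].
  by apply/mapP; exists mon.
rewrite (bigD1_seq _ es us') /= addrK eqxx big1 ?addr0 // => e ne.
by case: eqP => // E; rewrite E subrK eqxx in ne.
Qed.

Lemma hcomp_row_mulmx k m (sh : 'I_k -> int) (d : 'I_m -> int) (G : 'M[S]_(k, m)) e u :
  (forall i l, homog_of_degree (sh i - d l) (G i l)) ->
  hcomp_row sh e u *m G = hcomp_row d e (u *m G).
Proof.
move=> hG; apply/rowP => l; rewrite [LHS]mxE [RHS]mxE [(u *m G) _ _]mxE raddf_sum.
by apply: eq_bigr => i _ /=; rewrite mxE -(hcompM _ _ (hG i l)) addrA subrK.
Qed.

Lemma hcomp_row0 m (d : 'I_m -> int) e : hcomp_row d e 0 = 0.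
Proof. by apply/rowP => i; rewrite !mxE raddf0. Qed.

Definition homog_generators m (d : 'I_m -> int) (P : 'rV[S]_m -> Prop) k
    (sh : 'I_k -> int) (G : 'M[S]_(k, m)) : Prop :=
  (forall i l, homog_of_degree (sh i - d l) (G i l)) /\
  (forall x, P x <-> exists u, x = u *m G).

Lemma exists_homog_generators m (d : 'I_m -> int) (P : 'rV[S]_m -> Prop) :
  is_submodule P -> graded d P ->
  exists k (sh : 'I_k -> int) (G : 'M[S]_(k, m)), homog_generators d P sh G.
Proof.
move=> subP grP; have [k0 [G0 HG0]] := noetherian_mpoly3 subP.
have /fin_all_exists[s Hs] := fun i => hcomp_rowE d (row i G0).
pose t := undup (flatten [seq s i | i <- enum 'I_k0]).
have Et i : row i G0 = \sum_(b < size t) hcomp_row d (nth 0 t b) (row i G0).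
  rewrite {1}(Hs i t) ?undup_uniq //; first by rewrite (big_nth 0) big_mkord.
  move=> e es; rewrite mem_undup; apply/flattenP; exists (s i) => //.
  by apply/mapP; exists i; rewrite ?mem_enum.
pose I := ('I_k0 * 'I_(size t))%type.
pose ev (i : 'I_#|{: I}|) : I := enum_val i.
pose G := \matrix_i hcomp_row d (nth 0 t (ev i).2) (row (ev i).1 G0).
exists #|{: I}|, (fun i => nth 0 t (ev i).2), G; split.
  by move=> i l; rewrite !mxE; apply: homog_hcomp.
move=> x; rewrite HG0; split=> -[u ->]; last first.
  apply/HG0; apply: submodule_mulmx => // i; rewrite rowK; apply: grP; apply/HG0.
  exact: span_row.
apply: (submodule_mulmx _ (span_submodule G)) => i.
have [z0 zD zZ] := span_submodule G.
rewrite Et; apply: (big_ind (fun x => exists u, x = u *m G)) => // b _.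
have -> : hcomp_row d (nth 0 t b) (row i G0) = row (enum_rank (i, b)) G.
  by rewrite rowK /ev enum_rankK.
exact: span_row.
Qed.

Lemma redundant_generator m (d : 'I_m -> int) (P : 'rV[S]_m -> Prop) k
    (sh : 'I_k.+1 -> int) (G : 'M[S]_(k.+1, m)) (w : 'rV[S]_k.+1) i (c : K) :
  is_submodule P -> homog_generators d P sh G ->
  w *m G = 0 -> w 0 i = c%:MP -> c != 0 ->
  homog_generators d P (fun l => sh (lift i l)) (row' i G).
Proof.
move=> subP [hG gG] wG wi c0; split; first by move=> l j; rewrite mxE.
have rl j : row (lift i j) G = row j (row' i G) by apply/rowP => ?; rewrite !mxE.
have rowi l : exists u', row l G = u' *m row' i G.
  have [z0 zD zZ] := span_submodule (row' i G).
  have [j ->|->] := unliftP i l; first by rewrite rl; apply: span_row.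
  have -> : row i G = - (c^-1)%:MP *: \sum_(j < k) w 0 (lift i j) *: row (lift i j) G.
    move: wG; rewrite mulmx_sum_row (bigD1_ord i) //= => /eqP.
    rewrite addr_eq0 wi => /eqP E; rewrite -[LHS]scale1r -(mpolyC1 3 K) -(mulVf c0).
    by rewrite mpolyCM -scalerA E scalerN scaleNr.
  apply: (zZ); apply: (big_ind (fun x => exists u, x = u *m row' i G)) => // j _.
  by apply: zZ; rewrite rl; apply: span_row.
move=> x; rewrite gG; split=> -[y ->].
  exact: (submodule_mulmx _ (span_submodule (row' i G))).
apply: (submodule_mulmx _ (span_submodule G)) => l.
by rewrite -rl; apply: span_row.
Qed.

(* A generating family with the least number of elements is minimal: a relation with a unit coefficient would make a generator redundant. *)
Lemma exists_minimal_generators m (d : 'I_m -> int) (P : 'rV[S]_m -> Prop) :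
  is_submodule P -> graded d P ->
  exists (s : seq int) (G : 'M[S]_(size s, m)),
    [/\ forall (i : 'I_(size s)) l, homog_of_degree (nth 0 s i - d l) (G i l),
        forall x, P x <-> exists u, x = u *m G
      & forall u : 'rV_(size s), u *m G = 0 -> forall i, (u 0 i)@_0%MM = 0].
Proof.
move=> subP grP.
pose H k := exists (sh : 'I_k -> int) (G : 'M[S]_(k, m)), homog_generators d P sh G.
have [k Hk mink] : exists2 k, H k & forall k', (k' < k)%N -> ~ H k'.
  apply: NNPP => nmin; have [k0 [sh [G HG]]] := exists_homog_generators subP grP.
  suff nH k : ~ H k by apply: (nH k0); exists sh, G.
  by elim/ltn_ind: k => k IH Hk; apply: nmin; exists k.
have [sh [G [hG gG]]] := Hk.
have minG (u : 'rV_k) : u *m G = 0 -> forall i, (u 0 i)@_0%MM = 0.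
  move=> uG i; apply/eqP/negPn/negP => ui.
  (* In the component of degree [sh i] the i-th coefficient has degree 0, hence is the nonzero
     constant itself. *)
  pose w := hcomp_row sh (sh i) u.
  have wG : w *m G = 0 by rewrite (hcomp_row_mulmx _ _ hG) uG hcomp_row0.
  have wi : w 0 i = ((u 0 i)@_0%MM)%:MP.
    rewrite mxE subrr (homog_const (homog_hcomp 0 (u 0 i))) mcoeff_hcomp.
    by rewrite mdeg0 eqxx.
  set c := (u 0 i)@_0%MM in ui wi.
  case: k sh G hG gG Hk mink u uG i w wG c ui wi => [|k] sh G hG gG Hk mink u uG i w wG c ui wi.
    by case: i {ui wi w wG c} => [].
  apply: (mink k) => //; exists (fun l => sh (lift i l)), (row' i G).
  exact: redundant_generator wG wi ui.
have [s [ss Es]] : exists s : seq int, size s = k /\ forall i : 'I_k, nth 0 s i = sh i.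
  exists [seq sh i | i <- enum 'I_k]; rewrite size_map size_enum_ord; split=> // i.
  by rewrite (nth_map i) ?size_enum_ord // nth_ord_enum.
subst k; exists s, G; split=> // i l.
by rewrite Es.
Qed.

End MinimalGenerators.

(** * Second syzygies *)

Section SecondSyzygies.
Variable K : fieldType.
Local Notation S := {mpoly K[3]}.

Definition in_vars m (r : nat) (u : 'rV[S]_m) : Prop :=
  forall l, in_powers 1 (fun i : 'I_3 => (i < r)%N) (u 0 l).

Lemma in_varsD m r (u w : 'rV[S]_m) : in_vars r u -> in_vars r w -> in_vars r (u + w).
Proof. by move=> Hu Hw l; rewrite mxE; apply: in_powersD. Qed.

Lemma in_varsX m r (i : 'I_3) (u : 'rV[S]_m) : (i < r)%N -> in_vars r ('X_i *: u).
Proof. by move=> ir l; rewrite mxE mulrC -['X_i]expr1; apply: in_powers_gen. Qed.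

Lemma in_varsP m r (u : 'rV[S]_m) : in_vars r u <->
  exists h : 'I_3 -> 'rV[S]_m, u = \sum_(i < 3 | (i < r)%N) 'X_i *: h i.
Proof.
split=> [Hu|[h ->]].
  have /fin_all_exists[h Hh] := fun l => (in_powersP _ _ _).1 (Hu l).
  exists (fun i => \row_l h l i); apply/rowP => l; rewrite Hh summxE.
  by apply: eq_bigr => i _; rewrite !mxE expr1 mulrC.
apply: (big_ind (@in_vars m r)) => [l||i]; last exact: in_varsX.
  by rewrite mxE; apply: in_powers0.
exact: in_varsD.
Qed.

Lemma in_vars_mulmx m k r (u : 'rV[S]_m) (B : 'M[S]_(m, k)) :
  in_vars r u -> in_vars r (u *m B).
Proof.
move/in_varsP => [h ->]; apply/in_varsP; exists (fun i => h i *m B).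
by rewrite mulmx_suml; apply: eq_bigr => i _; rewrite scalemxAl.
Qed.

Lemma in_vars_reg m (i : 'I_3) (u : 'rV[S]_m) : in_vars i ('X_i *: u) -> in_vars i u.
Proof.
move=> H l; apply: (in_powers_reg (j := i)); first by rewrite /= ltnn.
by have := H l; rewrite mxE mulrC expr1.
Qed.

(** Let J be generated by the variables before X_i. A kernel element is X_i h + p with p in J; as
    X_i is regular modulo J, h B lies in J, so h is again a kernel element up to J. Repetition puts
    the kernel into J + (X_i^j) for all j, and these ideals intersect in J, as monomials show. *)
Lemma kernel_reduction m k (B : 'M[S]_(k, m)) (i : 'I_3) :
  (forall u : 'rV_k, in_vars i (u *m B) ->
     exists n w, [/\ n *m B = 0, in_vars i w & u = n + w]) ->
  (forall n : 'rV_k, n *m B = 0 -> in_vars i.+1 n) ->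
  forall n : 'rV_k, n *m B = 0 -> in_vars i n.
Proof.
move=> lift_i ker_i.
pose inJ j (f : S) := forall mon, f@_mon != 0 ->
  (exists2 i' : 'I_3, (i' < i)%N & (0 < mon i')%N) \/ (j <= mon i)%N.
suff kerJ j : forall n : 'rV_k, n *m B = 0 -> forall l, inJ j (n 0 l).
  move=> n nB l mon nl; case: (kerJ (mon i).+1 n nB l mon nl) => //.
  by rewrite ltnn.
elim: j => [|j IH] n nB l mon; first by right.
have /in_varsP[h] := ker_i n nB.
rewrite (bigD1 i) //= => En.
have Ep : \sum_(i0 < 3 | (i0 < i.+1)%N && (i0 != i)) 'X_i0 *: h i0 =
          \sum_(i0 < 3 | (i0 < i)%N) 'X_i0 *: h i0.
  by apply: eq_bigl => i0; rewrite ltnS ltn_neqAle andbC.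
rewrite Ep in En; set p := \sum_(i0 < 3 | _) _ in En.
have ip : in_vars i p by apply/in_varsP; exists h.
have : in_vars i (h i *m B).
  apply: in_vars_reg; have := nB; rewrite En mulmxDl -scalemxAl => /eqP.
  rewrite addr_eq0 => /eqP->; rewrite -mulNmx; apply: in_vars_mulmx.
  by move=> l'; rewrite mxE => mon'; rewrite mcoeffN oppr_eq0; apply: ip.
case/lift_i => n' [w [n'B iw Eh]].
rewrite En Eh scalerDr -addrA !mxE mcoeffD.
have iq : in_powers 1 (fun i0 : 'I_3 => (i0 < i)%N) ('X_i * w 0 l + p 0 l).
  apply: in_powersD => //; move/in_varsP: iw => [h' ->].
  have : in_vars i ('X_i *: \sum_(i0 < 3 | (i0 < i)%N) 'X_i0 *: h' i0).
    apply/in_varsP; exists (fun i0 => 'X_i *: h' i0); rewrite scaler_sumr.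
    by apply: eq_bigr => i0 _; rewrite !scalerA mulrC.
  by move/(_ l); rewrite mxE.
have [/eqP->|q0 _] := boolP (('X_i * w 0 l + p 0 l)@_mon == 0); last first.
  by left; apply: iq.
rewrite addr0 -mcoeff_msupp mulrC (perm_mem (msuppMX _ _)) => /mapP[mon' n'mon ->].
rewrite mcoeff_msupp in n'mon.
case: (IH n' n'B l mon' n'mon) => [[i' i'i mi']|jm]; [left|right].
  by exists i' => //; rewrite mnmDE ltn_addl.
by rewrite mnmDE mnm1E eqxx.
Qed.

(* M embeds in a free module with torsion-free cokernel, so that x, y is a regular sequence on M and the second syzygies of M are free. *)
Lemma second_syzygy_free p m k (M : 'rV[S]_p -> Prop) (A : 'M[S]_(m, p)) (B : 'M[S]_(k, m)) :
  (forall q, M ('X_o0 *: q) -> M q) ->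
  (forall x, M x <-> exists u, x = u *m A) ->
  (forall u : 'rV_m, u *m A = 0 <-> exists w, u = w *m B) ->
  (forall u : 'rV_k, u *m B = 0 -> forall l, (u 0 l)@_0%MM = 0) ->
  forall u : 'rV_k, u *m B = 0 -> u = 0.
Proof.
move=> satM genM exB minB.
have X0 q (i : 'I_3) (w : 'rV[S]_q) : 'X_i *: w = 0 -> w = 0.
  move=> E; apply/rowP => l; have /rowP/(_ l) := E; rewrite !mxE => /eqP.
  by rewrite mulf_eq0 -['X_i]expr1 (negbTE (Xn_neq0 _ _ _)) => /eqP.
have BA (w : 'rV_k) : w *m B *m A = 0 by apply/exB; exists w.
have ker3 (u : 'rV_k) : u *m B = 0 -> in_vars 3 u.
  move=> uB l mon ul; apply: NNPP => H.
  have E : mon = 0%MM.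
    apply/mnmP => i; rewrite mnm0E; apply/eqP; rewrite -leqn0 leqNgt.
    by apply/negP => mi; apply: H; exists i => //; case: i {mi}.
  by rewrite E minB ?eqxx in ul.
(* If u B = X_0 h_0 + X_1 h_1, then h_1 A = X_0 q and h_0 A = -X_1 q, with q = q' A in M by
   saturation. Correcting h_0 and h_1 by multiples of q' makes them syzygies w_0 B and w_1 B. *)
have ker2 : forall u : 'rV_k, u *m B = 0 -> in_vars 2 u.
  apply: (kernel_reduction (i := o2)) => // u.
  move/in_varsP => [h]; rewrite (bigD1 o0) //= (bigD1 o1) //= big1 ?addr0; last first.
    by move=> i; elim/ord3_ind: i.
  move=> Eu; have E0 : 'X_o0 *: (h o0 *m A) + 'X_o1 *: (h o1 *m A) = 0.
    by rewrite !scalemxAl -mulmxDl -Eu BA.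
  have [q Eq] : exists q, h o1 *m A = 'X_o0 *: q.
    have /fin_all_exists[q Hq] : forall l, exists q, (h o1 *m A) 0 l = q * 'X_o0 ^+ 1.
      move=> l; apply: (@powers_reg01 K 1 _ (- (h o0 *m A) 0 l)).
      rewrite !expr1 mulNr; apply/eqP; rewrite -addr_eq0 addrC.
      have /rowP/(_ l) := E0.
      by rewrite mxE [X in X + _]mxE [X in _ + X]mxE [RHS]mxE mulrC [_ * 'X_o1]mulrC mulrC => ->.
    by exists (\row_l q l); apply/rowP => l; rewrite Hq !mxE expr1 mulrC.
  have [q' Eq'] : exists q', q = q' *m A.
    by apply/genM/satM; rewrite -Eq; apply/genM; exists (h o1).
  have [w1 Ew1] : exists w1, h o1 - 'X_o0 *: q' = w1 *m B.
    by apply/exB; rewrite mulmxBl -scalemxAl -Eq' Eq subrr.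
  have [w0 Ew0] : exists w0, h o0 + 'X_o1 *: q' = w0 *m B.
    apply/exB; apply: (X0 _ o0); rewrite mulmxDl -scalemxAl -Eq' scalerDr.
    by rewrite scalerA [_ * 'X_o1]mulrC -scalerA -Eq.
  exists (u - ('X_o0 *: w0 + 'X_o1 *: w1)), ('X_o0 *: w0 + 'X_o1 *: w1).
  split; last by rewrite subrK.
    rewrite mulmxBl mulmxDl -!scalemxAl -Ew0 -Ew1 Eu scalerBr scalerDr !scalerA.
    by rewrite [_ * 'X_o1]mulrC [X in _ - X]addrACA subrr addr0 subrr.
  by apply: in_varsD; apply: in_varsX.
have ker1 : forall u : 'rV_k, u *m B = 0 -> in_vars 1 u.
  apply: (kernel_reduction (i := o1)) => // u.
  move/in_varsP => [h]; rewrite (bigD1 o0) //= big1 ?addr0; last first.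
    by move=> i; elim/ord3_ind: i.
  move=> Eu; have [w Ew] : exists w, h o0 = w *m B.
    by apply/exB; apply: (X0 _ o0); rewrite scalemxAl -Eu BA.
  exists (u - 'X_o0 *: w), ('X_o0 *: w); split; last by rewrite subrK.
    by rewrite mulmxBl -scalemxAl -Ew Eu subrr.
  exact: in_varsX.
have ker0 : forall u : 'rV_k, u *m B = 0 -> in_vars 0 u.
  apply: (kernel_reduction (i := o0)) => // u /in_varsP[h].
  rewrite big1 // => uB; exists u, 0; split; rewrite ?addr0 //.
  by move=> l; rewrite mxE; apply: in_powers0.
move=> u uB; have /in_varsP[h] := ker0 u uB.
by rewrite big1.
Qed.

End SecondSyzygies.

(** * The self-duality of D0 *)

Section MaximalPrimary.
Variables (K : fieldType) (n : nat) (alpha : 'I_n -> 'rV[K]_3).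
Local Notation S := {mpoly K[3]}.
Local Notation lf := linear_form_poly.

(** Nonzero at [p], so that an ideal containing these products for all points has no K-rational zero
    in P^2. *)
Definition off_point (p : 'cV[K]_3) : S :=
  \prod_(i | (alpha i *m p) 0 0 != 0) lf (alpha i).

Definition ideal_plus_forms (I : S -> Prop) r (U : 'M[K]_(r, 3)) (f : S) : Prop :=
  exists2 g, I g & exists h : 'I_r -> S, f = g + \sum_l h l * lf (row l U).

Lemma ideal_plus_formsP (I : S -> Prop) r (U : 'M[K]_(r, 3)) :
  is_ideal I -> is_ideal (ideal_plus_forms I U).
Proof.
case=> I0 ID IM; split.
- exists 0 => //; exists (fun=> 0); rewrite big1 ?addr0 // => l _; exact: mul0r.
- move=> _ _ [g Ig [h ->]] [g' Ig' [h' ->]]; exists (g + g'); first exact: ID.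
  exists (fun l => h l + h' l); rewrite addrACA -big_split /=; congr (_ + _).
  by apply: eq_bigr => l _; rewrite mulrDl.
- move=> c _ [g Ig [h ->]]; exists (c * g); first exact: IM.
  exists (fun l => c * h l); rewrite mulrDr mulr_sumr; congr (_ + _).
  by apply: eq_bigr => l _; rewrite mulrA.
Qed.

Lemma kernel_vector r (U : 'M[K]_(r, 3)) : (\rank U < 3)%N ->
  exists2 p : 'cV[K]_3, p != 0 & U *m p = 0.
Proof.
move=> rU; have : cokermx U != 0.
  by rewrite -mxrank_eq0 mxrank_coker subn_eq0 -ltnNge.
move=> c0; have [j cj] : exists j, col j (cokermx U) != 0.
  apply: NNPP => H; case/eqP: c0; apply/matrixP => i j; rewrite mxE.
  have : col j (cokermx U) = 0 by apply/eqP/negPn/negP => cj; apply: H; exists j.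
  by move=> /matrixP/(_ i 0); rewrite !mxE.
by exists (col j (cokermx U)) => //; rewrite colE mulmxA mulmx_coker mul0mx.
Qed.

(* As long as the forms inverted so far have a common zero p, the product of the forms not vanishing at p gives new ones, independent of the previous ones. *)
Lemma power_in_ideal_plus_forms (I : S -> Prop) (d r : nat) (U : 'M[K]_(r, 3)) k :
  is_ideal I -> (forall p, p != 0 -> I (off_point p)) ->
  (3 - \rank U <= d)%N -> exists N, ideal_plus_forms I U ('X_k ^+ N).
Proof.
move=> idI Ioff; elim: d r U => [|d IH] r U rd.
  have rU : row_full U by rewrite /row_full eqn_leq rank_leq_col -subn_eq0 -leqn0.
  have /submxP[w Ew] : ((delta_mx 0 k : 'rV[K]_3) <= U)%MS by apply: submx_full.
  exists 1%N, 0; first by case: idI.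
  exists (fun l => (w 0 l)%:MP); rewrite add0r expr1.
  rewrite -linear_form_delta.
  rewrite Ew linear_form_mulmx; apply: eq_bigr => l _.
  by rewrite mul_mpolyC.
have [lt3|] := ltnP (\rank U) 3; last first.
  by move=> le3; apply: IH; rewrite (eqP le3).
have idU := ideal_plus_formsP U idI; have [U0 UD UM] := idU.
have [p p0 Up] := kernel_vector lt3.
have H i : (alpha i *m p) 0 0 != 0 ->
    exists N c, ideal_plus_forms I U ('X_k ^+ N - c * lf (alpha i)).
  move=> aip.
  have [|N [g Ig [h Eh]]] := IH _ (col_mx U (alpha i)).
    suff : (\rank U < \rank (col_mx U (alpha i)))%N by lia.
    have sU : (U <= col_mx U (alpha i))%MS by rewrite -addsmxE addsmxSl.
    rewrite ltn_neqAle mxrankS // andbT; apply/negP => /eqP E.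
    have : (col_mx U (alpha i) <= U)%MS by rewrite -(geq_leqif (mxrank_leqif_sup sU)) E.
    rewrite -addsmxE addsmx_sub => /andP[_ /submxP[w Ew]].
    by rewrite Ew -mulmxA Up mulmx0 mxE eqxx in aip.
  exists N, (h (rshift r 0)), g => //; exists (fun l => h (lshift 1 l)).
  rewrite Eh big_split_ord /= big_ord1 addrA.
  rewrite rowKd row_id addrK; congr (_ + _).
  by apply: eq_bigr => l _; rewrite rowKu.
have [N [c HN]] : exists N c, ideal_plus_forms I U ('X_k ^+ N - c * off_point p).
  rewrite /off_point; apply: (big_rec (fun f => exists N c, ideal_plus_forms I U ('X_k ^+ N - c * f))).
    by exists 0%N, 1; rewrite expr0 mulr1 subrr.
  move=> i f /H[N1 [c1 H1]] [N2 [c2 H2]]; exists (N2 + N1)%N, (c1 * c2).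
  have -> : 'X_k ^+ (N2 + N1) - c1 * c2 * (lf (alpha i) * f) =
     'X_k ^+ N2 * ('X_k ^+ N1 - c1 * lf (alpha i)) +
     c1 * lf (alpha i) * ('X_k ^+ N2 - c2 * f).
    rewrite exprD; move: ('X_k ^+ N1) ('X_k ^+ N2) => x y; ring.
  by apply: UD; apply: UM.
exists N; rewrite -(subrK (c * off_point p) ('X_k ^+ N)); apply: UD => //; apply: UM.
exists (off_point p); first exact: Ioff.
by exists (fun=> 0); rewrite big1 ?addr0 // => l _; apply: mul0r.
Qed.

Lemma power_in_ideal (I : S -> Prop) : (0 < n)%N -> is_ideal I ->
  (forall p i, p != 0 -> (alpha i *m p) 0 0 = 0 -> I (off_point p)) ->
  exists N, forall k : 'I_3, I ('X_k ^+ N).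
Proof.
move=> n0 idI Ioff; have [I0 ID IM] := idI.
(* Off all the lines [off_point p] is Q itself, a multiple of [off_point q] for any q on the first
   line. *)
have {}Ioff p : p != 0 -> I (off_point p).
  move=> p0; have [[i ip]|H] := classic (exists i, (alpha i *m p) 0 0 = 0).
    exact: Ioff ip.
  pose i0 := Ordinal n0.
  have [|q q0 aq] := @kernel_vector _ (alpha i0).
    exact: leq_ltn_trans (rank_leq_row _) _.
  have Iq : I (off_point q) by apply: (Ioff q i0) => //; rewrite aq mxE.
  have -> : off_point p = (\prod_(i | (alpha i *m q) 0 0 == 0) lf (alpha i)) * off_point q.
    rewrite /off_point (eq_bigl xpredT) => [|i]; last by apply/eqP => ip; apply: H; exists i.
    by rewrite (bigID (fun i => (alpha i *m q) 0 0 == 0)).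
  exact: IM.
have /fin_all_exists[N HN] : forall k : 'I_3, exists N, I ('X_k ^+ N).
  move=> k; have [N [g Ig [h Eh]]] :=
    @power_in_ideal_plus_forms I 3 0 0 k idI Ioff (leq_subr _ _).
  by exists N; rewrite Eh big_ord0 addr0.
exists (\sum_k N k)%N => k.
by rewrite (bigD1 k) //= exprD mulrC; apply: IM.
Qed.

End MaximalPrimary.

Lemma scalemx_torsion_free (R : idomainType) p q (c : R) (M : 'M[R]_(p, q)) :
  c != 0 -> c *: M = 0 -> M = 0.
Proof.
move=> c0 cM; apply/matrixP => i j; have /matrixP/(_ i j) := cM; rewrite !mxE.
by move/eqP; rewrite mulf_eq0 (negbTE c0) => /eqP.
Qed.

(** By [vector_cramer], det(e, e1, e2) times a row is a combination of e1, e2 and e, whose first two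
    coefficients are q times entries of c1 and c2. Only the multiple of e remains, and in D0 such a
    multiple must vanish. *)
Lemma triple_col_cramer (R : comPzRingType) m (e : 'rV[R]_3) (A : 'M[R]_(m, 3))
    (q g : R) (c1 c2 : 'cV[R]_m) e1 e2 i :
  q *: c1 = triple_col e A e1 -> q *: c2 = triple_col e A e2 ->
  dot e (cross e1 e2) = g * q ->
  q *: row i (g *: A - c2 *m e1 + c1 *m e2) = dot (row i A) (cross e1 e2) *: e.
Proof.
move=> /colP/(_ i) E1 /colP/(_ i) E2 Eg.
have -> : row i (g *: A - c2 *m e1 + c1 *m e2) =
    g *: row i A - c2 i 0 *: e1 + c1 i 0 *: e2.
  by apply/rowP => j; rewrite !mxE !big_ord1.
rewrite scalerDr scalerBr !scalerA [q * g]mulrC -Eg (vector_cramer e e1 e2).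
rewrite !mxE in E1 E2; rewrite E1 E2.
move: (dot e (cross _ e2)) (dot e (cross _ e1)) (dot _ (cross e1 e2)) => x y z.
by apply/rowP => j; rewrite !mxE; ring.
Qed.

Section SelfDuality.
Variables (K : fieldType) (n : nat) (alpha : 'I_n -> 'rV[K]_3).
Hypotheses (arr : line_arrangement alpha) (n_neq0 : n%:R != 0 :> K).
Local Notation S := {mpoly K[3]}.
Local Notation lf := linear_form_poly.
Local Notation E := (euler K).
Local Notation Q := (defining_poly alpha).
Local Notation off i := (\prod_(j | j != i) lf (alpha j)).

Variables (m k : nat) (A : 'M[S]_(m, 3)) (B : 'M[S]_(k, m)).
Hypothesis genA : forall x, D0 alpha x <-> exists u, x = u *m A.
Hypothesis exB : forall u : 'rV_m, u *m A = 0 <-> exists w, u = w *m B.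

Lemma D0_row i : D0 alpha (row i A).
Proof. by apply/genA; apply: span_row. Qed.

Lemma syzygy_mul : B *m A = 0.
Proof.
apply/row_matrixP => i; rewrite row_mul row0; apply/exB.
by exists (delta_mx 0 i); rewrite rowE.
Qed.

Local Notation pairing := (triple_col E A).

Lemma syzygy_pairing w : B *m pairing w = 0.
Proof.
apply/row_matrixP => j; rewrite row_mul row0 mul_triple_col -row_mul syzygy_mul row0.
by rewrite dot_crossC dot0l oppr0 raddf0.
Qed.

Lemma scale_Q_logarithmic (z : 'rV[S]_3) : logarithmic alpha (Q *: z).
Proof.
move=> i; rewrite dotZr; apply: dividesMr.
exact: (divides_defining_poly arr Q).1 (divides_refl Q) i.
Qed.

(** The cross product kills alpha_i, and every other form divides the scalar factor. These
    derivations test one line at a time. *)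
Lemma off_cross_logarithmic i b :
  logarithmic alpha (off i *: cross (const_vec (alpha i)) (const_vec b)).
Proof.
move=> j; rewrite dotZr; have [->|ji] := eqVneq j i.
  by rewrite dot_cross_left mulr0; apply: divides0.
apply/dividesMr; rewrite (bigD1 j) //=.
exact/dividesMr/divides_refl.
Qed.

Lemma mul_triple_col_projection (y : 'rV[S]_m) (w : 'rV[S]_3) h :
  w - h *: E = y *m A ->
  forall z, y *m pairing z = (dot E (cross w z))%:M.
Proof.
by move=> Ey z; rewrite mul_triple_col -Ey dot_cross_modl.
Qed.

(** Nondegeneracy: Q z lies in D0 up to a multiple of E for every z, so det(E, w, z) = 0 for all z,
    that is, E cross w = 0. *)
Lemma pairing_eq0 w : pairing w = 0 -> exists h, w = h *: E.
Proof.
move=> pw; apply: cross_euler_eq0; apply: eq_dot => z; rewrite dot0l.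
have [h] := logarithmic_D0 n_neq0 (scale_Q_logarithmic z).
case/genA => y Ey; have := mul_triple_col_projection Ey w.
rewrite pw mulmx0 crossZl dotZr => /(congr1 (fun x : 'M_1 => x 0 0)).
rewrite [LHS]mxE [RHS]mxE mulr1n => /eqP.
rewrite eq_sym mulf_eq0 (negbTE (defining_poly_neq0 arr)) /=.
by rewrite dot_crossC oppr_eq0 dotC => /eqP.
Qed.

Lemma pairing_D0_eq0 w : D0 alpha w -> pairing w = 0 -> w = 0.
Proof.
move=> Dw /pairing_eq0[h Eh]; rewrite Eh in Dw *.
by rewrite (D0_euler arr n_neq0 Dw) scale0r.
Qed.

Lemma syzygy_rows (l : nat) (M : 'M[S]_(l, m)) : M *m A = 0 -> exists W, M = W *m B.
Proof.
move=> MA; have /fin_all_exists[w Hw] : forall i : 'I_l, exists w, row i M = w *m B.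
  by move=> i; apply/exB; rewrite -row_mul MA row0.
exists (\matrix_i w i); apply/row_matrixP => i.
by rewrite row_mul rowK.
Qed.

(* Cramer's rule: on D0, multiplication by <et1, et2> factors through a free module of rank 2. *)
Lemma annihilator_pairing (g : S) et1 et2 (phi : 'cV[S]_k) :
  (forall u : 'rV_k, u *m B = 0 -> u = 0) ->
  logarithmic alpha et1 -> logarithmic alpha et2 ->
  dot E (cross et1 et2) = g * Q -> exists psi, g *: phi = B *m psi.
Proof.
move=> injB l1 l2 Eg.
have [h1 /[dup] D1 /genA[y1 Ey1]] := logarithmic_D0 n_neq0 l1.
have [h2 /[dup] D2 /genA[y2 Ey2]] := logarithmic_D0 n_neq0 l2.
rewrite -(dot_cross_mod _ _ _ h1 h2) in Eg.
set e1 := et1 - _ in D1 Ey1 Eg; set e2 := et2 - _ in D2 Ey2 Eg.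
have c_of e : D0 alpha e -> exists c : 'cV[S]_m, Q *: c = pairing e.
  move=> De; have /fin_all_exists[c Hc] : forall i, exists c, pairing e i 0 = c * Q.
    move=> i; rewrite mxE.
    have := divides_pairing arr (D0_logarithmic arr (D0_row i)) (D0_logarithmic arr De).
    by case=> c; exists c.
  by exists (\col_i c i); apply/colP => i; rewrite Hc !mxE mulrC.
have [c1 Ec1] := c_of _ D1; have [c2 Ec2] := c_of _ D2.
have Q0 := defining_poly_neq0 arr.
have Bc (c : 'cV[S]_m) e : Q *: c = pairing e -> B *m c = 0.
  move=> Ec; have := syzygy_pairing e; rewrite -Ec -scalemxAr.
  exact: scalemx_torsion_free.
(* Multiplication by g minus its factorization through rank 2, lifted to the generators. It kills A,
   hence is W B, and W is a homotopy: B W = g. *)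
pose M := g%:M - c2 *m y1 + c1 *m y2.
have MA : M *m A = 0.
  apply/row_matrixP => i; rewrite row_mul row0.
  have Dz : D0 alpha (row i M *m A) by apply/genA; exists (row i M).
  suff [h Eh] : exists h, Q *: (row i M *m A) = h *: E.
    have := D0Z Q Dz; rewrite Eh => /(D0_euler arr n_neq0) h0.
    by apply: (scalemx_torsion_free Q0); rewrite Eh h0 scale0r.
  exists (dot (row i A) (cross e1 e2)); rewrite -row_mul.
  have -> : M *m A = g *: A - c2 *m e1 + c1 *m e2.
    by rewrite /M mulmxDl mulmxBl mul_scalar_mx -!mulmxA -Ey1 -Ey2.
  exact: (triple_col_cramer i Ec1 Ec2 Eg).
have [W EW] := syzygy_rows MA.
have BM : B *m M = g *: B.
  rewrite /M mulmxDr mulmxBr !mulmxA (Bc _ _ Ec1) (Bc _ _ Ec2) !mul0mx subr0 addr0.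
  by rewrite mul_mx_scalar.
have BW : B *m W = g%:M.
  apply/row_matrixP => j; apply/eqP; rewrite -subr_eq0; apply/eqP/injB.
  by rewrite mulmxBl -!row_mul -mulmxA -EW BM mul_scalar_mx subrr.
by exists (W *m phi); rewrite mulmxA BW mul_scalar_mx.
Qed.

Lemma annihilator_ideal (phi : 'cV[S]_k) : is_ideal (fun g : S => exists psi, g *: phi = B *m psi).
Proof.
split.
- by exists 0; rewrite scale0r mulmx0.
- by move=> g h [x Ex] [y Ey]; exists (x + y); rewrite scalerDl Ex Ey mulmxDr.
- by move=> c g [x Ex]; exists (c *: x); rewrite -scalerA Ex scalemxAr.
Qed.

(** The derivation constant in direction p, scaled by [off_point], is paired with the test
    derivation of alpha_i and b, where b(p) is nonzero. As alpha_i(p) = 0, the determinant is b(p)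
    times [off_point] times Q. *)
Lemma annihilator_off_point (p : 'cV[K]_3) i (phi : 'cV[S]_k) :
  (forall u : 'rV_k, u *m B = 0 -> u = 0) ->
  p != 0 -> (alpha i *m p) 0 0 = 0 ->
  exists psi, off_point alpha p *: phi = B *m psi.
Proof.
move=> injB p0 aip.
have dotp (a : 'rV[K]_3) : dot (const_vec p^T) (const_vec a) = ((a *m p) 0 0)%:MP.
  rewrite mxE raddf_sum; apply: eq_bigr => l _.
  by rewrite !mxE /= mpolyCM mulrC.
have [b bp] : exists b : 'rV[K]_3, (b *m p) 0 0 != 0.
  have [l pl] : exists l, p l 0 != 0.
    apply: NNPP => H; case/eqP: p0; apply/colP => l; rewrite mxE.
    by apply/eqP/negPn/negP => pl; apply: H; exists l.
  by exists (delta_mx 0 l); rewrite -rowE mxE.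
set c := (b *m p) 0 0 in bp.
have [|||psi Epsi] := @annihilator_pairing (c%:MP * off_point alpha p)
  (off_point alpha p *: const_vec p^T)
  (off i *: cross (const_vec (alpha i)) (const_vec b)) phi injB.
- move=> j; rewrite dotZr dotC dotp; have [->|ajp] := eqVneq ((alpha j *m p) 0 0) 0.
    by rewrite mpolyC0 mulr0; apply: divides0.
  by apply: dividesMr; rewrite /off_point (bigD1 j) //=; apply/dividesMr/divides_refl.
- exact: off_cross_logarithmic.
- rewrite crossZl crossZr !dotZr dot_cross3 !dotp aip mpolyC0 mulr0 subr0 -/c.
  rewrite -linear_form_polyE /defining_poly [in RHS](bigD1 i) //=.
  move: (off_point alpha p) (lf (alpha i)) (off i) (c%:MP) => x y z w; ring.
exists ((c^-1)%:MP *: psi); rewrite -scalemxAr -Epsi !scalerA mulrA -mpolyCM.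
by rewrite mulVf // mpolyC1 mul1r.
Qed.

(* A functional on D0 that kills the syzygies comes from D0 itself, by the self-duality of D0. *)
Lemma functional_pairing (chi : 'cV[S]_m) : B *m chi = 0 ->
  exists2 w, D0 alpha w & Q *: chi = pairing w.
Proof.
move=> Bchi; have Q0 := defining_poly_neq0 arr.
have ker (u : 'rV_m) : u *m A = 0 -> u *m chi = 0.
  by case/exB => w ->; rewrite -mulmxA Bchi mulmx0.
have /fin_all_exists[h /fin_all_exists[y Hy]] : forall l : 'I_3, exists h y,
    Q *: delta_mx 0 l - h *: E = y *m A.
  move=> l; have [h /genA[y Ey]] := logarithmic_D0 n_neq0 (scale_Q_logarithmic (delta_mx 0 l)).
  by exists h, y.
pose Y := \matrix_l y l : 'M[S]_(3, m).
have YA (e : 'rV[S]_3) : exists c, e *m Y *m A = Q *: e - c *: E.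
  exists (\sum_l e 0 l * h l); rewrite -mulmxA mulmx_sum_row.
  under eq_bigr => l _ do rewrite row_mul rowK -Hy scalerBr !scalerA.
  rewrite sumrB scaler_suml; congr (_ - _).
  rewrite [in RHS](row_sum_delta e) scaler_sumr; apply: eq_bigr => l _.
  by rewrite scalerA mulrC.
have D0YA (e : 'rV[S]_3) : D0 alpha (e *m Y *m A) by apply/genA; exists (e *m Y).
have YAD e : D0 alpha e -> e *m Y *m A = Q *: e.
  move=> De; have [c Ec] := YA e.
  have : D0 alpha (c *: E).
    have -> : c *: E = Q *: e - e *m Y *m A by rewrite Ec subKr.
    by apply: D0B => //; apply: D0Z.
  by rewrite Ec => /(D0_euler arr n_neq0)->; rewrite scale0r subr0.
have EY : E *m Y *m A = 0.
  have [c Ec] := YA E; have := D0YA E; rewrite Ec -scalerBl.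
  by move/(D0_euler arr n_neq0)->; rewrite scale0r.
(* Extends Q chi from D0 to a functional on S^3 that vanishes on E; Koszul exactness then writes it
   as E cross w. *)
pose u := (Y *m chi)^T.
have dotu (e : 'rV[S]_3) : e *m (Y *m chi) = (dot e u)%:M.
  rewrite [LHS]mx11_scalar; congr (_%:M); rewrite mxE; apply: eq_bigr => l _.
  by rewrite [u 0 l]mxE.
have Eu : dot E u = 0.
  have := ker _ EY; rewrite -mulmxA dotu => /(congr1 (fun x : 'M_1 => x 0 0)).
  by rewrite !mxE mulr1n.
have key (x : 'rV[S]_m) : Q *: (x *m chi) = (dot (x *m A) u)%:M.
  rewrite -dotu; apply/eqP; rewrite -subr_eq0; apply/eqP.
  rewrite scalemxAl [X in _ - X]mulmxA -mulmxBl; apply: ker.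
  rewrite mulmxBl -scalemxAl YAD ?subrr //.
  by apply/genA; exists x.
have [w Ew] := dot_euler_eq0 Eu.
(* On the test derivation of line i, [key] can be divided by the product of the other forms; the
   remaining factor alpha_i on the left gives divisibility. *)
have lw : logarithmic alpha w.
  move=> i; apply: divides_of_cross; first exact: alpha_neq0 arr i.
  move=> b; rewrite -Ew.
  have [g /genA[x Ex]] := logarithmic_D0 n_neq0 (off_cross_logarithmic i b).
  have := key x; rewrite -Ex dotBl dotZl dotZl Eu mulr0 subr0.
  move=> /(congr1 (fun x : 'M_1 => x 0 0)); rewrite !mxE mulr1n.
  rewrite {1}/defining_poly (bigD1 i) //= [lf _ * _]mulrC -mulrA.
  move/(mulfI (_ : off i != 0)) => <-; first exact/dividesMr/divides_refl.
  by apply/prodf_neq0 => j _; apply: linear_form_neq0; apply: alpha_neq0 arr j.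
have [g Dg] := logarithmic_D0 n_neq0 lw.
exists (- 1 *: (w - g *: E)); first exact: D0Z.
rewrite triple_colZ triple_colB triple_col_same subr0; apply/colP => i; rewrite !mxE.
have := key (delta_mx 0 i); rewrite -!rowE => /(congr1 (fun x : 'M_1 => x 0 0)).
rewrite [LHS]mxE [X in _ * X]mxE [RHS]mxE mulr1n => ->.
by rewrite Ew dot_crossC mulN1r.
Qed.

End SelfDuality.

Lemma divided_difference (R : comPzRingType) (x y u v l : R) :
  x * u - y * v = y * (x * l - v) - x * (y * l - u).
Proof. by ring. Qed.

Lemma divided_difference1 (R : comPzRingType) (x u v l : R) :
  u - x * v = x * (l - v) - (x * l - u).
Proof. by ring. Qed.

Lemma scaled_difference (R : comPzRingType) (x l v t o e : R) :
  x * v = t - o - e -> x * (l - v) = (x * l - t) + o + e.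
Proof. by move=> E; rewrite mulrBr E; ring. Qed.

Lemma scalemx_inj (R : idomainType) p q (c : R) (M M' : 'M[R]_(p, q)) :
  c != 0 -> c *: M = c *: M' -> M = M'.
Proof.
move=> c0 E; apply/eqP; rewrite -subr_eq0; apply/eqP/(scalemx_torsion_free c0).
by rewrite scalerBr E subrr.
Qed.

(** * Weak perspectives as extensions of D0 *)

Section KoszulComparison.
Variables (R : comPzRingType) (x : 'I_3 -> R) (m : nat) (e : 'rV[R]_3) (A : 'M[R]_(m, 3)) (q : R).
Implicit Types (psi chi : 'I_3 -> 'cV[R]_m) (th om : 'I_3 -> 'rV[R]_3).

Lemma koszul_triple psi om : (forall a, q *: psi a = triple_col e A (om a)) ->
  forall a, triple_col e A (koszul x om a) = q *: koszul x psi a.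
Proof. by move=> H a; rewrite -koszulZ -triple_col_koszul; apply: eq_koszul. Qed.

Lemma koszul_triple_left psi chi th (v : 'rV[R]_3) :
  (forall a, q *: koszul x psi a = triple_col e A (koszul x th a)) ->
  (forall a, q *: chi a = triple_col e A (th a - x a *: v)) ->
  forall a, q *: koszul x (fun b => psi b - chi b) a = 0.
Proof.
move=> Hk /koszul_triple Hc a.
by rewrite koszulB scalerBr Hk -Hc koszulB koszulX subr0 subrr.
Qed.

Lemma koszul_triple_right psi th om :
  (forall a, q *: koszul x psi a = triple_col e A (koszul x th a)) ->
  (forall a, q *: psi a = triple_col e A (om a)) ->
  forall a, triple_col e A (koszul x (fun b => th b - om b) a) = 0.
Proof. by move=> Hk /koszul_triple Ho a; rewrite koszulB triple_colB -Hk Ho subrr. Qed.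

End KoszulComparison.

Section Correspondence.
Variables (K : fieldType) (n : nat) (alpha : 'I_n -> 'rV[K]_3).
Hypotheses (arr : line_arrangement alpha) (n_neq0 : n%:R != 0 :> K).
Local Notation S := {mpoly K[3]}.
Local Notation lf := linear_form_poly.
Local Notation E := (euler K).
Local Notation Q := (defining_poly alpha).

Variables (m k : nat) (A : 'M[S]_(m, 3)) (B : 'M[S]_(k, m)).
Hypothesis genA : forall x, D0 alpha x <-> exists u, x = u *m A.
Hypothesis exB : forall u : 'rV_m, u *m A = 0 <-> exists w, u = w *m B.
Hypothesis injB : forall u : 'rV_k, u *m B = 0 -> u = 0.
Local Notation pairing := (triple_col E A).

(* phi stands for a class in Ext^1(D0, S), the cokernel of the transpose of B,
   and lam for a class in the cokernel C of S^3 -> (+)_i S/(alpha i). Both are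
   killed by a power of the maximal ideal; th and psi are the Cech data that
   lift X_a^N lam to S^3 and X_a^N phi to the dual of the generators, and the
   last condition matches their coboundaries under D0 = Hom(D0, S)(-(n-1)). *)
Definition corresponds (phi : 'cV[S]_k) (lam : 'I_n -> S) : Prop :=
  exists N (psi : 'I_3 -> 'cV[S]_m) (th : 'I_3 -> 'rV[S]_3),
    [/\ forall a, powers K N a *: phi = B *m psi a,
        forall a i, divides (lf (alpha i)) (powers K N a * lam i - dot (const_vec (alpha i)) (th a))
      & forall a, Q *: koszul (powers K N) psi a = pairing (koszul (powers K N) th a)].

(* By three-term relations, these are the weak perspectives; algebraically, the degree 0 classes of C that vanish at every point of P^2. *)
Definition locally_linear (lam : 'I_n -> K) : Prop :=
  forall p : 'cV[K]_3, p != 0 -> exists v : 'cV[K]_3,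
    forall i, (alpha i *m p) 0 0 = 0 -> lam i = (alpha i *m v) 0 0.

Lemma n_gt0 : (0 < n)%N.
Proof. by rewrite lt0n; apply: contraNneq n_neq0 => ->. Qed.

Lemma powers_neq0 N a : powers K N a != 0.
Proof. exact: Xn_neq0. Qed.

Lemma pairing_quotient w : logarithmic alpha w -> exists c : 'cV[S]_m, Q *: c = pairing w.
Proof.
move=> lw; have /fin_all_exists[c Hc] : forall i, exists c, pairing w i 0 = c * Q.
  move=> i; rewrite mxE.
  have := divides_pairing arr (D0_logarithmic arr (D0_row genA i)) lw.
  by case=> c; exists c.
by exists (\col_i c i); apply/colP => i; rewrite Hc !mxE mulrC.
Qed.

Lemma syzygy_quotient (c : 'cV[S]_m) w : Q *: c = pairing w -> B *m c = 0.
Proof.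
move=> Ec; apply: (scalemx_torsion_free (defining_poly_neq0 arr)).
by rewrite scalemxAr Ec (syzygy_pairing exB).
Qed.

(** The Koszul boundary of psi is killed by B, hence is a pairing with elements of D0. These form a
    Koszul cycle, since the pairing is faithful on D0, so they bound some th; modulo alpha_i the
    values of th on alpha_i are compatible and come from a single lam_i. *)
Lemma corresponds_of_functional phi : exists lam, corresponds phi lam.
Proof.
have [N HN] := power_in_ideal n_gt0 (annihilator_ideal B phi)
  (fun p i p0 ip => annihilator_off_point arr n_neq0 genA exB phi injB p0 ip).
have /fin_all_exists[psi Hpsi] : forall a, exists psi, powers K N a *: phi = B *m psi.
  by move=> a; apply: HN.
have /fin_all_exists2[om Dom Hom] : forall a, exists2 w, D0 alpha w &
    Q *: koszul (powers K N) psi a = pairing w.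
  move=> a; apply: (functional_pairing arr n_neq0 genA exB).
  rewrite -koszul_mulmxl -(koszulX (powers K N) phi a).
  by apply: eq_koszul => b; rewrite Hpsi.
have /koszul2_exact[th Hth] : \sum_a powers K N a *: om a = 0.
  apply: (pairing_D0_eq0 arr n_neq0 genA); first by apply: D0_sum => a; apply: D0Z.
  rewrite triple_col_sum.
  under eq_bigr => a _ do rewrite triple_colZ -Hom scalerA mulrC -scalerA.
  by rewrite -scaler_sumr koszul_closed scaler0.
have lth a b i : divides (lf (alpha i))
   ('X_b ^+ N * dot (const_vec (alpha i)) (th a) - 'X_a ^+ N * dot (const_vec (alpha i)) (th b)).
  rewrite -!dotZr -dotBr.
  pose P (y : 'rV[S]_3) := divides (lf (alpha i)) (dot (const_vec (alpha i)) y).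
  apply: (koszul_pairs (x := powers K N) (P := P)) => [|y Py|c]; rewrite /P.
  - by rewrite dot0r; apply: divides0.
  - by rewrite -scaleN1r dotZr; apply: dividesMl.
  - by rewrite -Hth; have := D0_logarithmic arr (Dom c) i.
have /fin_all_exists[lam Hlam] := fun i => koszul_mod_linear_form (alpha_neq0 arr i) (fun a b => lth a b i).
exists lam, N, psi, th; split=> [a|a i|a]; [exact: Hpsi | exact: Hlam |].
by rewrite Hom Hth.
Qed.

(** The same chase backwards. The polynomials g for which g lam comes from S^3 form an ideal;
    linearity of lam at p puts [off_point p] into it. *)
Lemma corresponds_of_locally_linear lam : locally_linear lam ->
  exists phi, corresponds phi (fun i => (lam i)%:MP).
Proof.
move=> LL.
pose I (g : S) := exists th : 'rV[S]_3, forall i,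
  divides (lf (alpha i)) (g * (lam i)%:MP - dot (const_vec (alpha i)) th).
have idI : is_ideal I.
  split.
  - by exists 0 => i; rewrite mul0r dot0r subrr; apply: divides0.
  - move=> g h [t Ht] [u Hu]; exists (t + u) => i.
    by rewrite mulrDl dotDr opprD addrACA; apply: dividesD.
  - move=> c g [t Ht]; exists (c *: t) => i.
    by rewrite dotZr -mulrA -mulrBr; apply: dividesMl.
have [p i p0 _|N HN] := @power_in_ideal K n alpha I n_gt0 idI.
  have [v Hv] := LL p p0; exists (off_point alpha p *: const_vec v^T) => j.
  rewrite dotZr -mulrBr.
  have dotv : dot (const_vec (alpha j)) (const_vec v^T) = ((alpha j *m v) 0 0)%:MP.
    rewrite mxE raddf_sum; apply: eq_bigr => l _.
    by rewrite !mxE /= mpolyCM.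
  rewrite dotv; have [/Hv->|ajp] := eqVneq ((alpha j *m p) 0 0) 0.
    by rewrite subrr mulr0; apply: divides0.
  by apply: dividesMr; rewrite /off_point (bigD1 j) //=; apply/dividesMr/divides_refl.
have /fin_all_exists[th Hth] : forall a, exists th : 'rV[S]_3, forall i,
    divides (lf (alpha i)) (powers K N a * (lam i)%:MP - dot (const_vec (alpha i)) th).
  by move=> a; apply: HN.
have lk a : logarithmic alpha (koszul (powers K N) th a).
  move=> i; have key b c : divides (lf (alpha i))
      (dot (const_vec (alpha i)) (powers K N c *: th b - powers K N b *: th c)).
    rewrite dotBr !dotZr.
    rewrite (divided_difference _ _ _ _ (lam i)%:MP).
    by apply: dividesB; apply: dividesMl; apply: Hth.
  by elim/ord3_ind: a; apply: key.
have /fin_all_exists[chi Hchi] := fun a => pairing_quotient (lk a).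
have Q0 := defining_poly_neq0 arr.
have /koszul2_exact[psi Hpsi] : \sum_a powers K N a *: chi a = 0.
  apply: (scalemx_torsion_free Q0); rewrite scaler_sumr.
  under eq_bigr => a _ do rewrite scalerA mulrC -scalerA Hchi -triple_colZ.
  rewrite -triple_col_sum koszul_closed.
  exact: triple_col0.
have [|phi Hphi] := @koszul1_exact K N _ _ (fun a => B *m psi a).
  apply: koszul_eq0 => a; rewrite koszul_mulmxl -Hpsi.
  exact: syzygy_quotient (Hchi a).
exists phi, N, psi, th; split=> [a|a i|a]; [by rewrite Hphi | exact: Hth |].
by rewrite -Hpsi.
Qed.

(** If lam comes from v, then th_a - X_a^N v is logarithmic, and its pairing over Q is a column
    chi_a killed by B. The difference psi - chi is a Koszul cocycle X_a^N psi0, whence phi = B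
    psi0. *)
Lemma corresponds_trivial phi lam (v : 'rV[S]_3) : corresponds phi lam ->
  (forall i, divides (lf (alpha i)) (lam i - dot (const_vec (alpha i)) v)) ->
  exists psi, phi = B *m psi.
Proof.
move=> [N [psi [th [Hphi Hlam Hk]]]] Hv; have Q0 := defining_poly_neq0 arr.
pose th' a := th a - powers K N a *: v.
have lth' a : logarithmic alpha (th' a).
  move=> i; rewrite dotBr dotZr.
  rewrite (divided_difference1 _ _ _ (lam i)).
  by apply: dividesB => //; apply: dividesMl.
have /fin_all_exists[chi Hchi] := fun a => pairing_quotient (lth' a).
have [|psi0 Hpsi0] := @koszul1_exact K N _ _ (fun a => psi a - chi a).
  apply: koszul_eq0 => a; apply: (scalemx_torsion_free Q0).
  exact: koszul_triple_left Hk Hchi a.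
exists psi0; apply: (scalemx_inj (powers_neq0 N o0)).
rewrite Hphi -(subrK (chi o0) (psi o0)) Hpsi0 mulmxDr (syzygy_quotient (Hchi o0)) addr0.
by rewrite scalemxAr.
Qed.

Lemma corresponds0 lam : corresponds 0 lam ->
  exists v : 'rV[S]_3, forall i, divides (lf (alpha i)) (lam i - dot (const_vec (alpha i)) v).
Proof.
move=> [N [psi [th [Hphi Hlam Hk]]]].
have /fin_all_exists2[om Dom Hom] : forall a, exists2 w, D0 alpha w & Q *: psi a = pairing w.
  by move=> a; apply: (functional_pairing arr n_neq0 genA exB); rewrite -Hphi scaler0.
have /fin_all_exists[h Hh] : forall a, exists h, koszul (powers K N) (fun b => th b - om b) a = h *: E.
  move=> a; apply: (pairing_eq0 arr n_neq0 genA).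
  exact: koszul_triple_right Hk Hom a.
(* The pairing determines th - om only up to multiples of E. These multiples form a Koszul cycle, so
   subtracting t E makes th - om a cocycle X_a^N v. *)
have /koszul2_exact[t Ht] : \sum_a powers K N a *: (h a)%:M = 0 :> 'M_1.
  have := koszul_closed (powers K N) (fun b => th b - om b).
  under eq_bigr => a _ do rewrite Hh scalerA.
  rewrite -scaler_suml => /rowP/(_ o0); rewrite !mxE => /eqP.
  rewrite mulf_eq0 => /orP[/eqP E0|]; last first.
    by rewrite -['X__]expr1 (negbTE (Xn_neq0 _ _ _)).
  apply/matrixP => i j; rewrite !ord1 summxE [RHS]mxE -[RHS]E0.
  by apply: eq_bigr => a _; rewrite !mxE mulr1n.
have [|v Hv] := @koszul1_exact K N _ _ (fun a => (th a - om a) - t a *m E).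
  apply: koszul_eq0 => a; rewrite koszulB Hh koszul_mulmxr -Ht mul_scalar_mx subrr //.
exists v => i.
have key a : divides (lf (alpha i)) (powers K N a * (lam i - dot (const_vec (alpha i)) v)).
  have -> : powers K N a * (lam i - dot (const_vec (alpha i)) v) =
     (powers K N a * lam i - dot (const_vec (alpha i)) (th a))
     + dot (const_vec (alpha i)) (om a) + t a 0 0 * lf (alpha i).
    have -> : t a 0 0 * lf (alpha i) = dot (const_vec (alpha i)) (t a *m E).
      rewrite linear_form_polyE -dotZr; congr dot; apply/rowP => l.
      by rewrite [LHS]mxE [RHS]mxE big_ord1.
    by apply: scaled_difference; rewrite -dotZr -Hv !dotBr.
  apply: dividesD; last exact/dividesMl/divides_refl.
  by apply: dividesD => //; have := D0_logarithmic arr (Dom a) i.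
have [//|nl] := classic (divides (lf (alpha i)) (lam i - dot (const_vec (alpha i)) v)).
have a0 := alpha_neq0 arr i.
by case: (@not_divides_two_variables _ (alpha i)); apply: (@linear_form_prime_exp _ _ _ N a0);
  [case: (linear_form_prime a0 (key o0)) | case: (linear_form_prime a0 (key o1))].
Qed.

End Correspondence.

(** * The correspondence degree by degree *)

Lemma dot_cross_cyclic (R : comPzRingType) (a u w : 'rV[R]_3) :
  dot a (cross u w) = dot w (cross a u).
Proof. by rewrite !dotE !mxE /=; ring. Qed.

Lemma scaleB_entry (R : pzRingType) p q (x y : R) (M M' : 'M[R]_(p, q)) i j :
  (x *: M - y *: M') i j = x * M i j - y * M' i j.
Proof. by rewrite !mxE. Qed.

Lemma triple_colE (R : comPzRingType) m (e : 'rV[R]_3) (A : 'M[R]_(m, 3)) w i j :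
  triple_col e A w i j = dot w (cross e (row i A)).
Proof. by rewrite mxE dot_cross_cyclic. Qed.

Section GradedTools.
Variable K : fieldType.
Local Notation S := {mpoly K[3]}.
Local Notation E := (euler K).

Lemma homog_powers N a : homog_of_degree N%:Z (powers K N a).
Proof. by have := homogXn N (homogXU K a); rewrite mul1r. Qed.

Lemma homog_mderiv e (p : S) i : homog_of_degree e p -> homog_of_degree (e - 1) p^`M(i).
Proof.
move=> /homog_of_degreeP H; apply/homog_of_degreeP => mon; rewrite mcoeff_deriv => c0.
have /H : p@_(mon + U_(i)) != 0 by apply: contraNneq c0 => ->; rewrite mul0rn.
by rewrite mdegD mdeg1 PoszD => <-; rewrite addrK.
Qed.

Definition hcomp_mx p q (c : 'I_p -> 'I_q -> int) (M : 'M[S]_(p, q)) : 'M[S]_(p, q) :=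
  \matrix_(i, j) hcomp (c i j) (M i j).

Lemma hcomp_mxE p q (c : 'I_p -> 'I_q -> int) (M : 'M[S]_(p, q)) i j :
  hcomp_mx c M i j = hcomp (c i j) (M i j).
Proof. exact: mxE. Qed.

Lemma koszul_hcomp p q (c : 'I_p -> 'I_q -> int) N (t : 'I_3 -> 'M[S]_(p, q)) a :
  koszul (powers K N) (fun b => hcomp_mx c (t b)) a =
  hcomp_mx (fun i j => c i j + N%:Z) (koszul (powers K N) t a).
Proof.
have key b b' : powers K N b *: hcomp_mx c (t b') - powers K N b' *: hcomp_mx c (t b) =
    hcomp_mx (fun i j => c i j + N%:Z) (powers K N b *: t b' - powers K N b' *: t b).
  apply/matrixP => i j; rewrite scaleB_entry !hcomp_mxE scaleB_entry raddfB /=.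
  by rewrite ![powers K N _ * _]mulrC !(hcompM _ _ (homog_powers N _)).
by elim/ord3_ind: a; apply: key.
Qed.

Lemma hcomp_dot c g (w u : 'rV[S]_3) : (forall l, homog_of_degree g (u 0 l)) ->
  hcomp (c + g) (dot w u) = dot (hcomp_mx (fun _ _ => c) w) u.
Proof.
move=> hu; rewrite raddf_sum; apply: eq_bigr => l _ /=.
by rewrite hcompM // hcomp_mxE.
Qed.

Lemma homog_cross g h (u w : 'rV[S]_3) : (forall l, homog_of_degree g (u 0 l)) ->
  (forall l, homog_of_degree h (w 0 l)) -> forall l, homog_of_degree (g + h) (cross u w 0 l).
Proof.
by move=> hu hw; apply: ord3_ind; rewrite mxE /=; apply: homogB; apply: homogM.
Qed.

Lemma triple_col_hcomp m (A : 'M[S]_(m, 3)) (d : 'I_m -> int) c w :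
  (forall i l, homog_of_degree (d i) (A i l)) ->
  triple_col E A (hcomp_mx (fun _ _ => c) w) =
  hcomp_mx (fun i _ => c + (1 + d i)) (triple_col E A w).
Proof.
move=> hA; apply/matrixP => i j; rewrite hcomp_mxE [LHS]triple_colE [in RHS]triple_colE.
rewrite -(@hcomp_dot c (1 + d i)) // => l; apply: homog_cross => l'; last by rewrite mxE.
by rewrite eulerE; apply: homogXU.
Qed.

Lemma mcoeff0_const_vec_dot (a : 'rV[K]_3) (v : 'rV[S]_3) :
  (dot (const_vec a) v)@_0%MM = (a *m \col_l (v 0 l)@_0%MM) 0 0.
Proof.
rewrite raddf_sum mxE; apply: eq_bigr => l _ /=.
by rewrite !mxE mcoeffCM.
Qed.

Lemma mcoeff0_divides_linear_form (a : 'rV[K]_3) (f : S) :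
  divides (linear_form_poly a) f -> f@_0%MM = 0.
Proof.
move=> [h ->]; rewrite rmorphM /=; have -> : (linear_form_poly a)@_0%MM = 0; last by rewrite mulr0.
rewrite raddf_sum big1 // => l _ /=.
by rewrite mcoeffZ mcoeffX mnm1_eq0 mulr0.
Qed.

End GradedTools.

Section GradedCorrespondence.
Variables (K : fieldType) (n : nat) (alpha : 'I_n -> 'rV[K]_3).
Hypotheses (arr : line_arrangement alpha) (n_neq0 : n%:R != 0 :> K).
Local Notation S := {mpoly K[3]}.
Local Notation lf := linear_form_poly.
Local Notation E := (euler K).
Local Notation Q := (defining_poly alpha).

Lemma D0_hcomp c w : D0 alpha w -> D0 alpha (hcomp_mx (fun _ _ => c) w).
Proof.
move=> /D0P H; apply/D0P.
have := congr1 (hcomp (c + (n%:Z - 1))) H; rewrite raddf0 => <-.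
rewrite raddf_sum; apply: eq_bigr => l _ /=.
by rewrite hcompM ?hcomp_mxE //; apply/homog_mderiv/homog_defining_poly.
Qed.

Variables (m k : nat) (A : 'M[S]_(m, 3)) (B : 'M[S]_(k, m)).
Variables (d : 'I_m -> int) (e : 'I_k -> int).
Hypothesis genA : forall x, D0 alpha x <-> exists u, x = u *m A.
Hypothesis exB : forall u : 'rV_m, u *m A = 0 <-> exists w, u = w *m B.
Hypothesis injB : forall u : 'rV_k, u *m B = 0 -> u = 0.
Hypothesis hA : forall i l, homog_of_degree (d i) (A i l).
Hypothesis hB : forall j i, homog_of_degree (e j - d i) (B j i).
Hypothesis minB : forall j i, (B j i)@_0%MM = 0.
Local Notation pairing := (triple_col E A).

Definition trivial_values (lam : 'I_n -> K) := exists v : 'cV[K]_3, forall i, lam i = (alpha i *m v) 0 0.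

(** With N added for each power, the degrees are e_j + t for phi, d_i + t for psi, and t + n - 1 for
    lam and th. The difference n - 1 arises from the coboundary condition, where Q has degree n and
    the E in the pairing has degree 1. *)
Lemma corresponds_hcomp t phi lam : corresponds alpha A B phi lam ->
  corresponds alpha A B (hcomp_mx (fun j _ => e j + t) phi)
    (fun i => hcomp (t + (n%:Z - 1)) (lam i)).
Proof.
move=> [N [psi [th [Hphi Hlam Hk]]]].
exists N, (fun a => hcomp_mx (fun i _ => d i + N%:Z + t) (psi a)),
  (fun a => hcomp_mx (fun _ _ => t + (n%:Z - 1) + N%:Z) (th a)); split.
- move=> a; apply/matrixP => j l.
  have /matrixP/(_ j l)/(congr1 (hcomp (e j + t + N%:Z))) := Hphi a.
  rewrite [X in hcomp _ X = _ -> _]mxE mulrC (hcompM _ _ (homog_powers K N a)) => Ejl.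
  rewrite [LHS]mxE hcomp_mxE mulrC Ejl [X in hcomp _ X]mxE raddf_sum [RHS]mxE.
  apply: eq_bigr => i _ /=.
  rewrite hcomp_mxE mulrC [RHS]mulrC -(hcompM _ _ (hB j i)).
  by congr (hcomp _ _); ring.
- move=> a i; have [h Eh] := Hlam a i.
  exists (hcomp (t + (n%:Z - 1) + N%:Z - 1) h).
  rewrite -(hcompM _ _ (homog_linear_form (alpha i))) -Eh raddfB /= subrK.
  rewrite mulrC -(hcompM _ _ (homog_powers K N a)) mulrC; congr (_ - _).
  rewrite dotC [in RHS]dotC -[X in hcomp X]addr0 hcomp_dot // => l.
  by rewrite mxE -[X in homog_of_degree _ X]mulr1 mul_mpolyC; apply/homogZ/homog1.
- move=> a; rewrite !koszul_hcomp (triple_col_hcomp _ _ hA).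
  apply/matrixP => i l; have /matrixP/(_ i l) := Hk a; rewrite [LHS]mxE => Ea.
  rewrite hcomp_mxE -Ea [LHS]mxE hcomp_mxE [LHS]mulrC [in RHS]mulrC.
  rewrite -(hcompM _ _ (homog_defining_poly alpha)).
  by congr (hcomp _ _); ring.
Qed.

Lemma trivial_of_corresponds0 (lam : 'I_n -> K) :
  corresponds alpha A B 0 (fun i => (lam i)%:MP) -> trivial_values lam.
Proof.
case/(corresponds0 arr n_neq0 genA exB) => v Hv.
exists (\col_l (v 0 l)@_0%MM) => i; have := mcoeff0_divides_linear_form (Hv i).
rewrite mcoeffB mcoeffC eqxx mulr1 mcoeff0_const_vec_dot.
by move/eqP; rewrite subr_eq0 => /eqP.
Qed.

(** Shifting by t = -(n - 1) keeps the constants lam and leaves phi_j in degree e_j - (n - 1). If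
    all these are negative, phi is 0 and lam is trivial. *)
Lemma shift_lower_bound lam : locally_linear alpha lam -> ~ trivial_values lam ->
  exists j, n%:Z - 1 <= e j.
Proof.
move=> LL nt; apply: NNPP => H; apply: nt.
have [phi /(corresponds_hcomp (- (n%:Z - 1)))] := corresponds_of_locally_linear arr n_neq0 genA exB LL.
have -> : hcomp_mx (fun j _ => e j - (n%:Z - 1)) phi = 0.
  apply/matrixP => j l; rewrite hcomp_mxE mxE.
  apply: homog_neg (homog_hcomp _ _) _; rewrite subr_lt0 ltNge.
  by apply/negP => ej; apply: H; exists j.
rewrite addNr => -[N [psi [th [H1 H2 H3]]]]; apply: trivial_of_corresponds0.
exists N, psi, th; split; [exact: H1 | move=> a i | exact: H3].
have := H2 a i; rewrite (@hcomp_homog _ _ 0 0) ?eqxx //.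
by rewrite -[X in homog_of_degree _ X]mulr1 mul_mpolyC; apply/homogZ/homog1.
Qed.

Lemma unit_col_not_in_image j psi : delta_mx j 0 <> B *m psi :> 'cV_k.
Proof.
move/(congr1 (fun M : 'cV_k => (M j 0)@_0%MM)); rewrite [in LHS]mxE !eqxx mcoeff1 eqxx.
rewrite [in RHS]mxE raddf_sum big1 => [/eqP|i _ /=]; first by rewrite oner_eq0.
by rewrite rmorphM /= minB mul0r.
Qed.

Lemma const_of_degree0 (f : S) : hcomp 0 f = ((hcomp 0 f)@_0%MM)%:MP.
Proof. exact: homog_const (homog_hcomp 0 f). Qed.

(** Near p some coordinate p_a is nonzero, so X_a^N can be inverted: v = th_a(p) / p_a^N. *)
Lemma corresponds_locally_linear phi (lam : 'I_n -> K) :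
  corresponds alpha A B phi (fun i => (lam i)%:MP) -> locally_linear alpha lam.
Proof.
move=> [N [psi [th [_ Hlam _]]]] p p0.
have [a pa] : exists a, p a 0 != 0.
  apply: NNPP => H; case/eqP: p0; apply/colP => a; rewrite mxE.
  by apply/eqP/negPn/negP => pa; apply: H; exists a.
pose ev (f : S) := f.@[fun l => p l 0].
exists (\col_l (ev (th a 0 l) / p a 0 ^+ N)) => i ip.
have [h /(congr1 ev)] := Hlam a i.
rewrite /ev mevalB !mevalM meval_linear_form ip mulr0 rmorphXn /= mevalXU mevalC => /eqP.
rewrite subr_eq0 => /eqP E0; apply: (mulfI (expf_neq0 N pa)); rewrite E0.
rewrite raddf_sum mxE mulr_sumr; apply: eq_bigr => l _ /=.
rewrite mevalM !mxE mevalC; field.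
exact: expf_neq0.
Qed.

(** By minimality the j-th basis vector is nonzero in Ext^1. Its partner lives in degree n - 1 -
    e_j: if this is negative, the partner vanishes, a contradiction; if it is 0, the partner
    consists of constants and is nontrivial. *)
Lemma shift_upper_bound j : n%:Z - 1 <= e j ->
  e j = n%:Z - 1 /\ exists2 lam, locally_linear alpha lam & ~ trivial_values lam.
Proof.
move=> ej.
have [lam] := corresponds_of_functional arr n_neq0 genA exB injB (delta_mx j 0).
move/(corresponds_hcomp (- e j)).
have -> : hcomp_mx (fun j' _ => e j' - e j) (delta_mx j 0 : 'cV[S]_k) = delta_mx j 0.
  apply/matrixP => j' l; rewrite hcomp_mxE !mxE; have [->|_] := eqVneq j' j.
    by rewrite subrr ord1 eqxx (hcomp_homog _ (homog1 K 3)) eqxx.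
  by rewrite raddf0.
move=> Hc.
have ntriv (v : 'rV[S]_3) : ~ forall i, divides (lf (alpha i))
    (hcomp (- e j + (n%:Z - 1)) (lam i) - dot (const_vec (alpha i)) v).
  move=> Hv; have [psi] := corresponds_trivial arr genA exB Hc Hv.
  exact: unit_col_not_in_image.
have Ej : e j = n%:Z - 1.
  apply/eqP; rewrite eq_le ej andbT leNgt; apply/negP => lt; apply: (ntriv 0) => i.
  rewrite (homog_neg (homog_hcomp _ _)) ?dot0r ?subrr; first exact: divides0.
  by rewrite addrC subr_lt0.
split=> //; move: Hc ntriv; rewrite Ej addNr => Hc ntriv.
exists (fun i => (hcomp 0 (lam i))@_0%MM).
  apply: (corresponds_locally_linear (phi := delta_mx j 0)).
  case: Hc => N [psi [th [H1 H2 H3]]]; exists N, psi, th; split; [exact: H1 | move=> a i | exact: H3].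
  by rewrite -const_of_degree0.
case=> v Hv; apply: (ntriv (const_vec v^T)) => i.
rewrite const_of_degree0 Hv.
have -> : dot (const_vec (alpha i)) (const_vec v^T) = ((alpha i *m v) 0 0)%:MP.
  rewrite mxE raddf_sum; apply: eq_bigr => l _.
  by rewrite !mxE /= mpolyCM.
by rewrite subrr; apply: divides0.
Qed.

(** The i-th coordinate kills all syzygies, so Q times it is the pairing with some w; comparing
    degrees, deg w + 1 + d_i = n. *)
Lemma isolated_generator i : (forall j, B j i = 0) ->
  exists w, [/\ D0 alpha w, w != 0 & forall l, homog_of_degree (n%:Z - 1 - d i) (w 0 l)].
Proof.
move=> Bi; have [|w Dw Hw] := functional_pairing arr n_neq0 genA exB (chi := delta_mx i 0).
  by apply/colP => j; rewrite -colE !mxE Bi.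
pose c := n%:Z - 1 - d i.
exists (hcomp_mx (fun _ _ => c) w); split; first exact: D0_hcomp.
  apply/eqP => w0; have /matrixP/(_ i 0) := triple_col_hcomp c w hA.
  rewrite w0 triple_col0 hcomp_mxE -Hw [LHS]mxE [in RHS]mxE [X in _ * X]mxE !eqxx mulr1.
  rewrite (hcomp_homog _ (homog_defining_poly alpha)).
  have -> : (c + (1 + d i) == n%:Z) by apply/eqP; rewrite /c; ring.
  by move=> /esym/eqP; rewrite (negbTE (defining_poly_neq0 arr)).
by move=> l; rewrite hcomp_mxE; apply: homog_hcomp.
Qed.

End GradedCorrespondence.

(** * Relations, formality and weak perspectives *)

Section FreeFamilies.
Variables (K : fieldType) (n : nat) (f : 'I_n -> 'rV[K]_3).

(** Coefficients are indexed by all lines, which spares later arguments the enumeration of [D]. *)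
Lemma not_freeP (D : {set 'I_n}) : ~~ free [seq f i | i in D] <->
  exists c : 'rV[K]_n, [/\ c != 0, forall i, i \notin D -> c 0 i = 0 & \sum_i c 0 i *: f i = 0].
Proof.
set X := in_tuple [seq f i | i in D].
have sX : size [seq f i | i in D] = #|D| by rewrite size_map -cardE.
have split_sum (c : 'I_n -> K) : (forall i, i \notin D -> c i = 0) ->
    \sum_i c i *: f i = \sum_(i <- enum D) c i *: f i.
  move=> c0; rewrite big_enum /= [RHS]big_mkcond; apply: eq_bigr => i _.
  by case: ifPn => // /c0->; rewrite scale0r.
have [D0|[i0 Di0]] := set_0Vmem D.
  have -> : [seq f i | i in D] = [::] by apply/nilP; rewrite /nilp sX D0 cards0.
  rewrite nil_free; split=> // -[c [c0 cD _]]; case/eqP: c0.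
  by apply/rowP => i; rewrite mxE cD // D0 inE.
split.
  move=> nf; apply: NNPP => H; case/negP: nf; have : free X; last by [].
  apply/freeP => k Hk j.
  apply/eqP/negPn/negP => kj; apply: H.
  pose kk (l : nat) := oapp k 0 (insub l).
  have kkE (l : 'I_(size [seq f i | i in D])) : kk l = k l by rewrite /kk valK.
  pose c i := if i \in D then kk (index i (enum D)) else 0.
  exists (\row_i c i); split.
  - apply/eqP => /rowP/(_ (nth i0 (enum D) j)); rewrite !mxE /c -mem_enum mem_nth; last first.
      by rewrite -cardE -sX.
    rewrite index_uniq ?enum_uniq -?cardE -?sX // kkE; exact/eqP.
  - by move=> i nDi; rewrite mxE /c (negbTE nDi).
  - under eq_bigr => i _ do rewrite mxE.
    rewrite split_sum; last by move=> i nDi; rewrite /c (negbTE nDi).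
    rewrite (big_nth i0) big_mkord -cardE -sX -[RHS]Hk; apply: eq_bigr => l _.
    have lD : (l < size (enum D))%N by rewrite -cardE -sX.
    rewrite /c -mem_enum mem_nth // index_uniq ?enum_uniq // kkE; congr (_ *: _).
    by rewrite (nth_map i0).
case=> c [c0 cD cf]; apply/negP => fX; have {fX}/freeP H : free X by [].
case/eqP: c0; apply/rowP => i; rewrite mxE.
have [iD|/cD//] := boolP (i \in D).
have lt : (index i (enum D) < size [seq f i | i in D])%N by rewrite size_map index_mem mem_enum.
have := H (fun l => c 0 (nth i0 (enum D) l)) _ (Ordinal lt) => /=.
rewrite nth_index ?mem_enum //; apply.
rewrite -[RHS]cf split_sum // [RHS](big_nth i0) big_mkord -[in RHS]cardE -[in RHS]sX.
apply: eq_bigr => l _; rewrite (nth_map i0) // -cardE -sX //.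
Qed.

End FreeFamilies.

Section Relations.
Variables (K : fieldType) (n : nat) (alpha : 'I_n -> 'rV[K]_3).
Hypothesis arr : line_arrangement alpha.
Implicit Types (c : 'rV[K]_n) (lam : 'I_n -> K).

(** The common form of all three notions: the dual description of formality, of weak perspectives
    and of local linearity. *)
Definition kills3 lam := forall c, linear_relation alpha c -> three_term c ->
  \sum_i c 0 i * lam i = 0.

Definition support_set c : {set 'I_n} := [set i | c 0 i != 0].

Lemma relation_support2 c i j : linear_relation alpha c ->
  (forall l, l != i -> l != j -> c 0 l = 0) -> c = 0.
Proof.
move=> /eqP rc cl.
suff H i' j' : (forall l, l != i' -> l != j' -> c 0 l = 0) -> c 0 i' = 0.
  apply/rowP => l; rewrite mxE; have [->|li] := eqVneq l i; first exact: H cl.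
  have [->|lj] := eqVneq l j; last exact: cl.
  by apply: (H j i) => l' l'j l'i; apply: cl.
move=> {}cl; apply/eqP/negPn/negP => ci; move: rc.
have [ij|ij] := eqVneq i' j'.
  rewrite (bigD1 i') //= big1 ?addr0 => [|l li]; last first.
    by rewrite cl -?ij ?scale0r.
  by move/eqP; rewrite scaler_eq0 (negbTE ci) (negbTE (alpha_neq0 arr i')).
rewrite (bigD1 i') //= (bigD1 j') 1?eq_sym //= big1 ?addr0 => [|l /andP[li lj]]; last first.
  by rewrite cl ?scale0r.
move/eqP; rewrite addr_eq0 => /eqP E.
apply: (@alpha_not_proportional _ _ _ arr j' i' (- c 0 j' / c 0 i')); first by rewrite eq_sym.
by rewrite mulrC -scalerA scaleNr -E scalerA mulVf // scale1r.
Qed.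

Lemma relation_support_gt2 c : linear_relation alpha c -> c != 0 ->
  (2 < #|support_set c|)%N.
Proof.
move=> rc c0; rewrite ltnNge; apply/negP => le2; case/eqP: c0.
have [D0|[i Di]] := set_0Vmem (support_set c).
  apply/rowP => i; rewrite mxE; apply/eqP/negPn/negP => ci.
  have : i \in support_set c by rewrite inE.
  by rewrite D0 inE.
move: le2; rewrite (cardsD1 i) Di ltnS => le1.
have [D0|[j Dj]] := set_0Vmem (support_set c :\ i).
  apply: (@relation_support2 c i i) => // l li _; apply/eqP/negPn/negP => cl.
  have : l \in support_set c :\ i by rewrite !inE li.
  by rewrite D0 inE.
apply: (@relation_support2 c i j) => // l li lj; apply/eqP/negPn/negP => cl.
case/negP: lj; apply/eqP; move: le1 => /card_le1_eqP; apply=> //.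
by rewrite !inE li.
Qed.

Lemma kills3_le3 lam c : kills3 lam -> linear_relation alpha c ->
  (#|support_set c| <= 3)%N -> \sum_i c 0 i * lam i = 0.
Proof.
move=> k3 rc le3; have [->|c0] := eqVneq c 0.
  by apply: big1 => i _; rewrite mxE mul0r.
by apply: k3 => //; rewrite /three_term -/(support_set c) eqn_leq le3 relation_support_gt2.
Qed.

(** Two forms have a common zero, and the relation forces the third to vanish there: a three-term
    relation lives at one intersection point. *)
Lemma three_term_common_zero c : linear_relation alpha c -> three_term c ->
  exists i j l (p : 'cV[K]_3), [/\ i != j, c 0 i != 0, c 0 j != 0 & c 0 l != 0] /\
   [/\ forall t, t != i -> t != j -> t != l -> c 0 t = 0,
     l != i, l != j, p != 0 & forall t, c 0 t != 0 -> (alpha t *m p) 0 0 = 0].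
Proof.
move=> /eqP rc tc; have /card_gt0P[i Di] : (0 < #|support_set c|)%N by rewrite (eqP tc).
have := tc; rewrite /three_term -/(support_set c) (cardsD1 i) Di (eqn_add2l 1 _ 2).
case/cards2P => j [l [jl Djl]].
have inD t : t \in support_set c :\ i = (t == j) || (t == l) by rewrite Djl !inE.
have := inD j; rewrite eqxx !inE => /andP[ji cj].
have := inD l; rewrite eqxx orbT !inE => /andP[li cl].
rewrite inE in Di.
have c0 t : t != i -> t != j -> t != l -> c 0 t = 0.
  move=> ti tj tl; apply/eqP/negPn/negP => ct; have := inD t.
  by rewrite !inE ti ct (negbTE tj) (negbTE tl).
have [|p p0 Ep] := @kernel_vector K _ (col_mx (alpha i) (alpha j)).
  exact: leq_ltn_trans (rank_leq_row _) _.
move: Ep; rewrite mul_col_mx -[0]vsubmxK => /eq_col_mx[]; rewrite !linear0 => Epi Epj.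
have Epl : alpha l *m p = 0.
  move: rc; rewrite (bigD1 i) //= (bigD1 j) //= (bigD1 l) ?li /=; last by rewrite eq_sym jl.
  rewrite big1 ?addr0 => [|t /andP[/andP[ti tj] tl]]; last by rewrite c0 ?scale0r.
  move/(congr1 (fun a => a *m p)); rewrite !mulmxDl -!scalemxAl Epi Epj !scaler0 !add0r mul0mx.
  by move/eqP; rewrite scaler_eq0 (negbTE cl) => /eqP.
exists i, j, l, p; split; split=> //; rewrite 1?eq_sym //.
move=> t ct; have [->|ti] := eqVneq t i; first by rewrite Epi mxE.
have [->|tj] := eqVneq t j; first by rewrite Epj mxE.
have [->|tl] := eqVneq t l; first by rewrite Epl mxE.
by rewrite c0 ?eqxx in ct.
Qed.

Lemma locally_linear_kills3 lam : locally_linear alpha lam -> kills3 lam.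
Proof.
move=> LL c rc tc; have [i [j [l [p [_ [_ _ _ p0 Hp]]]]]] := three_term_common_zero rc tc.
have [v Hv] := LL p p0.
have E0 : (\sum_t c 0 t *: alpha t) *m v = 0 by rewrite (eqP rc) mul0mx.
have /matrixP/(_ 0 0) := E0; rewrite mulmx_suml summxE [X in _ = X -> _]mxE.
apply: etrans; apply: eq_bigr => t _.
rewrite -scalemxAl mxE; have [->|ct] := eqVneq (c 0 t) 0; first by rewrite !mul0r.
by rewrite Hv // Hp.
Qed.

(** Two lines through p already span the forms vanishing at p. Interpolating lam on these two
    determines v, and any further line through p is tied to them by a relation on at most three
    forms. *)
Lemma kills3_locally_linear lam : kills3 lam -> locally_linear alpha lam.
Proof.
move=> k3 p p0.
have [[i ip]|nP] := classic (exists i, (alpha i *m p) 0 0 = 0); last first.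
  by exists 0 => i ip; case: nP; exists i.
have aip : alpha i *m p = 0 by apply/matrixP => ? ?; rewrite !ord1 ip mxE.
have [[j [ji jp]]|nj] := classic (exists j, j != i /\ (alpha j *m p) 0 0 = 0); last first.
  have [l al] := row_neq0P (alpha_neq0 arr i).
  exists (lam i / alpha i 0 l *: delta_mx l 0) => t tp.
  have -> : t = i by apply/eqP/negPn/negP => ti; apply: nj; exists t.
  by rewrite -scalemxAr mxE -colE mxE divfK.
have ajp : alpha j *m p = 0 by apply/matrixP => ? ?; rewrite !ord1 jp mxE.
pose M := col_mx (alpha i) (alpha j).
have freeM : row_free M.
  rewrite -kermx_eq0; apply/rowV0P => x /sub_kermxP.
  have [a Ea] : exists a, lsubmx x = a%:M by exists (lsubmx x 0 0); apply: mx11_scalar.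
  have [b Eb] : exists b, rsubmx x = b%:M by exists (rsubmx x 0 0); apply: mx11_scalar.
  rewrite -[x]hsubmxK mul_row_col Ea Eb !mul_scalar_mx => E.
  pose c : 'rV[K]_n := a *: delta_mx 0 i + b *: delta_mx 0 j.
  have ci : c 0 i = a.
    by rewrite !mxE !eqxx /= eq_sym (negbTE ji) mulr0 mulr1 addr0.
  have cj : c 0 j = b by rewrite !mxE !eqxx /= (negbTE ji) mulr0 mulr1 add0r.
  have ct t : t != i -> t != j -> c 0 t = 0.
    by move=> ti tj; rewrite !mxE (negbTE ti) (negbTE tj) !mulr0 addr0.
  have rc : linear_relation alpha c.
    apply/eqP; rewrite -[RHS]E (bigD1 i) //= (bigD1 j) //= big1 ?addr0 ?ci ?cj //.
    by move=> t /andP[ti tj]; rewrite ct ?scale0r.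
  have c0 := relation_support2 rc ct.
  by rewrite -ci -cj c0 !mxE raddf0 row_mx0.
have Mp : M *m p = 0 by rewrite mul_col_mx aip ajp col_mx0.
have kerM : (kermx p <= M)%MS.
  have sM : (M <= kermx p)%MS by apply/sub_kermxP.
  rewrite -(geq_leqif (mxrank_leqif_sup sM)) mxrank_ker (eqP freeM).
  suff : (0 < \rank p)%N by lia.
  by rewrite lt0n mxrank_eq0.
(* The rows of M are independent, so this v takes the values lam_i and lam_j on alpha_i and
   alpha_j. *)
exists (pinvmx M *m col_mx (lam i)%:M (lam j)%:M) => t tp.
have /submxP[w Ew] : (alpha t <= M)%MS.
  apply: submx_trans kerM; apply/sub_kermxP/matrixP => ? ?.
  by rewrite !ord1 tp mxE.
rewrite Ew mulmxA -(mulmxA w) mulmxVp // mulmx1.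
rewrite -[w]hsubmxK mul_row_col mul_mx_scalar mul_mx_scalar.
set a := lsubmx w 0 0; set b := rsubmx w 0 0.
have Et : alpha t = a *: alpha i + b *: alpha j.
  by rewrite Ew -[w]hsubmxK mul_row_col {1}[lsubmx w]mx11_scalar {1}[rsubmx w]mx11_scalar !mul_scalar_mx.
pose c : 'rV[K]_n := delta_mx 0 t - (a *: delta_mx 0 i + b *: delta_mx 0 j).
have sumc (V : lmodType K) (F : 'I_n -> V) : \sum_l c 0 l *: F l = F t - (a *: F i + b *: F j).
  have sum1 (s : 'I_n) : \sum_l (delta_mx 0 s : 'rV[K]_n) 0 l *: F l = F s.
    rewrite (bigD1 s) //= big1 => [|l /negbTE ls]; first by rewrite mxE !eqxx scale1r addr0.
    by rewrite mxE ls andbF scale0r.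
  rewrite -(sum1 t) -(sum1 i) -(sum1 j) !scaler_sumr -big_split -sumrB /=.
  apply: eq_bigr => l _; rewrite !scalerA -scalerDl -scalerBl.
  by congr (_ *: _); rewrite !mxE.
have : \sum_l c 0 l * lam l = 0.
  apply: kills3_le3 => //; first by apply/eqP; rewrite sumc Et subrr.
  apply: leq_trans (_ : #|[set t; i; j]| <= 3)%N; last by rewrite -setUA cardsU1 cards2; case: (_ \notin _); case: (_ != _).
  apply: subset_leq_card; apply/subsetP => l; rewrite !inE !mxE.
  apply: contraNT; rewrite !negb_or => /andP[/andP[/negbTE-> /negbTE->] /negbTE->].
  by rewrite !mulr0 addr0 subr0.
move: (sumc K^o lam) => /= -> /eqP; rewrite subr_eq0 => /eqP->.
rewrite [RHS]mxE [X in _ = X + _]mxE [X in _ = _ + X]mxE -/a -/b.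
by rewrite [lam i * a]mulrC [lam j * b]mulrC.
Qed.

End Relations.

Section FormalityAndPerspectives.
Variables (K : fieldType) (n : nat) (alpha : 'I_n -> 'rV[K]_3).
Hypothesis arr : line_arrangement alpha.
Implicit Types (c : 'rV[K]_n) (lam : 'I_n -> K).

Lemma trivial_values_relation c lam : linear_relation alpha c ->
  trivial_values alpha lam -> \sum_i c 0 i * lam i = 0.
Proof.
move=> /eqP rc [v Hv].
have E0 : (\sum_t c 0 t *: alpha t) *m v = 0 by rewrite rc mul0mx.
have /matrixP/(_ 0 0) := E0; rewrite mulmx_suml summxE [X in _ = X -> _]mxE.
apply: etrans; apply: eq_bigr => t _.
by rewrite -scalemxAl mxE Hv.
Qed.

Lemma trivial_valuesP lam :
  (forall c, linear_relation alpha c -> \sum_i c 0 i * lam i = 0) -> trivial_values alpha lam.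
Proof.
move=> H; pose N := \matrix_i alpha i; pose L := \row_i lam i.
have /submxP[w Ew] : (L <= N^T)%MS.
  rewrite submxE; apply/eqP/rowP => j; rewrite [RHS]mxE.
  pose c := \row_i cokermx N^T i j.
  rewrite mxE; apply: etrans (H c _); first by apply: eq_bigr => i _; rewrite !mxE mulrC.
  have cN : c *m N = 0.
    apply: trmx_inj; rewrite trmx_mul trmx0.
    have -> : c^T = col j (cokermx N^T) by apply/colP => i; rewrite !mxE.
    by rewrite colE mulmxA mulmx_coker mul0mx.
  apply/eqP; rewrite -[RHS]cN mulmx_sum_row; apply: eq_bigr => i _.
  by rewrite rowK.
exists w^T => i; have /rowP/(_ i) := Ew; rewrite !mxE => ->.
by apply: eq_bigr => k _; rewrite !mxE mulrC.
Qed.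

(** [formal] lets the list depend on the relation; duality needs one list for all. A free list of
    three-term relations cannot grow beyond length n. *)
Lemma exists_spanning_three_term : exists2 s : seq 'rV[K]_n,
  all (fun r => linear_relation alpha r && three_term r) s &
  forall r, linear_relation alpha r -> three_term r -> r \in <<s>>%VS.
Proof.
apply: NNPP => H.
suff grow d : exists s : seq 'rV[K]_n,
    [/\ all (fun r => linear_relation alpha r && three_term r) s, free s & size s = d].
  have [s [_ /eqnP fs ss]] := grow n.+1.
  have := dimvS (subvf <<s>>); rewrite fs ss dimvf dim_matrix mul1r.
  by rewrite ltnn.
elim: d => [|d [s [As fs ss]]]; first by exists [::]; rewrite nil_free.
apply: NNPP => nogrow; apply: H; exists s => // r rr tr.
apply/negPn/negP => rs; apply: nogrow; exists (r :: s); split; last by rewrite /= ss.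
  by rewrite /= rr tr.
by rewrite free_cons rs.
Qed.

Lemma span_functional (s : seq 'rV[K]_n) (L : 'cV[K]_n) :
  (forall r, r \in s -> r *m L = 0) -> forall r, r \in <<s>>%VS -> r *m L = 0.
Proof.
move=> Hs r rs.
have /span_subvP sub : {subset s <= lker (linfun (mulmxr L))}.
  by move=> x xs; rewrite memv_ker lfunE /= Hs.
have := subvP sub r rs.
by rewrite memv_ker lfunE => /eqP.
Qed.

Lemma relation_valueE c lam : c *m (\col_i lam i) = (\sum_i c 0 i * lam i)%:M.
Proof.
rewrite [LHS]mx11_scalar mxE; congr (_%:M); apply: eq_bigr => i _.
by rewrite mxE.
Qed.

(** A relation outside the span of the three-term ones is separated from it by a linear functional,
    and trivial values kill every relation. *)
Lemma not_formalP : ~ formal alpha <-> exists2 lam, kills3 alpha lam & ~ trivial_values alpha lam.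
Proof.
split=> [nf|[lam k3 nt] F].
  have [s As Hs] := exists_spanning_three_term.
  have [c rc nc] : exists2 c, linear_relation alpha c & c \notin <<s>>%VS.
    apply: NNPP => H; apply: nf => c rc; exists s => //.
    by apply/negPn/negP => nc; apply: H; exists c.
  pose M := \matrix_(i < size s) nth 0 s i.
  have [j cj] : exists j, (c *m cokermx M) 0 j != 0.
    apply: NNPP => H; case/negP: nc.
    have /submxP[w ->] : (c <= M)%MS.
      rewrite submxE; apply/eqP/rowP => j; rewrite [RHS]mxE; apply/eqP/negPn/negP => cj.
      by apply: H; exists j.
    rewrite mulmx_sum_row; apply: memv_suml => i _; apply: memvZ; rewrite rowK.
    by apply: memv_span; apply: mem_nth.
  exists (fun i => cokermx M i j).
    move=> r rr tr; have : r *m (\col_i cokermx M i j) = 0.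
      apply: span_functional (Hs r rr tr) => x xs.
      have -> : \col_i cokermx M i j = col j (cokermx M) by apply/colP => i; rewrite !mxE.
      have -> : x = row (Ordinal (etrans (index_mem x s) xs)) M by rewrite rowK /= nth_index.
      by rewrite colE mulmxA -row_mul mulmx_coker row0 mul0mx.
    by rewrite relation_valueE => /(congr1 (fun x : 'M_1 => x 0 0)); rewrite !mxE mulr1n.
  move=> /(trivial_values_relation rc) sc0; case/eqP: cj; rewrite mxE.
  exact: sc0.
apply: nt; apply: trivial_valuesP => c rc; have [s /allP As cs] := F c rc.
have : c *m (\col_i lam i) = 0.
  apply: span_functional cs => r /As/andP[rr tr].
  by rewrite relation_valueE k3 // raddf0.
by rewrite relation_valueE => /(congr1 (fun x : 'M_1 => x 0 0)); rewrite !mxE mulr1n.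
Qed.

Variable alpha0 : 'rV[K]_3.
Hypothesis gen0 : generic_line alpha alpha0.

Lemma notin_truncation (f : 'I_n -> 'rV[K]_3) (D : {set 'I_n}) : (#|D| <= 3)%N ->
  (D \notin truncation 3 (linear_matroid f)) = ~~ free [seq f i | i in D].
Proof. by move=> le3; rewrite !inE le3 andbT. Qed.

Lemma sum_perspective c (lambda : 'rV[K]_n) :
  \sum_j c 0 j *: (alpha j + lambda 0 j *: alpha0) =
  \sum_j c 0 j *: alpha j + (\sum_j c 0 j * lambda 0 j) *: alpha0.
Proof.
rewrite scaler_suml -big_split /=; apply: eq_bigr => j _.
by rewrite scalerDr scalerA.
Qed.

(** A dependency c' of the moved triple is evaluated at the common zero p: the alpha terms vanish
    and alpha0(p) is nonzero, so c' kills lambda. Then c' is also a relation of the alpha_i on the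
    same three lines, hence proportional to c. *)
Lemma weak_perspectiveP (lambda : 'rV[K]_n) :
  weak_perspective alpha alpha0 lambda <-> kills3 alpha (fun i => lambda 0 i).
Proof.
split=> [W c rc tc|k3 D].
  have [i [j [l [p [[ij ci cj cl] [c0 li lj p0 Hp]]]]]] := three_term_common_zero rc tc.
  have le3 : (#|support_set c| <= 3)%N by rewrite (eqP tc).
  have dep : ~~ free [seq alpha i | i in support_set c].
    apply/not_freeP; exists c; split; last exact/eqP.
      by apply: contraNneq ci => ->; rewrite mxE.
    by move=> t; rewrite inE negbK => /eqP.
  have := W (support_set c); rewrite !notin_truncation // => /(_ dep).
  move/not_freeP => [c' [c'0 c'D]]; rewrite sum_perspective => E.
  have c'p t : c' 0 t != 0 -> (alpha t *m p) 0 0 = 0.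
    move=> c't; apply: Hp; apply: contraNneq c't => ct; apply/eqP/c'D.
    by rewrite inE ct eqxx.
  have Eap : (\sum_t c' 0 t *: alpha t) *m p = 0.
    rewrite mulmx_suml big1 // => t _; rewrite -scalemxAl.
    have [->|c't] := eqVneq (c' 0 t) 0; first by rewrite scale0r.
    by rewrite [_ *m p]mx11_scalar c'p // raddf0 scaler0.
  have a0p : alpha0 *m p != 0.
    have lp t : c 0 t != 0 -> line (alpha t) p.
      by move=> ct; rewrite /line p0 /= [_ *m p]mx11_scalar Hp // raddf0.
    have [_ _ /(_ i j p ij (lp i ci) (lp j cj))] := gen0.
    by rewrite /line p0.
  have E0 : \sum_t c' 0 t * lambda 0 t = 0.
    have := congr1 (fun a => a *m p) E; rewrite mulmxDl Eap add0r mul0mx -scalemxAl.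
    by move/eqP; rewrite scaler_eq0 (negbTE a0p) orbF => /eqP.
  have rc' : linear_relation alpha c' by apply/eqP; move: E; rewrite E0 scale0r addr0.
  have Ecc : c' 0 l *: c - c 0 l *: c' = 0.
    apply: (@relation_support2 _ _ _ arr _ i j).
      apply/eqP; under eq_bigr => t _ do rewrite !mxE scalerBl -!scalerA.
      by rewrite sumrB -!scaler_sumr (eqP rc) (eqP rc') !scaler0 subrr.
    move=> t ti tj; rewrite !mxE; have [->|tl] := eqVneq t l; first by rewrite mulrC subrr.
    have aux (x y u w : K) : u = 0 -> w = 0 -> x * u - y * w = 0.
      by move=> -> ->; rewrite !mulr0 subrr.
    have ct := c0 t ti tj tl; apply: aux; first exact: ct.
    by apply: c'D; rewrite inE ct eqxx.
  have c'l : c' 0 l != 0.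
    apply: contraNneq c'0 => c'l; move/eqP: Ecc.
    by rewrite c'l scale0r sub0r oppr_eq0 scaler_eq0 (negbTE cl).
  apply: (mulfI c'l); rewrite mulr0 mulr_sumr -[RHS](mulr0 (c 0 l)) -[in RHS]E0 mulr_sumr.
  apply: eq_bigr => t _; rewrite !mulrA; congr (_ * _).
  by have /rowP/(_ t) := Ecc; rewrite !mxE => /eqP; rewrite subr_eq0 => /eqP.
have [le3|gt3] := leqP #|D| 3; last first.
  by move=> _; rewrite !inE leqNgt gt3 andbF.
rewrite !notin_truncation // => /not_freeP[c [c0 cD rc]].
apply/not_freeP; exists c; split=> //.
rewrite sum_perspective rc add0r (kills3_le3 arr k3) ?scale0r //; first exact/eqP.
apply: leq_trans le3; apply: subset_leq_card; apply/subsetP => t; rewrite inE.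
by apply: contraR => /cD->.
Qed.

Lemma nontrivial_perspectiveP : has_nontrivial_weak_perspective alpha alpha0 <->
  exists2 lam, locally_linear alpha lam & ~ trivial_values alpha lam.
Proof.
split=> [[lambda /weak_perspectiveP W nt]|[lam LL nt]].
  by exists (fun i => lambda 0 i) => //; apply: kills3_locally_linear.
exists (\row_i lam i).
  apply/weak_perspectiveP => c rc tc; rewrite -[RHS](locally_linear_kills3 LL rc tc).
  by apply: eq_bigr => i _; rewrite mxE.
by case=> v Hv; apply: nt; exists v => i; rewrite -Hv mxE.
Qed.

Lemma not_formal_perspective : ~ formal alpha <-> has_nontrivial_weak_perspective alpha alpha0.
Proof.
rewrite not_formalP nontrivial_perspectiveP; split=> -[lam H nt]; exists lam => //.
  exact: kills3_locally_linear.
exact: locally_linear_kills3.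
Qed.

End FormalityAndPerspectives.

(** * Regularity *)

Section LowDegree.
Variables (K : fieldType) (n : nat) (alpha : 'I_n -> 'rV[K]_3).
Hypotheses (arr : line_arrangement alpha) (n_neq0 : n%:R != 0 :> K).
Local Notation S := {mpoly K[3]}.
Local Notation lf := linear_form_poly.
Local Notation E := (euler K).

Lemma homog1_linear_form (f : S) : homog_of_degree 1 f -> f = lf (\row_k f@_U_(k)).
Proof.
move=> hf; apply/mpolyP => m.
have [/mdeg1P[k /eqP->]|dm] := boolP (mdeg m == 1%N); first by rewrite mcoeff_linear_form mxE.
have zero g : homog_of_degree 1 g -> (g : S)@_m = 0.
  move=> /homog_of_degreeP H; apply/eqP/negPn/negP => /H [] /eqP.
  by rewrite (negbTE dm).
by rewrite !zero //; apply: homog_linear_form.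
Qed.

Definition essential := forall p : 'cV[K]_3, p != 0 -> exists i, (alpha i *m p) 0 0 != 0.

Lemma essential_full : essential -> row_full (\matrix_i alpha i).
Proof.
move=> ess; rewrite /row_full eqn_leq rank_leq_col leqNgt; apply/negP.
move=> /kernel_vector[p p0 Np]; have [i] := ess p p0; case/eqP.
by have /matrixP/(_ i 0) := Np; rewrite -{1}(rowK alpha i) -row_mul !mxE.
Qed.

(* A linear endomorphism with every alpha i as an eigenvector: distinct eigenvalues split the arrangement. *)
Lemma common_eigenvectors_scalar (T : 'M[K]_3) : irreducible_arrangement alpha -> essential ->
  (forall i, exists c, alpha i *m T = c *: alpha i) -> exists c, T = c%:M.
Proof.
move=> irr ess /fin_all_exists[c Hc].
have full := essential_full ess; set N := \matrix_i alpha i in full.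
pose f := fullrankfun full; pose M := rowsub f N.
have uM : M \in unitmx by apply: fullrowsub_unit.
have rowM k : row k M = alpha (f k) by rewrite row_rowsub rowK.
pose i0 := f 0.
have [cc|nc] := classic (forall i, c i = c i0).
  exists (c i0); apply: (can_inj (mulKmx uM)); apply/row_matrixP => k.
  by rewrite !row_mul rowM Hc cc mul_mx_scalar.
have [i1 ni1] : exists i, c i != c i0.
  by apply: NNPP => H; apply: nc => i; apply/eqP/negPn/negP => ci; apply: H; exists i.
have expand i : alpha i = (alpha i *m invmx M) *m M by rewrite mulmxKV.
have coord i k : c i != c (f k) -> (alpha i *m invmx M) 0 k = 0.
  move=> cik; set x := alpha i *m invmx M.
  have : \row_l (x 0 l * (c i - c (f l))) = 0.
    apply: (can_inj (mulmxK uM)); rewrite mul0mx.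
    have := Hc i; rewrite (expand i) -/x [x *m M]mulmx_sum_row mulmx_suml scaler_sumr => /eqP.
    rewrite -subr_eq0 -sumrB => /eqP E0; apply/eqP; rewrite -oppr_eq0 -[X in _ == X]E0.
    rewrite mulmx_sum_row -sumrN; apply/eqP/eq_bigr => l _.
    rewrite mxE rowM -scalemxAl Hc !scalerA -scalerBl -scaleNr; congr (_ *: _).
    by rewrite mulrBr opprB mulrC [x 0 l * c i]mulrC.
  move=> /rowP/(_ k); rewrite !mxE => /eqP; rewrite mulf_eq0 subr_eq0 (negbTE cik) orbF.
  by move/eqP.
have has_coord i : exists k, c (f k) == c i.
  apply: NNPP => H; case/eqP: (alpha_neq0 arr i); rewrite (expand i).
  have -> : alpha i *m invmx M = 0; last exact: mul0mx.
  apply/rowP => k; rewrite [RHS]mxE; apply: coord; apply/negP => /eqP E0.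
  by apply: H; exists k; rewrite E0.
(* In the basis M each alpha_i involves only basis forms with its own eigenvalue; i1 makes the
   complementary parts nonempty. *)
case: irr; exists (invmx M), [set k | c (f k) == c i0], [set i | c i == c i0]; split.
- by rewrite unitmx_inv.
- apply/andP; split; apply/set0Pn; first by exists 0; rewrite inE.
  by have [k /eqP Ek] := has_coord i1; exists k; rewrite !inE Ek.
- by apply/andP; split; apply/set0Pn; [exists i0 | exists i1]; rewrite !inE.
- move=> i k; rewrite !inE => /eqP ci ck; apply: coord.
  by rewrite ci eq_sym.
- move=> i k; rewrite !inE => ci /eqP ck; apply: coord.
  by rewrite ck.
Qed.

(** The coefficients form a matrix with every alpha_i as an eigenvector, hence a scalar matrix; then
    th is a multiple of E, and D0 meets S E in 0. *)
Lemma D0_degree1 th : irreducible_arrangement alpha -> essential -> D0 alpha th ->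
  (forall l, homog_of_degree 1 (th 0 l)) -> th = 0.
Proof.
move=> irr ess Dth h1; pose T := \matrix_(l, k) (th 0 l)@_U_(k).
have thT l : th 0 l = lf (row l T).
  by rewrite {1}(homog1_linear_form (h1 l)); congr lf; apply/rowP => k; rewrite !mxE.
have [i|c ET] := common_eigenvectors_scalar irr ess (T := T).
  apply: divides_linear_form; rewrite linear_form_mulmx.
  have := D0_logarithmic arr Dth i; rewrite /dot.
  by under eq_bigr => l _ do rewrite [const_vec _ _ _]mxE thT mul_mpolyC.
have Eth : th = c%:MP *: E.
  apply/rowP => l; rewrite thT ET [RHS]mxE eulerE -linear_form_delta.
  have -> : row l c%:M = c *: delta_mx 0 l :> 'rV[K]_3.
    by apply/rowP => k; rewrite !mxE eqxx /= mulr_natr eq_sym.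
  rewrite /linear_form_poly mulr_sumr; apply: eq_bigr => k _.
  by rewrite mxE mul_mpolyC scalerA.
by move: Dth; rewrite Eth => /(D0_euler arr n_neq0)->; rewrite scale0r.
Qed.

Lemma D0_degree_le1 th g : irreducible_arrangement alpha -> essential -> D0 alpha th ->
  g <= 1 -> (forall l, homog_of_degree g (th 0 l)) -> th = 0.
Proof.
move=> irr ess Dth g1 hth.
have [g0|] := ltP g 0.
  by apply/rowP => l; rewrite (homog_neg (hth l) g0) mxE.
move=> g0; have [Eg|Eg] : g = 0 \/ g = 1 by lia.
  (* A constant derivation is multiplied by X_0 to reach degree 1. *)
  apply: (@scalemx_torsion_free S _ _ 'X_o0); first by rewrite -['X__]expr1; apply: Xn_neq0.
  apply: D0_degree1 => //; first exact: D0Z.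
  move=> l; rewrite mxE -[1]addr0; apply: homogM; first exact: homogXU.
  by have := hth l; rewrite Eg.
by apply: D0_degree1 => // l; have := hth l; rewrite Eg.
Qed.

Lemma divides_defining_poly_low g f : homog_of_degree g f -> g < n%:Z ->
  divides (defining_poly alpha) f -> f = 0.
Proof.
move=> hf gn [h Eh].
have <- : hcomp g f = f by rewrite (hcomp_homog _ hf) eqxx.
rewrite Eh -(subrK n%:Z g) (hcompM _ _ (homog_defining_poly alpha)).
by rewrite (homog_neg (homog_hcomp _ _)) ?mul0r // subr_lt0.
Qed.

(* If all the lines pass through the point p, then the constant derivation p pairs trivially with every element of D0 of degree at most n - 2. *)
Lemma generators_of_pencil m (A : 'M[S]_(m, 3)) (d : 'I_m -> int) (p : 'cV[K]_3) :
  (forall x, D0 alpha x <-> exists u, x = u *m A) ->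
  (forall i l, homog_of_degree (d i) (A i l)) -> (forall i, d i <= n%:Z - 2) ->
  (forall i, (alpha i *m p) 0 0 = 0) -> p = 0.
Proof.
move=> genA hA dn ap.
have lp : logarithmic alpha (const_vec p^T).
  move=> i; have -> : dot (const_vec (alpha i)) (const_vec p^T) = 0.
    rewrite -[RHS](mpolyC0 3 K) -(ap i) mxE raddf_sum; apply: eq_bigr => l _.
    by rewrite !mxE /= mpolyCM.
  exact: divides0.
have : triple_col E A (const_vec p^T) = 0.
  apply/colP => i; rewrite [RHS]mxE; apply: (@divides_defining_poly_low (1 + d i)).
  - rewrite triple_colE -[1 + d i]add0r; apply: homog_sum => l _; apply: homogM.
      by rewrite mxE -[X in homog_of_degree _ X]mulr1 mul_mpolyC; apply/homogZ/homog1.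
    apply: homog_cross => l'; first by rewrite eulerE; apply: homogXU.
    by rewrite mxE.
  - by have := dn i; lia.
  - by rewrite mxE; apply: (divides_pairing arr) => //; apply/D0_logarithmic/(D0_row genA).
case/(pairing_eq0 arr n_neq0 genA) => h Eh; apply/colP => l.
have /rowP/(_ l)/(congr1 (mcoeff 0%MM)) := Eh.
by rewrite !mxE mcoeffC eqxx mulr1 => ->; rewrite rmorphM /= mcoeffX mnm1_eq0 mulr0.
Qed.

End LowDegree.

(** * Minimal resolutions of D0 *)

Section Resolutions.
Variables (K : fieldType) (n : nat) (alpha : 'I_n -> 'rV[K]_3).
Local Notation S := {mpoly K[3]}.

Lemma unit_row_constant_term k (i : 'I_k) :
  ~ (forall l, ((delta_mx 0 i : 'rV[S]_k) 0 l)@_0%MM = 0).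
Proof. by move/(_ i); rewrite mxE !eqxx mcoeff1 eqxx => /eqP; rewrite oner_eq0. Qed.

Lemma mulmx_constant_term k m (w : 'rV[S]_k) (B : 'M[S]_(k, m)) :
  (forall j i, (B j i)@_0%MM = 0) -> forall l, ((w *m B) 0 l)@_0%MM = 0.
Proof.
move=> minB l; rewrite mxE raddf_sum big1 // => j _ /=.
by rewrite rmorphM /= minB mulr0.
Qed.

Lemma D0_submodule : is_submodule (fun x => D0 alpha x).
Proof. by split; [exact: D0_0 | exact: D0D | move=> c x; apply: D0Z]. Qed.

Lemma betti_neq0 m (F : graded_free_complex K 3 m) i j :
  betti F i j != 0%N <-> exists k : 'I_(size (gfc_shift F i)), nth 0 (gfc_shift F i) k = j.
Proof.
rewrite /betti -lt0n -has_count has_pred1; split=> [/(nthP 0)[k lt <-]|[k <-]].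
  by exists (Ordinal lt).
exact: mem_nth.
Qed.

(** Stated for every minimal resolution, since [has_regularity] supplies an unspecified one. *)
Lemma resolution_length_le1 (F : graded_free_complex K 3 3) :
  minimal_graded_free_resolution F (D0 alpha) ->
  (forall u : 'rV_(size (gfc_shift F 1)), u *m gfc_diff F 0 = 0 -> u = 0) /\
  (forall i, size (gfc_shift F i.+2) = 0%N).
Proof.
move=> [_ [genA ex0 exS] minF].
have ker_const i (u : 'rV_(size (gfc_shift F i.+1))) : u *m gfc_diff F i = 0 ->
    forall l, (u 0 l)@_0%MM = 0.
  by move/exS => [w ->]; apply: mulmx_constant_term; apply: minF.
have inj0 (u : 'rV_(size (gfc_shift F 1))) : u *m gfc_diff F 0 = 0 -> u = 0.
  apply: (second_syzygy_free _ genA ex0 (ker_const 0%N)) => q.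
  by apply: D0_saturated; rewrite -['X__]expr1; apply: Xn_neq0.
split=> // i.
(* A zero differential has the basis vectors in its kernel, but minimality allows only kernel
   elements without constant terms; so its source has rank 0. *)
have ker_all i' : (forall u : 'rV_(size (gfc_shift F i'.+1)), u *m gfc_diff F i' = 0) ->
    size (gfc_shift F i'.+1) = 0%N.
  move=> H; apply/eqP; rewrite -leqn0 leqNgt; apply/negP => lt.
  exact: (@unit_row_constant_term _ (Ordinal lt)) (ker_const _ _ (H _)).
elim: i => [|i IH]; apply: ker_all => u; last by move: (_ *m _); rewrite IH => x; apply: thinmx0.
by apply/inj0/exS; exists u.
Qed.

Lemma D0_graded : graded (fun=> 0) (fun x => D0 alpha x).
Proof.
move=> e x Dx; have -> : hcomp_row (fun=> 0) e x = hcomp_mx (fun _ _ => e) x.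
  by apply/rowP => l; rewrite hcomp_mxE mxE subr0.
exact: D0_hcomp.
Qed.

Lemma exists_minimal_resolution : exists F : graded_free_complex K 3 3,
  minimal_graded_free_resolution F (D0 alpha).
Proof.
have [s0 [A [hA genA minA]]] := exists_minimal_generators D0_submodule D0_graded.
have sub1 : is_submodule (fun u => u *m A = 0).
  split; first exact: mul0mx.
    by move=> u w uA wA; rewrite mulmxDl uA wA addr0.
  by move=> c u uA; rewrite -scalemxAl uA scaler0.
have gr1 : graded (fun i : 'I_(size s0) => nth 0 s0 i) (fun u => u *m A = 0).
  by move=> e u uA; rewrite (hcomp_row_mulmx _ _ hA) uA hcomp_row0.
have [s1 [B [hB genB minB]]] := exists_minimal_generators sub1 gr1.
have injB (u : 'rV_(size s1)) : u *m B = 0 -> u = 0.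
  apply: (second_syzygy_free _ genA genB minB) => q.
  by apply: D0_saturated; rewrite -['X__]expr1; apply: Xn_neq0.
pose sh i := if i is i'.+1 then if i' is 0%N then s1 else [::] else s0.
pose df i : 'M[S]_(size (sh i.+1), size (sh i)) :=
  match i return 'M[S]_(size (sh i.+1), size (sh i)) with 0%N => B | _ => 0 end.
exists (@GradedFreeComplex K 3 3 sh df A); split.
- split=> [[|i] k l|k l] /=; first exact: hB.
    by rewrite mxE; apply: homog0.
  by have := hA k l; rewrite subr0.
- split=> [x|u|[|i] u] /=; [exact: genA | exact: genB | |].
    split=> [/injB->|[w ->]]; first by exists 0; rewrite mul0mx.
    by rewrite !mulmx0 mul0mx.
  by split=> _; [exists 0; rewrite [u]thinmx0 mul0mx | rewrite mulmx0].
case=> [|i] k l /=; last by rewrite mxE mcoeff0.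
have -> : B k l = row k B 0 l by rewrite mxE.
by apply: minA; apply/genB; apply: span_row.
Qed.

End Resolutions.

Section Regularity.
Variables (K : fieldType) (n : nat) (alpha : 'I_n -> 'rV[K]_3).
Hypotheses (arr : line_arrangement alpha) (n_neq0 : n%:R != 0 :> K).
Hypothesis irr : irreducible_arrangement alpha.
Local Notation S := {mpoly K[3]}.

(** If all lines pass through p, linearity at p is already global. *)
Lemma nontrivial_essential lam : locally_linear alpha lam -> ~ trivial_values alpha lam ->
  essential alpha.
Proof.
move=> LL nt p p0; apply: NNPP => H; apply: nt; have [v Hv] := LL p p0.
exists v => i; apply: Hv; apply/eqP/negPn/negP => ip; apply: H; exists i.
exact: ip.
Qed.

Section FixedResolution.
Variable F : graded_free_complex K 3 3.
Hypothesis resF : minimal_graded_free_resolution F (D0 alpha).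
Local Notation d i := (nth 0 (gfc_shift F 0) i).
Local Notation e j := (nth 0 (gfc_shift F 1) j).

(* A generator of maximal degree that is involved in no syzygy would split off, giving a nonzero element of D0 of degree at most 1. *)
Lemma generator_degree_bound (b : int) : essential alpha -> n%:Z - 2 <= b ->
  (forall j : 'I_(size (gfc_shift F 1)), e j <= b) ->
  forall i : 'I_(size (gfc_shift F 0)), d i < b.
Proof.
move=> ess bn eb i; rewrite ltNge; apply/negP => bd.
have [[hB hA] [genA exB _] minF] := resF.
(* The entry has degree e_j - d_i, at most 0, and minimality excludes nonzero constants. *)
have Bi j : gfc_diff F 0 j i = 0.
  have hji := hB 0%N j i; have [lt0|] := ltP (e j - d i) 0; first exact: homog_neg hji lt0.
  move=> ge0; have E0 : e j - d i = 0 by have := eb j; lia.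
  by rewrite E0 in hji; rewrite (homog_const hji) minF mpolyC0.
have [w [Dw w0 hw]] := isolated_generator arr n_neq0 genA exB hA Bi.
case/eqP: w0; apply: (D0_degree_le1 arr n_neq0 irr ess Dw _ hw).
(* The degree n - 1 - d_i is at most 1, as d_i >= b >= n - 2. *)
by lia.
Qed.

Lemma regularity_of_nontrivial lam : locally_linear alpha lam -> ~ trivial_values alpha lam ->
  (exists i j, betti F i j != 0%N /\ n%:Z - 2 = j - i%:Z) /\
  (forall i j, betti F i j != 0%N -> j - i%:Z <= n%:Z - 2).
Proof.
move=> LL nt; have ess := nontrivial_essential LL nt.
have [[hB hA] [genA exB _] minF] := resF.
have [injB sh2] := resolution_length_le1 resF.
have upper := shift_upper_bound arr n_neq0 genA exB injB hA (hB 0%N) (minF 0%N).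
have [j0 ej0] := shift_lower_bound arr n_neq0 genA exB hA (hB 0%N) LL nt.
split.
  exists 1%N, (n%:Z - 1); split; last by ring.
  by apply/betti_neq0; exists j0; have [] := upper j0 ej0.
have eb (j : 'I_(size (gfc_shift F 1))) : e j <= n%:Z - 1.
  rewrite leNgt; apply/negP => lt; have [Ej _] := upper j (ltW lt).
  by have := lt_irreflexive (n%:Z - 1); rewrite -{2}Ej lt.
move=> [|[|i]] j /betti_neq0[l <-].
- have := @generator_degree_bound (n%:Z - 1) ess _ eb l; lia.
- have := eb l; lia.
- by case: l => l; rewrite sh2.
Qed.

Lemma nontrivial_of_regularity :
  (exists i j, betti F i j != 0%N /\ n%:Z - 2 = j - i%:Z) ->
  (forall i j, betti F i j != 0%N -> j - i%:Z <= n%:Z - 2) ->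
  exists2 lam, locally_linear alpha lam & ~ trivial_values alpha lam.
Proof.
move=> [i [j [/betti_neq0[l El] Eij]]] bound.
have [[hB hA] [genA exB _] minF] := resF.
have [injB sh2] := resolution_length_le1 resF.
have upper := shift_upper_bound arr n_neq0 genA exB injB hA (hB 0%N) (minF 0%N).
have db (k : 'I_(size (gfc_shift F 0))) : d k <= n%:Z - 2.
  by have := bound 0%N (d k); rewrite subr0; apply; apply/betti_neq0; exists k.
have ess : essential alpha.
  move=> p p0; apply: NNPP => H; case/eqP: p0.
  apply: (generators_of_pencil arr n_neq0 genA hA db) => k.
  by apply/eqP/negPn/negP => kp; apply: H; exists k.
have [[k ek]|H] := classic (exists k : 'I_(size (gfc_shift F 1)), n%:Z - 1 <= e k).
  by have [] := upper k ek.
have eb (k : 'I_(size (gfc_shift F 1))) : e k <= n%:Z - 2.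
  rewrite leNgt; apply/negP => lt; apply: H; exists k; lia.
(* Without a shift n - 1 in F1 the value n - 2 could only be attained by a generator of degree n -
   2, which [generator_degree_bound] with b = n - 2 forbids. *)
case: i => [|[|i]] in l El Eij *.
- have := @generator_degree_bound _ ess (lexx _) eb l; lia.
- have := eb l; lia.
- by case: l El => l; rewrite sh2.
Qed.

End FixedResolution.
End Regularity.

(** Here Q = 1 and D0 = S^3, whereas regularity -2 would make all generator degrees negative and the
    augmentation 0. *)
Lemma regularity_empty (K : fieldType) (alpha : 'I_0 -> 'rV[K]_3) :
  ~ has_regularity (D0 alpha) (0%:Z - 2).
Proof.
case=> F [[_ hA] [genA _ _] _] [_ bound].
have A0 : gfc_aug F = 0.
  apply/matrixP => i l; rewrite mxE; apply: homog_neg (hA i l) _.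
  have := bound 0%N (nth 0 (gfc_shift F 0) i); rewrite subr0 => le2.
  by apply: le_lt_trans (le2 _) _ => //; apply/betti_neq0; exists i.
have : D0 alpha (delta_mx 0 0).
  by apply/D0P; rewrite /defining_poly big_ord0 derivation_apply1.
case/genA => u /rowP/(_ 0); rewrite A0 mulmx0 !mxE !eqxx => /eqP.
by rewrite oner_eq0.
Qed.

Theorem corollary7p8 (K : fieldType) (charK0 : [pchar K] =i pred0)
    (n : nat) (alpha : 'I_n -> 'rV[K]_3) (alpha0 : 'rV[K]_3)
    (arr : line_arrangement alpha)
    (irr : irreducible_arrangement alpha)
    (gen0 : generic_line alpha alpha0) :
  (~ formal alpha <-> has_nontrivial_weak_perspective alpha alpha0) /\
  (has_nontrivial_weak_perspective alpha alpha0 <->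
   has_regularity (D0 alpha) (n%:Z - 2)).
Proof.
split; first exact: not_formal_perspective.
rewrite (nontrivial_perspectiveP arr gen0).
(* For n = 0 the splitting off of E fails, but both sides are false: values on no lines are
   trivial. *)
have [n0|n0] := eqVneq n 0%N.
  subst n; split=> [[lam _ []]|/regularity_empty//].
  by exists 0; case.
have n_neq0 : n%:R != 0 :> K by rewrite ((pcharf0P K).1 charK0).
split=> [[lam LL nt]|[F resF [att bound]]].
  have [F resF] := exists_minimal_resolution alpha.
  by exists F => //; apply: regularity_of_nontrivial LL nt.
exact: nontrivial_of_regularity resF att bound.
Qed.
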